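(* Let $D$ be an oriented link diagram in the interior of a compact oriented surface $F$ (possibly with boundary), or on the plane, and let $(X,T)$ be a finite KTQ. Then the number of KTQ-colorings of $D$ by $(X,T)$ does not change under Reidemeister moves.
   Context: A ternary quasigroup is a set $X$ with $T\colon X^3\to X$ such that in the equation $T(x_1,x_2,x_3)=x_4$ any three of $x_1,x_2,x_3,x_4\in X$ determine the remaining one uniquely. A knot-theoretic ternary quasigroup (KTQ) is a ternary quasigroup satisfying, for all $a,b,c,d\in X$: (A1) $T(T(a,b,c),c,d)=T\big(T(a,b,T(b,c,d)),\,T(b,c,d),\,d\big)$; (A2) $T(a,b,T(b,c,d))=T\big(a,\,T(a,b,c),\,T(T(a,b,c),c,d)\big)$. Regions of $D$ are the connected components of $F$ (or $\mathbb{R}^2$) minus the universe (underlying $4$-valent curve) of $D$. Co-orient each arc of $D$ by the normal pointing to the left of its direction (so (tangent, normal) is a positive frame). At a crossing there are four corners. The source corner is the one with all co-orientation arrows pointing out of it, the target corner the one with all arrows pointing into it. The ascending path of the crossing is the triple $(r_1,r_2,r_3)$ where $r_1$ is the source corner, $r_2$ is the corner separated from $r_1$ by an under-arc, and $r_3$ is the target corner; let $r_4$ be the fourth corner (separated from $r_1$ by the over-arc). Thus $r_4$ is the corner between the two outgoing edges if the crossing is positive, and the corner between the two incoming edges if it is negative. A KTQ-coloring of $D$ is a function $c$ from the set of regions of $D$ to $X$ such that $c(r_4)=T(c(r_1),c(r_2),c(r_3))$ at every crossing (a corner has the color of the region containing it). *)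

(* Defs.v *)
From HB Require Import structures.
From mathcomp Require Import all_boot all_order all_algebra.
From mathcomp Require Import all_classical all_reals all_analysis.

Set Implicit Arguments.
Unset Strict Implicit.
Unset Printing Implicit Defensive.

Import Order.TTheory GRing.Theory Num.Theory.
Import numFieldNormedType.Exports.

Local Open Scope classical_set_scope.
Local Open Scope ring_scope.

Definition ternary_quasigroup (X : Type) (T : X -> X -> X -> X) : Prop :=
  [/\ forall x2 x3 x4, exists! x1, T x1 x2 x3 = x4,
      forall x1 x3 x4, exists! x2, T x1 x2 x3 = x4 &
      forall x1 x2 x4, exists! x3, T x1 x2 x3 = x4].

Definition ktq (X : Type) (T : X -> X -> X -> X) : Prop :=
  [/\ ternary_quasigroup T,
      forall a b c d,
        T (T a b c) c d = T (T a b (T b c d)) (T b c d) d &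
      forall a b c d,
        T a b (T b c d) = T a (T a b c) (T (T a b c) c d)].

Notation plane R := (R * R)%type.

Definition det2 (R : realType) (v w : plane R) : R := v.1 * w.2 - v.2 * w.1.

Definition half_plane (R : realType) : set (plane R) := [set p | 0 <= p.2].

Definition homeo_between (T U : topologicalType) (A : set T) (B : set U)
    (f : T -> U) (g : U -> T) : Prop :=
  [/\ {within A, continuous f}, {within B, continuous g},
      forall x, A x -> B (f x) /\ g (f x) = x &
      forall y, B y -> A (g y) /\ f (g y) = y].

(* [param] and [coord] are only meaningful on [cdom] and [ccod]. *)
Record chart (R : realType) (F : topologicalType) := Chart {
  cdom : set (plane R);
  ccod : set F;
  param : plane R -> F;
  coord : F -> plane R }.

Definition is_chart (R : realType) (F : topologicalType) (c : chart R F) :=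
  [/\ open (cdom c), open (ccod c) &
      homeo_between (cdom c) (ccod c) (param c) (coord c)].

(* C^1 with positive Jacobian determinant at every point of A. *)
Definition C1_positive (R : realType) (A : set (plane R))
    (f : plane R -> plane R) : Prop :=
  forall p, A p ->
    [/\ differentiable f p,
        forall v, {for p, continuous (fun q => 'd f q v)} &
        0 < det2 ('d f p (1, 0)) ('d f p (0, 1))].

(* The map h : F -> F' read in the charts c and c'. *)
Definition C1_positive_in (R : realType) (F F' : topologicalType)
    (c : chart R F) (c' : chart R F') (h : F -> F') : Prop :=
  C1_positive (cdom c `&` [set p | ccod c' (h (param c p))])
              (fun p => coord c' (h (param c p))).

Definition manifold_interior (R : realType) (F : topologicalType) : set F :=
  [set x | exists2 c : chart R F, is_chart c & ccod c x].

(* A surface, possibly with boundary and possibly disconnected, whose interior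
   carries an oriented C^1 atlas; the boundary is only topological.  Second
   countability is not required: it is automatic for compact F. *)
Record oriented_surface (R : realType) := OrientedSurface {
  carrier :> topologicalType;
  atlas : set (chart R carrier);
  surface_hausdorff : hausdorff_space carrier;
  surface_local : forall x : carrier,
    exists (O : set (plane R)) (B : set carrier)
           (f : plane R -> carrier) (g : carrier -> plane R),
      [/\ open O, open B, B x & homeo_between (O `&` @half_plane R) B f g];
  atlas_chart : forall c, atlas c -> is_chart c;
  atlas_cover : forall x : carrier,
    @manifold_interior R carrier x <-> exists2 c, atlas c & ccod c x;
  atlas_compatible : forall c c', atlas c -> atlas c' ->
    C1_positive_in c c' id }.

(* Membership in the maximal oriented atlas. *)
Definition positive_chart (R : realType) (S : oriented_surface R)
    (c : chart R S) : Prop :=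
  is_chart c /\
  forall c', atlas c' -> C1_positive_in c c' id /\ C1_positive_in c' c id.

Section PlaneSurface.
Variable R : realType.

Definition plane_chart : chart R (plane R) := Chart setT setT id id.

Lemma homeo_between_continuous (T U : topologicalType) (A : set T) (B : set U)
    (f : T -> U) (g : U -> T) : continuous f -> continuous g ->
  (forall x, A x -> B (f x)) -> (forall y, B y -> A (g y)) ->
  cancel f g -> cancel g f -> homeo_between A B f g.
Proof.
move=> cf cg AB BA fK gK; split.
- exact: continuous_subspaceT.
- exact: continuous_subspaceT.
- by move=> x /AB.
- by move=> y /BA.
Qed.

Lemma plane_chartP : is_chart plane_chart.
Proof.
split; [exact: openT|exact: openT|].
by apply: homeo_between_continuous => //= x; exact: cvg_id.
Qed.

Lemma plane_hausdorff : hausdorff_space (plane R).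
Proof. exact: norm_hausdorff. Qed.

Lemma plane_local (x : plane R) :
  exists (O : set (plane R)) (B : set (plane R)) (f g : plane R -> plane R),
    [/\ open O, open B, B x & homeo_between (O `&` @half_plane R) B f g].
Proof.
have cadd (v : plane R) : continuous (fun p : plane R => p + v).
  by move=> p; apply: cvgD; [exact: cvg_id|exact: cvg_cst].
have oup (r : R) : open [set p : plane R | r < p.2].
  apply: (@open_comp _ _ snd [set t | r < t]); last exact: open_gt.
  by move=> p _; exact: cvg_snd.
exists [set p | 0 < p.2], [set p | x.2 - 1 < p.2],
  (fun p => p + (x - (0, 1))), (fun p => p - (x - (0, 1))).
split=> //=.
  by rewrite ltrBlDr ltrDl ltr01.
apply: homeo_between_continuous => //.
- by move=> p [/= p0 _]; rewrite ltrDr.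
- by move=> p /= xp; split; rewrite /half_plane /= ?subr_gt0 // ltW // subr_gt0.
- by move=> p; rewrite addrK.
- by move=> p; rewrite subrK.
Qed.

Lemma plane_cover (x : plane R) :
  @manifold_interior R (plane R) x <->
  exists2 c, [set plane_chart] c & ccod c x.
Proof.
by split=> _; exists plane_chart => //; exact: plane_chartP.
Qed.

Lemma plane_compatible (c c' : chart R (plane R)) :
  [set plane_chart] c -> [set plane_chart] c' -> C1_positive_in c c' id.
Proof.
move=> -> -> p _; split=> /=.
- exact: ex_diff.
- move=> v; rewrite (_ : (fun q => _) = cst v); first exact: cvg_cst.
  by apply/funext => q; rewrite (@diff_val _ _ _ _ _ _ _ (is_diff_id q)).
- by rewrite (@diff_val _ _ _ _ _ _ _ (is_diff_id p)) /det2 /= mulr1 mulr0 subr0 ltr01.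
Qed.

Definition plane_surface : oriented_surface R :=
  @OrientedSurface R (plane R) [set plane_chart] plane_hausdorff plane_local
    (fun c (Hc : [set plane_chart] c) =>
       eq_ind_r (@is_chart R (plane R)) plane_chartP Hc)
    plane_cover plane_compatible.

End PlaneSurface.

Definition velocity (R : realType) (F : topologicalType) (c : chart R F)
    (g : R -> F) (t : R) : plane R := derive1 (coord c \o g) t.

(* Points of the disjoint union of n circles R/Z are represented by pairs (i, t)
   with i < n and t : R. *)
Definition same_point (R : realType) (n : nat) (i : 'I_n) (t : R)
    (j : 'I_n) (u : R) : Prop :=
  i = j /\ exists z : int, u = t + z%:~R.

Definition double_point (R : realType) (F : Type) (n : nat)
    (g : 'I_n -> R -> F) (i : 'I_n) (t : R) (j : 'I_n) (u : R) : Prop :=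
  g i t = g j u /\ ~ same_point i t j u.

(* An n-component diagram: a generic C^1 immersion of n oriented circles into
   the interior of S, with one of the two preimages of each crossing marked as
   the over one. *)
Record diagram (R : realType) (S : oriented_surface R) (n : nat) := Diagram {
  curve : 'I_n -> R -> S;
  over : 'I_n -> R -> Prop;
  curve_periodic : forall i t, curve i (t + 1) = curve i t;
  curve_continuous : forall i, continuous (curve i);
  curve_interior : forall i t, @manifold_interior R S (curve i t);
  curve_immersed : forall i t c, atlas c -> ccod c (curve i t) ->
    [/\ derivable (coord c \o curve i) t 1,
        {for t, continuous (velocity c (curve i))} &
        velocity c (curve i) t != 0];
  curve_no_triple : forall i t j u k s,
    double_point curve i t j u -> double_point curve i t k s ->
    same_point j u k s;
  curve_transverse : forall i t j u c,
    double_point curve i t j u -> atlas c -> ccod c (curve i t) ->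
    det2 (velocity c (curve i) t) (velocity c (curve j) u) != 0;
  curve_finite : finite_set
    [set x : S | exists i t j u, double_point curve i t j u /\ x = curve i t];
  over_double : forall i t, over i t ->
    exists j u, double_point curve i t j u;
  over_same : forall i t j u, same_point i t j u -> over i t -> over j u;
  over_one : forall i t j u, double_point curve i t j u ->
    (over i t <-> ~ over j u) }.

Definition universe (R : realType) (S : oriented_surface R) (n : nat)
    (D : diagram S n) : set S :=
  [set x | exists i t, x = curve D i t].

Definition regions (R : realType) (S : oriented_surface R) (n : nat)
    (D : diagram S n) : set (set S) :=
  [set r | exists2 x, ~ universe D x &
     r = connected_component (~` universe D) x].

Inductive side := onleft | onright.

Definition on_side (R : realType) (v : plane R) (s : side) (d : plane R) :=
  match s with
  | onleft => 0 < det2 v d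
  | onright => det2 v d < 0
  end.

(* At a crossing x whose over (resp. under) strand has velocity v (resp. w) in
   the chart c, the four corners are told apart by the sides of the over strand
   and of the under strand on which they lie.  The corner on side so of the over
   strand and su of the under strand lies in r when r contains the start of some
   ray issued from x into that corner. *)
Definition corner_in (R : realType) (F : topologicalType) (c : chart R F)
    (x : F) (v w : plane R) (so su : side) (r : set F) : Prop :=
  exists d : plane R,
    [/\ on_side v so d, on_side w su d &
        \forall e \near 0^'+, r (param c (coord c x + e *: d))].

(* Normals point to the left, so the source corner r1 is on the right of both
   strands and the target corner r3 on the left of both; r2 (resp. r4) is reached
   from r1 by crossing the under (resp. over) strand. *)
Definition is_coloring (R : realType) (S : oriented_surface R) (n : nat)
    (D : diagram S n) (X : Type) (T : X -> X -> X -> X)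
    (col : regions D -> X) : Prop :=
  forall (i : 'I_n) (t : R) (j : 'I_n) (u : R) (c : chart R S),
    double_point (curve D) i t j u -> over D i t ->
    atlas c -> ccod c (curve D i t) ->
    let corner so su (r : regions D) :=
      corner_in c (curve D i t) (velocity c (curve D i) t)
        (velocity c (curve D j) u) so su (\val r) in
    forall r1 r2 r3 r4 : regions D,
      corner onright onright r1 -> corner onright onleft r2 ->
      corner onleft onleft r3 -> corner onleft onright r4 ->
      col r4 = T (col r1) (col r2) (col r3).

Definition colorings (R : realType) (S : oriented_surface R) (n : nat)
    (D : diagram S n) (X : Type) (T : X -> X -> X -> X) :
    set (regions D -> X) :=
  [set col | is_coloring T col].

Arguments colorings {R S n} D {X} T.

Definition oriented_diffeo (R : realType) (S : oriented_surface R)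
    (h : S -> S) : Prop :=
  exists k : S -> S,
    [/\ continuous h, continuous k, cancel h k, cancel k h &
        forall c c' : chart R S, atlas c -> atlas c' ->
          C1_positive_in c c' h /\ C1_positive_in c c' k].

Definition isotopic_to_id (R : realType) (S : oriented_surface R)
    (h : S -> S) : Prop :=
  exists H : R -> S -> S,
    [/\ {within [set x : R * S | 0 <= x.1 <= 1],
           continuous (fun x : R * S => H x.1 x.2)},
        forall x, H 0 x = x, forall x, H 1 x = h x &
        forall s, 0 <= s <= 1 -> oriented_diffeo (H s)].

Definition circle_reparam (R : realType) (f : R -> R) : Prop :=
  forall t, [/\ derivable f t 1, 0 < derive1 f t & f (t + 1) = f t + 1].

(* Diagrams are compared up to ambient isotopy, orientation-preserving
   reparametrization and renumbering of the components. *)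
Definition isotopy_move (R : realType) (S : oriented_surface R) (n : nat)
    (D D' : diagram S n) : Prop :=
  exists (h : S -> S) (p : 'I_n -> 'I_n) (f : 'I_n -> R -> R),
    [/\ isotopic_to_id h, injective p, forall i, circle_reparam (f i),
        forall i t, curve D' i t = h (curve D (p i) (f i t)) &
        forall i t, over D' i t <-> over D (p i) (f i t)].

(* Reidemeister moves.  Each move takes place in a disc [param c @` K], K a
   rectangle of a positive chart c, which both diagrams meet in m strands, the
   k-th one being the image of the parameter interval [a k, b k] of the component
   comp k.  Orientations of the strands are arbitrary. *)

Definition rect (R : realType) (x0 x1 y0 y1 : R) : set (plane R) :=
  [set p | x0 <= p.1 <= x1 /\ y0 <= p.2 <= y1].

Definition meets_in_strands (R : realType) (S : oriented_surface R) (n : nat)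
    (D : diagram S n) (c : chart R S) (K : set (plane R)) (m : nat)
    (comp : 'I_m -> 'I_n) (a b : 'I_m -> R) : Prop :=
  forall i t, (param c @` K) (curve D i t) <->
    exists (k : 'I_m) (z : int), comp k = i /\ a k <= t + z%:~R <= b k.

Definition supported_in (R : realType) (S : oriented_surface R) (n : nat)
    (D D' : diagram S n) (c : chart R S) (K : set (plane R)) (m : nat)
    (comp : 'I_m -> 'I_n) (a b : 'I_m -> R) : Prop :=
  [/\ positive_chart c /\ K `<=` cdom c,
      forall k, a k < b k < a k + 1,
      meets_in_strands D c K comp a b,
      meets_in_strands D' c K comp a b &
      forall i t,
        ~ (exists (k : 'I_m) (z : int), comp k = i /\ a k < t + z%:~R < b k) ->
        curve D i t = curve D' i t /\ (over D i t <-> over D' i t)].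

(* On [a, b] the curve g runs once, in either direction, through the plane curve
   P restricted to [lo, hi], transported by the chart c. *)
Definition traces (R : realType) (F : topologicalType) (c : chart R F)
    (g : R -> F) (a b : R) (P : R -> plane R) (lo hi : R) : Prop :=
  exists s : R -> R,
    [/\ {within `[a, b], continuous s},
        [/\ s a = lo, s b = hi & {in `[a, b] &, {homo s : x y / x < y}}] \/
        [/\ s a = hi, s b = lo & {in `[a, b] &, {homo s : x y /~ x < y}}] &
        forall t, a <= t <= b -> g t = param c (P (s t))].

Definition graph_of (R : realType) (f : R -> R) (x : R) : plane R := (x, f x).

Definition graph_in (R : realType) (f : R -> R) (x0 x1 y0 y1 : R) : Prop :=
  (forall x, x0 <= x <= x1 -> y0 < f x < y1) /\
  (forall x, x0 < x < x1 -> derivable f x 1).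

(* A plane curve with a single double point, at s = -1 and s = 1. *)
Definition curl (R : realType) (s : R) : plane R := (s ^+ 3 - s, s ^+ 2).

Definition R1_move (R : realType) (S : oriented_surface R) (n : nat)
    (D D' : diagram S n) : Prop :=
  exists (c : chart R S) (i : 'I_n) (a b : R) (f : R -> R),
    [/\ supported_in D D' c (rect (-6) 6 (-1) 5)
          (fun _ : 'I_1 => i) (fun _ => a) (fun _ => b),
        graph_in f (-6) 6 (-1) 5,
        traces c (curve D i) a b (graph_of f) (-6) 6 &
        traces c (curve D' i) a b (@curl R) (-2) 2].

(* In the rectangle [-1, 1] x [-1, 1] the strands of D (resp. D') are the graphs
   of the functions f k (resp. f' k). *)
Definition graph_move (R : realType) (S : oriented_surface R) (n : nat)
    (D D' : diagram S n) (m : nat) (c : chart R S)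
    (comp : 'I_m -> 'I_n) (a b : 'I_m -> R) (f f' : 'I_m -> R -> R) : Prop :=
  supported_in D D' c (rect (-1) 1 (-1) 1) comp a b /\
  forall k : 'I_m,
    [/\ graph_in (f k) (-1) 1 (-1) 1, graph_in (f' k) (-1) 1 (-1) 1,
        traces c (curve D (comp k)) (a k) (b k) (graph_of (f k)) (-1) 1 &
        traces c (curve D' (comp k)) (a k) (b k) (graph_of (f' k)) (-1) 1].

(* Strand k passes over strand l wherever they cross. *)
Definition strand_above (R : realType) (S : oriented_surface R) (n : nat)
    (D : diagram S n) (m : nat) (comp : 'I_m -> 'I_n) (a b : 'I_m -> R)
    (k l : 'I_m) : Prop :=
  forall t u, a k <= t <= b k -> a l <= u <= b l ->
    curve D (comp k) t = curve D (comp l) u -> over D (comp k) t.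

Definition R2_move (R : realType) (S : oriented_surface R) (n : nat)
    (D D' : diagram S n) : Prop :=
  exists (c : chart R S) (comp : 'I_2 -> 'I_n) (a b : 'I_2 -> R)
         (f f' : 'I_2 -> R -> R) (p q : R),
    let f0 := f (inord 0) in let f1 := f (inord 1) in
    let g0 := f' (inord 0) in let g1 := f' (inord 1) in
    [/\ graph_move D D' c comp a b f f',
        forall x, -1 <= x <= 1 -> f0 x < f1 x,
        [/\ -1 < p, p < q & q < 1],
        [/\ g0 p = g1 p, g0 q = g1 q,
            forall x, -1 <= x < p -> g0 x < g1 x,
            forall x, p < x < q -> g1 x < g0 x &
            forall x, q < x <= 1 -> g0 x < g1 x] &
        strand_above D' comp a b (inord 0) (inord 1) \/
        strand_above D' comp a b (inord 1) (inord 0)].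

(* On [-1, 1] the graph of f passes from below to above the graph of g, at p. *)
Definition cross_at (R : realType) (f g : R -> R) (p : R) : Prop :=
  [/\ -1 < p < 1, f p = g p,
      forall x, -1 <= x < p -> f x < g x &
      forall x, p < x <= 1 -> g x < f x].

Definition R3_move (R : realType) (S : oriented_surface R) (n : nat)
    (D D' : diagram S n) : Prop :=
  exists (c : chart R S) (comp : 'I_3 -> 'I_n) (a b : 'I_3 -> R)
         (f f' : 'I_3 -> R -> R) (p01 p02 p12 q01 q02 q12 : R)
         (height : 'I_3 -> nat),
    let f0 := f (inord 0) in let f1 := f (inord 1) in
    let f2 := f (inord 2) in
    let g0 := f' (inord 0) in let g1 := f' (inord 1) in
    let g2 := f' (inord 2) in
    [/\ graph_move D D' c comp a b f f',
        [/\ cross_at f0 f1 p01, cross_at f0 f2 p02, cross_at f1 f2 p12,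
            p01 < p02 & p02 < p12],
        [/\ cross_at g0 g1 q01, cross_at g0 g2 q02, cross_at g1 g2 q12,
            q12 < q02 & q02 < q01],
        injective height &
        forall k l, (height l < height k)%N ->
          strand_above D comp a b k l /\ strand_above D' comp a b k l].

Definition reidemeister_move (R : realType) (S : oriented_surface R) (n : nat)
    (D D' : diagram S n) : Prop :=
  [\/ isotopy_move D D', R1_move D D' \/ R1_move D' D,
      R2_move D D' \/ R2_move D' D | R3_move D D' \/ R3_move D' D].

(* Main.v *)
From Pilot Require Import Defs.
From HB Require Import structures.
From mathcomp Require Import all_boot all_order all_algebra.
From mathcomp Require Import all_classical all_reals all_analysis.
From mathcomp Require Import ring lra zify.
Import Pilot.Defs.
Set Implicit Arguments.
Unset Strict Implicit.
Unset Printing Implicit Defensive.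
Import Order.TTheory GRing.Theory Num.Theory.
Import numFieldNormedType.Exports.
Local Open Scope classical_set_scope.
Local Open Scope ring_scope.

(** A region coloring is the same thing as a map on the surface that is locally
constant off the universe and satisfies the equation at every crossing along rays
issued from it ([point_coloring]). Such maps can be transported and pasted, so a
move is treated by relating the point colorings of the two diagrams
([colorings_card_le]).

For an ambient isotopy, the final diffeomorphism carries regions to regions. The
corners are tested along straight rays of a chart, which the diffeomorphism bends;
but a thin cone around a ray transverse to both strands avoids the universe
([cone_off]), so a bent ray and its tangent end in the same region.

A Reidemeister move changes the diagram in a disc only. Inside the disc the regions
are sorted into types (which strands a point lies above), and a coloring becomes a
coloring of the types subject to one equation per crossing. In each move the
equations of both sides can be completed into the same set of rules on the same
types, a type that is missing on one side receiving the color that the rules force.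
Reading one coloring of the types through the regions of the other side then gives
the corresponding coloring, and the boundary of the disc determines it
([local_move_le]).

In the first move the equation at the new crossing determines the color of the loop.
In the second one the two crossings impose one and the same equation, which
determines the color of the bigon and makes the two strips at its ends equally
colored. In the third move the eight types are the vertices of a cube whose
two-dimensional faces are the possible crossings: the strands of one side give the
three faces at a vertex, those of the other side the three faces at the opposite
vertex, and the two KTQ axioms make either three faces imply all six ([cube_complete]). *)

(** * Locally constant maps, charts and regions *)

(** Local constancy is required only relative to [A]; this is the form in which a
map defined piece by piece, or only along a path, can be fed to connectedness.
*)
Lemma locally_constant_connected (Z : topologicalType) (Y : Type) (A : set Z)
    (phi : Z -> Y) : connected A ->
  (forall x, A x -> \forall y \near x, A y -> phi y = phi x) ->
  forall x y, A x -> A y -> phi x = phi y.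
Proof.
move=> cA lc x y Ax Ay.
suff : A `&` [set z | phi z = phi x] = A by rewrite predeqE => /(_ y) -[_ /(_ Ay) []].
apply: cA; first by exists x.
- exists (interior [set z | A z -> phi z = phi x]); first exact: open_interior.
  rewrite predeqE => z; split=> [[Az zx]|[Az /interior_subset /(_ Az)]] //.
  by split=> //; near=> t => At; rewrite (near (lc _ Az) t).
- exists (~` interior [set z | A z -> phi z <> phi x]).
    exact/open_closedC/open_interior.
  rewrite predeqE => z; split=> [[Az zx]|[Az nz]].
    by split=> // /interior_subset /(_ Az).
  split=> //; apply: contrapT => zx; apply: nz.
  by near=> t => At; rewrite (near (lc _ Az) t).
Unshelve. all: by end_near.
Qed.

Lemma locally_constant_segment (R : realType) (Y : Type) (a b : R)
    (g : R -> Y) : a <= b ->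
  (forall u, a <= u <= b -> \forall v \near u, a <= v <= b -> g v = g u) ->
  g a = g b.
Proof.
move=> ab lc; apply: (@locally_constant_connected _ _ `[a, b]%classic g).
- exact: segment_connected.
- by move=> x; rewrite /= in_itv /= => /lc; apply: filterS => y; rewrite in_itv.
- by rewrite /= in_itv /= lexx ab.
- by rewrite /= in_itv /= lexx ab.
Qed.

Section Charts.
Variables (R : realType) (F : topologicalType).
Implicit Type c : chart R F.

Lemma chart_param c p : is_chart c -> cdom c p ->
  ccod c (param c p) /\ coord c (param c p) = p.
Proof. by move=> [_ _ [_ _ + _]] => /[apply]. Qed.

Lemma chart_coord c x : is_chart c -> ccod c x ->
  cdom c (coord c x) /\ param c (coord c x) = x.
Proof. by move=> [_ _ [_ _ _ +]] => /[apply]. Qed.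

Lemma param_continuous c p : is_chart c -> cdom c p ->
  param c q @[q --> p] --> param c p.
Proof.
move=> [od _ [+ _ _ _]] dp; rewrite continuous_open_subspace //.
by move/(_ _ (mem_set dp)).
Qed.

Lemma coord_continuous c x : is_chart c -> ccod c x ->
  coord c y @[y --> x] --> coord c x.
Proof.
move=> [_ od [_ + _ _]] dp; rewrite continuous_open_subspace //.
by move/(_ _ (mem_set dp)).
Qed.

(** Parametrizations of charts are open maps: a property of the points of a
surface can be checked near a point in the coordinates of a chart. *)
Lemma param_near c p (P : set F) : is_chart c -> cdom c p ->
  (\forall q \near p, P (param c q)) -> \forall x \near param c p, P x.
Proof.
move=> cc dp HP; have [co cK] := chart_param cc dp.
have H : \forall x \near param c p, P (param c (coord c x)).
  by move: (coord_continuous cc co); rewrite cK; move/(_ _ HP).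
have [_ oc _] := cc.
have {}oc : \forall x \near param c p, ccod c x by exact: open_nbhs_nbhs.
near=> x.
have /(chart_coord cc)[_ <-] : ccod c x by near: x.
by near: x.
Unshelve. all: by end_near.
Qed.

Lemma param_inj c p q : is_chart c -> cdom c p -> cdom c q ->
  param c p = param c q -> p = q.
Proof.
move=> cc /(chart_param cc)[_ pK] /(chart_param cc)[_ qK] pq.
by rewrite -pK pq qK.
Qed.

End Charts.

Section Universe.
Variables (R : realType) (S : oriented_surface R) (n : nat) (D : diagram S n).

Lemma curve_shift i t (z : int) : curve D i (t + z%:~R) = curve D i t.
Proof.
have Hn (m : nat) u : curve D i (u + m%:R) = curve D i u.
  elim: m u => [|m IH] u; first by rewrite addr0.
  by rewrite -natr1 addrA curve_periodic IH.
case: z => m; first exact: Hn.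
by rewrite NegzE mulrNz -(Hn m.+1) subrK.
Qed.

Lemma curve_same i t j u : same_point i t j u -> curve D i t = curve D j u.
Proof. by move=> [-> [z ->]]; rewrite curve_shift. Qed.

(** The universe is a finite union of compact circles in a Hausdorff space. *)
Lemma universe_closed : closed (universe D).
Proof.
have -> : universe D = \bigcup_(i in [set: 'I_n]) (curve D i @` `[0, 1]).
  rewrite predeqE => x; split=> [[i [t ->]]|[i _ [t _ <-]]]; last by exists i, t.
  exists i => //; exists (t - (Num.floor t)%:~R).
    rewrite /= in_itv /= subr_ge0 floor_le /= lerBlDl ltW //.
    by have := floorD1_gt t; rewrite intrD.
  by rewrite -mulrNz curve_shift.
apply: closed_bigcup; first exact: finite_finset.
move=> i _; apply: compact_closed; first exact: surface_hausdorff.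
apply: continuous_compact; last exact: segment_compact.
exact/continuous_subspaceT/curve_continuous.
Qed.

Lemma universeC_near x : ~ universe D x -> \forall y \near x, ~ universe D y.
Proof. by move=> nU; apply: open_nbhs_nbhs; split=> //; exact/closed_openC/universe_closed. Qed.

(** Surfaces are locally connected, at boundary points too: in a ball of the half
plane, two points are joined by a segment. *)
Lemma region_open x : ~ universe D x ->
  \forall y \near x, connected_component (~` universe D) x y.
Proof.
move=> nU.
have [W [B [f [g [oW oB Bx [cf cg fK gK]]]]]] := surface_local x.
have [[Wgx Hgx] fgx] := gK _ Bx.
have : \forall p \near g x, W p /\ (half_plane p -> ~ universe D (f p)).
  apply: filterI; first exact: open_nbhs_nbhs.
  have cfx : f @ within (W `&` @half_plane R) (nbhs (g x)) --> f (g x).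
    by move/subspace_continuousP : cf; apply.
  have {}cfx : within (W `&` @half_plane R) (nbhs (g x)) [set p | ~ universe D (f p)].
    have nu : nbhs (f (g x)) [set y | ~ universe D y].
      by rewrite fgx; exact: universeC_near.
    exact: (cfx _ nu).
  have Wg : \forall p \near g x, W p by exact: open_nbhs_nbhs.
  by apply: filterS2 Wg cfx => p Wp + hp; apply.
move/nbhs_ballP => -[e /= e0 be].
have : \forall y \near x, B y /\ ball (g x) e (g y).
  have By : \forall y \near x, B y by exact: open_nbhs_nbhs.
  apply: filterI => //.
  have cgx : g @ within B (nbhs x) --> g x.
    by move/subspace_continuousP : cg; apply.
  have {}cgx : within B (nbhs x) [set y | ball (g x) e (g y)].
    exact: (cgx _ (nbhsx_ballx (g x) e e0)).
  by apply: filterS2 By cgx => y By; apply.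
apply: filterS => y [By gy].
have [[_ Hgy] fgy] := gK _ By.
pose s (l : R) : plane R := g x + l *: (g y - g x).
have inB l : 0 <= l <= 1 -> [/\ W (s l), half_plane (s l) & ~ universe D (f (s l))].
  move=> /andP[l0 l1].
  have hs : half_plane (s l).
    move: Hgx Hgy; rewrite /half_plane /s /= => Hx Hy.
    rewrite [leRHS](_ : _ = (1 - l) * (g x).2 + l * (g y).2).
      by rewrite addr_ge0 // mulr_ge0 // subr_ge0.
    by rewrite /GRing.scale /=; ring.
  suff /be [Ws] : ball (g x) e (s l) by move=> /(_ hs).
  move: gy => [g1 g2]; split; rewrite /s /=.
  - move: g1; rewrite -!ball_normE /= opprD addNKr normrN => d2.
    rewrite normrZ ger0_norm // distrC.
    by apply: le_lt_trans d2; rewrite -[leRHS]mul1r ler_wpM2r.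
  - move: g2; rewrite -!ball_normE /= opprD addNKr normrN => d2.
    rewrite normrZ ger0_norm // distrC.
    by apply: le_lt_trans d2; rewrite -[leRHS]mul1r ler_wpM2r.
exists (f @` (s @` `[0, 1])).
  split.
  - exists (g x) => //; exists 0; first by rewrite /= in_itv /= lexx ler01.
    by rewrite /s scale0r addr0.
  - by move=> _ [_ [l + <-] <-]; rewrite /= in_itv /= => /inB[].
  - apply: connected_continuous_connected.
      apply: connected_continuous_connected; first exact: segment_connected.
      apply: continuous_subspaceT => l; apply: cvgD; first exact: cvg_cst.
      by apply: cvgZr_tmp; exact: cvg_id.
    apply: continuous_subspaceW cf.
    by move=> _ [l + <-]; rewrite /= in_itv /= => /inB[].
exists (g y); last by [].
exists 1; first by rewrite /= in_itv /= lexx ler01.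
by rewrite /s scale1r addrC subrK.
Qed.

End Universe.

(** * Colorings of regions as colorings of points *)

(** The rays along which [corner_in] explores the corners of a crossing. *)
Definition ray (R : realType) (F : topologicalType) (c : chart R F) (x : F)
  (d : plane R) (e : R) : F := param c (coord c x + e *: d).

Lemma line_continuous (R : realType) (p d : plane R) :
  continuous (fun e : R => p + e *: d).
Proof.
by move=> e; apply: cvgD; [exact: cvg_cst|apply: cvgZr_tmp; exact: cvg_id].
Qed.

Lemma line_cvg0 (R : realType) (p d : plane R) :
  p + e *: d @[e --> (0 : R)] --> p.
Proof. by have := @line_continuous R p d 0; rewrite /continuous_at scale0r addr0. Qed.

Lemma near_right (R : realType) (P : set R) :
  (\forall e \near (0 : R), P e) -> \forall e \near (0 : R)^'+, P e.
Proof. by move=> nP; rewrite near_withinE; apply: filterS nP. Qed.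

Lemma nbhs_right_interval (R : realType) (P : set R) :
  (\forall e \near 0^'+, P e) ->
  exists2 e0 : R, 0 < e0 & forall e, 0 < e < e0 -> P e.
Proof.
rewrite near_withinE => /nbhs_ballP [e0 /= e00 He]; exists e0 => // e /andP[ep e1].
by apply: He => //=; rewrite /ball /= sub0r normrN gtr0_norm.
Qed.

Section PointColorings.
Variables (R : realType) (S : oriented_surface R) (n : nat).
Variables (X : Type) (T : X -> X -> X -> X).
Implicit Types (D : diagram S n) (c : chart R S) (v w : plane R).

(** The data on which the equation at a crossing depends: a chart, the point, and
the velocities of the over and the under strand. *)
Definition crossing D c (x : S) v w : Prop :=
  exists i t j u, [/\ double_point (curve D) i t j u, over D i t,
    atlas c /\ ccod c x, x = curve D i t &
    v = velocity c (curve D i) t /\ w = velocity c (curve D j) u].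

Definition corner v w so su (d : plane R) := on_side v so d /\ on_side w su d.

(** The equation at a crossing, read along rays rather than on regions; it is
required only for rays that stay off the universe, so that it makes sense for
any map on the surface and needs no knowledge of the local shape of the
universe. *)
Definition crossing_rule D (phi : S -> X) c x v w : Prop :=
  forall d1 d2 d3 d4,
    corner v w onright onright d1 -> corner v w onright onleft d2 ->
    corner v w onleft onleft d3 -> corner v w onleft onright d4 ->
    (\forall e \near 0^'+,
      [/\ ~ universe D (ray c x d1 e), ~ universe D (ray c x d2 e),
          ~ universe D (ray c x d3 e) & ~ universe D (ray c x d4 e)]) ->
    \forall e \near 0^'+, phi (ray c x d4 e) =
      T (phi (ray c x d1 e)) (phi (ray c x d2 e)) (phi (ray c x d3 e)).

Definition locally_constant_off D (phi : S -> X) : Prop :=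
  forall x, ~ universe D x -> \forall y \near x, phi y = phi x.

(** Colorings of regions seen as maps on the surface. They can be cut and pasted
along a disc, which colorings of the abstract set of regions cannot. *)
Definition point_coloring D (phi : S -> X) : Prop :=
  locally_constant_off D phi /\
  forall c x v w, crossing D c x v w -> crossing_rule D phi c x v w.

Definition induces D (phi : S -> X) (col : regions D -> X) : Prop :=
  forall x r, \val r x -> phi x = col r.

Lemma region_at D x : ~ universe D x -> exists r : regions D, \val r x.
Proof.
move=> nU.
have rx : regions D (connected_component (~` universe D) x) by exists x.
by exists (SigSub (mem_set rx)); exact: connected_component_refl.
Qed.

Lemma region_component D (r : regions D) x : \val r x ->
  ~ universe D x /\ \val r = connected_component (~` universe D) x.
Proof.
case: r => A /= rA; have [y ny ->] := set_mem rA => yx.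
split; first exact: (connected_component_sub yx).
exact: same_connected_component.
Qed.

Lemma region_inh D (r : regions D) : exists x, \val r x.
Proof.
case: r => A rA; have [y ny /= ->] := set_mem rA.
by exists y; exact: connected_component_refl.
Qed.

Lemma region_eq D (r r' : regions D) x : \val r x -> \val r' x -> r = r'.
Proof.
move=> /region_component[_ rx] /region_component[_ rx'].
by apply: val_inj; rewrite rx rx'.
Qed.

Lemma region_connected D (A : set S) x y (r : regions D) : connected A ->
  A `<=` ~` universe D -> A x -> A y -> \val r x -> \val r y.
Proof.
move=> cA AU Ax Ay /region_component[_ ->].
exact: (connected_component_max Ax AU cA).
Qed.

Lemma locally_constant_off_connected D phi (A : set S) x y :
  locally_constant_off D phi -> connected A -> A `<=` ~` universe D ->
  A x -> A y -> phi x = phi y.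
Proof.
move=> lc cA AU; apply: locally_constant_connected => // z /AU /lc.
by apply: filterS.
Qed.

(** A final segment of a ray that stays off the universe is connected, hence lies
in one region. *)
Lemma ray_tail D c x d : is_chart c -> ccod c x ->
  (\forall e \near 0^'+, ~ universe D (ray c x d e)) ->
  exists r : regions D, \forall e \near 0^'+, \val r (ray c x d e).
Proof.
move=> cc cx nU.
have [oc _ _] := cc.
have dx : \forall p \near coord c x, cdom c p.
  by apply: open_nbhs_nbhs; split=> //; have [] := chart_coord cc cx.
have cvs := @line_cvg0 _ (coord c x) d.
have {dx} dx : \forall e \near 0^'+, cdom c (coord c x + e *: d).
  by apply: near_right; exact: cvs dx.
have : \forall e \near 0^'+, cdom c (coord c x + e *: d) /\
    ~ universe D (ray c x d e) by apply: filterI.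
move=> /nbhs_right_interval [e0 e00 He].
have [r rx] : exists r : regions D, \val r (ray c x d (e0 / 2)).
  by apply: region_at; apply He; lra.
exists r; near=> e.
have e1 : 0 < e < e0 by apply/andP; split; near: e; [exact: nbhs_right_gt|exact: nbhs_right_lt].
apply: (@region_connected D (ray c x d @` `]0, e0[) (ray c x d (e0 / 2))) rx.
- apply: connected_continuous_connected; first exact/connected_intervalP/interval_is_interval.
  apply/continuous_in_subspaceT => u; rewrite inE /= in_itv /= => /He[du _].
  apply: (@continuous_comp _ _ _ (fun e : R => coord c x + e *: d) (param c)).
    exact: line_continuous.
  exact: param_continuous.
- by move=> _ [u + <-]; rewrite /= in_itv /= => /He[].
- by exists (e0 / 2) => //; rewrite /= in_itv /=; lra.
- by exists e => //; rewrite /= in_itv /=.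
Unshelve. all: by end_near.
Qed.

(** The default [x0] is the color given to the points of the universe. *)
Lemma coloring_point D (x0 : X) (col : regions D -> X) : is_coloring T col ->
  exists2 phi, point_coloring D phi & induces phi col.
Proof.
move=> cT.
have ex x : exists a, forall r : regions D, \val r x -> a = col r.
  have [Ux|/region_at [r rx]] := pselect (universe D x).
    by exists x0 => r /region_component[].
  by exists (col r) => r' rx'; rewrite (region_eq rx rx').
have [phi phiE] := choice ex.
exists phi => //; split.
  move=> x nU; have [r rx] := region_at nU.
  have := region_open nU; apply: filterS => y xy.
  rewrite (phiE _ _ rx); apply: phiE.
  by have [_ ->] := region_component rx.
move=> c x v w [i [t [j [u [dp ov [ac cx] xE [vE wE]]]]]] d1 d2 d3 d4 c1 c2 c3 c4 nU.
have cc := atlas_chart ac.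
have [r1 H1] : exists r : regions D, \forall e \near 0^'+, \val r (ray c x d1 e).
  by apply: ray_tail => //; apply: filterS nU => e [].
have [r2 H2] : exists r : regions D, \forall e \near 0^'+, \val r (ray c x d2 e).
  by apply: ray_tail => //; apply: filterS nU => e [].
have [r3 H3] : exists r : regions D, \forall e \near 0^'+, \val r (ray c x d3 e).
  by apply: ray_tail => //; apply: filterS nU => e [].
have [r4 H4] : exists r : regions D, \forall e \near 0^'+, \val r (ray c x d4 e).
  by apply: ray_tail => //; apply: filterS nU => e [].
have E : col r4 = T (col r1) (col r2) (col r3).
  rewrite xE in cx H1 H2 H3 H4; rewrite vE wE in c1 c2 c3 c4.
  apply: (cT i t j u c dp ov ac cx); rewrite /corner_in.
  - by exists d1; case: c1.
  - by exists d2; case: c2.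
  - by exists d3; case: c3.
  - by exists d4; case: c4.
near=> e.
rewrite (phiE (ray c x d1 e) r1); last by near: e.
rewrite (phiE (ray c x d2 e) r2); last by near: e.
rewrite (phiE (ray c x d3 e) r3); last by near: e.
by rewrite (phiE (ray c x d4 e) r4); last by near: e.
Unshelve. all: by end_near.
Qed.

Lemma point_coloring_coloring D phi : point_coloring D phi ->
  exists2 col : regions D -> X, is_coloring T col & induces phi col.
Proof.
move=> [lc cr].
have [pt ptE] := choice (@region_inh D).
exists (phi \o pt); last first.
  move=> x r rx /=; have [nU rE] := region_component rx.
  apply: (@locally_constant_off_connected D phi (\val r)) => //.
  - by rewrite rE; exact: component_connected.
  - by rewrite rE; exact: connected_component_sub.
have ind x (r : regions D) : \val r x -> phi x = phi (pt r).
  move=> rx; have [nU rE] := region_component rx.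
  apply: (@locally_constant_off_connected D phi (\val r)) => //.
  - by rewrite rE; exact: component_connected.
  - by rewrite rE; exact: connected_component_sub.
move=> i t j u c dp ov ac cx co r1 r2 r3 r4 [d1 [a1 b1 H1]] [d2 [a2 b2 H2]]
  [d3 [a3 b3 H3]] [d4 [a4 b4 H4]].
have cr0 : crossing D c (curve D i t) (velocity c (curve D i) t)
  (velocity c (curve D j) u) by exists i, t, j, u.
have off (r : regions D) x : \val r x -> ~ universe D x.
  by move=> /region_component[].
have K := cr _ _ _ _ cr0 d1 d2 d3 d4 (conj a1 b1) (conj a2 b2) (conj a3 b3)
  (conj a4 b4).
have {}K : \forall e \near 0^'+, phi (ray c (curve D i t) d4 e) =
    T (phi (ray c (curve D i t) d1 e)) (phi (ray c (curve D i t) d2 e))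
      (phi (ray c (curve D i t) d3 e)).
  apply: K; near=> e; split.
  - by apply: (off r1); near: e.
  - by apply: (off r2); near: e.
  - by apply: (off r3); near: e.
  - by apply: (off r4); near: e.
suff : \forall e \near (0 : R)^'+, (phi \o pt) r4 =
    T ((phi \o pt) r1) ((phi \o pt) r2) ((phi \o pt) r3).
  by move/filter_ex => [].
near=> e => /=.
have -> : phi (pt r4) = phi (ray c (curve D i t) d4 e).
  by apply/esym/ind; near: e.
have -> : phi (pt r3) = phi (ray c (curve D i t) d3 e).
  by apply/esym/ind; near: e.
have -> : phi (pt r2) = phi (ray c (curve D i t) d2 e).
  by apply/esym/ind; near: e.
have -> : phi (pt r1) = phi (ray c (curve D i t) d1 e).
  by apply/esym/ind; near: e.
by near: e.
Unshelve. all: by end_near.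
Qed.

End PointColorings.

Section Count.
Variables (R : realType) (S : oriented_surface R) (n : nat) (D D' : diagram S n).
Variables (X : Type) (T : X -> X -> X -> X).

(** Counting through point colorings. Since [rel] relates them up to equality off
the universes, it induces an injection of the region colorings of [D] into
those of [D']. The first hypothesis handles diagrams without regions, for
which there may be no color at all to build a point coloring from. *)
Lemma colorings_card_le (rel : (S -> X) -> (S -> X) -> Prop) :
  ((forall x, universe D x) -> (forall x, universe D' x)) ->
  (forall phi, point_coloring T D phi ->
    exists2 phi', point_coloring T D' phi' & rel phi phi') ->
  (forall phi psi phi' psi', point_coloring T D phi -> point_coloring T D psi ->
    rel phi phi' -> rel psi psi' ->
    (forall x, ~ universe D' x -> phi' x = psi' x) ->
    forall x, ~ universe D x -> phi x = psi x) ->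
  (colorings D T #<= colorings D' T)%card.
Proof.
move=> full tot inj.
have [->|/set0P[col0 cT0]] := eqVneq (colorings D T) set0.
  exact: card_ge0.
pose linked (col' : regions D' -> X) (col : regions D -> X) := exists phi phi',
  [/\ point_coloring T D phi, point_coloring T D' phi', rel phi phi',
      induces phi col & induces phi' col'].
have exf col' : exists col, (exists c, linked col' c) -> linked col' col.
  have [[c lk]|nlk] := pselect (exists c, linked col' c); first by exists c.
  by exists col0 => /nlk.
have [f fP] := choice exf.
apply: (@card_le_trans _ _ _ (f @` colorings D' T)); last exact: card_image_le.
apply: subset_card_le => col cT.
have [[x nUx]|/forallNP aU] := pselect (exists x, ~ universe D x); last first.
  have aU' x : universe D x by exact: contrapT (aU x).
  have noR' (r : regions D') : False.
    by have [x /region_component[nx _]] := region_inh r; exact/nx/full.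
  have noR (r : regions D) : False.
    by have [x /region_component[nx _]] := region_inh r; exact/nx/aU'.
  exists (fun r => match noR' r with end).
    by move=> i t j u c _ _ _ _ /= r; case: (noR' r).
  by apply/funext => r; case: (noR r).
have [r0 _] := region_at nUx.
have [phi pc ind] := coloring_point (col r0) cT.
have [phi' pc' r] := tot _ pc.
have [col' cT' ind'] := point_coloring_coloring pc'.
exists col' => //.
have lk : linked col' col by exists phi, phi'.
have [psi [psi' [qc qc' q jnd jnd']]] : linked col' (f col') by apply: fP; exists col.
apply/funext => rr; have [y ry] := region_inh rr.
rewrite -(jnd _ _ ry) -(ind _ _ ry).
apply: (inj _ _ psi' phi') => //.
  by move=> z /region_at[r' rz]; rewrite (ind' _ _ rz) (jnd' _ _ rz).
by have [] := region_component ry.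
Qed.

End Count.

(** * Derivatives of plane curves and changes of chart *)

Section Calculus.
Variable R : realType.

Lemma is_derive_comp_diff (V W : normedModType R) (g : R -> V) (f : V -> W)
    t v : is_derive t (1 : R) g v -> differentiable f (g t) ->
  is_derive t (1 : R) (f \o g) ('d f (g t) v).
Proof.
move=> [dg <-] df; have {}dg : differentiable g t by exact/derivable1_diffP.
have dfg : differentiable (f \o g) t by exact: differentiable_comp.
split; first exact/derivable1_diffP.
by rewrite !deriveE // diff_comp.
Qed.

Lemma is_derive_scale_comp (V : normedModType R) (f : R -> R) (g : R -> V)
    t l v : is_derive t (1 : R) f l -> is_derive (f t) (1 : R) g v ->
  is_derive t (1 : R) (g \o f) (l *: v).
Proof.
move=> df [dg <-]; have {}dg : differentiable g (f t) by exact/derivable1_diffP.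
have := is_derive_comp_diff df dg.
by rewrite diff1E // derive1E.
Qed.

Lemma is_derive_fst (g : R -> plane R) t v :
  is_derive t (1 : R) g v -> is_derive t (1 : R) (fun e => (g e).1) v.1.
Proof.
move=> dg; have cf : continuous (fst : plane R -> R) by move=> p; exact: cvg_fst.
by have := is_derive_comp_diff dg (linear_differentiable _ cf); rewrite diff_lin.
Qed.

Lemma is_derive_snd (g : R -> plane R) t v :
  is_derive t (1 : R) g v -> is_derive t (1 : R) (fun e => (g e).2) v.2.
Proof.
move=> dg; have cf : continuous (snd : plane R -> R) by move=> p; exact: cvg_snd.
by have := is_derive_comp_diff dg (linear_differentiable _ cf); rewrite diff_lin.
Qed.

(** The derivative as a limit of difference quotients, with the increment on the
right. *)
Lemma is_derive_quotient (V : normedModType R) (g : R -> V) t v :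
  is_derive t (1 : R) g v -> h^-1 *: (g (t + h) - g t) @[h --> 0^'] --> v.
Proof.
move=> [dg <-]; rewrite (_ : (fun h => _) =
  (fun h : R => h^-1 *: ((g \o shift t) (h *: (1 : R)) - g t))) //.
by apply/funext => h /=; rewrite [h *: 1]mulr1 (addrC h).
Qed.

Lemma is_derive_right_pos (g : R -> R) v : is_derive (0 : R) (1 : R) g v ->
  g 0 = 0 -> 0 < v -> \forall e \near 0^'+, 0 < g e.
Proof.
move=> /is_derive_quotient dg g0 v0.
have : \forall h \near 0^', 0 < h^-1 *: (g (0 + h) - g 0).
  exact: (cvgr_gt _ dg).
rewrite near_withinE => H; rewrite near_withinE.
apply: filterS H => h H h0; have := H (lt0r_neq0 h0).
by rewrite g0 subr0 add0r pmulr_rgt0 // invr_gt0.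
Qed.

Lemma is_derive_right_neg (g : R -> R) v : is_derive (0 : R) (1 : R) g v ->
  g 0 = 0 -> v < 0 -> \forall e \near 0^'+, g e < 0.
Proof.
move=> dg g0 v0.
have : \forall e \near 0^'+, 0 < - g e.
  apply: (is_derive_right_pos (is_deriveN dg)); last by rewrite oppr_gt0.
  by change (- g 0 = 0); rewrite g0 oppr0.
by apply: filterS => e; rewrite oppr_gt0.
Qed.

Lemma is_derive_cvg (V : normedModType R) (g : R -> V) t v :
  is_derive t (1 : R) g v -> g e @[e --> t] --> g t.
Proof. by move=> [/derivable1_diffP/differentiable_continuous]. Qed.

Lemma is_derive_line (V : normedModType R) (p d : V) (e : R) :
  is_derive e (1 : R) (fun e : R => p + e *: d) d.
Proof.
have dd : is_derive e (1 : R) (fun e : R => e *: d) d.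
  have df : differentiable (fun e : R => e *: d) e by exact: ex_diff.
  split; first exact/derivable1_diffP.
  by rewrite deriveE // (@diff_val _ _ _ _ _ _ _ (is_diff_scalel e d)) scale1r.
have := is_deriveD (is_derive_cst p e (1 : R)) dd.
by rewrite add0r.
Qed.

(** A linear map of the plane multiplies oriented areas by its determinant; when
that determinant is positive, it respects the two sides of a vector. *)
Lemma det2_linear (L : {linear plane R -> plane R}) v w :
  det2 (L v) (L w) = det2 (L (1, 0)) (L (0, 1)) * det2 v w.
Proof.
have E (u : plane R) : L u = u.1 *: L (1, 0) + u.2 *: L (0, 1).
  rewrite -!linearZ -linearD; congr (L _).
  case: u => a b; change ((a, b) = (a * 1 + b * 0, a * 0 + b * 1)).
  by congr pair; ring.
have E1 u : (L u).1 = u.1 * (L (1, 0)).1 + u.2 * (L (0, 1)).1 by rewrite {1}E.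
have E2 u : (L u).2 = u.1 * (L (1, 0)).2 + u.2 * (L (0, 1)).2 by rewrite {1}E.
by rewrite /det2 !(E1 v, E2 v, E1 w, E2 w); ring.
Qed.

End Calculus.

Section Velocities.
Variables (R : realType) (F F' : topologicalType).

(** The chain rule for a map between surfaces read in charts. It is used both for
diffeomorphisms and, with the identity, for changes of chart. *)
Lemma velocity_transport (c : chart R F) (c' : chart R F') (h : F -> F')
    (g : R -> F) t v :
  is_chart c -> ccod c (g t) -> ccod c' (h (g t)) -> {for t, continuous g} ->
  C1_positive_in c c' h -> is_derive t (1 : R) (coord c \o g) v ->
  is_derive t (1 : R) (coord c' \o (h \o g))
    ('d (fun p => coord c' (h (param c p))) (coord c (g t)) v).
Proof.
move=> cc cg chg ctg C1 dv.
have [dx pK] := chart_coord cc cg.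
have [dPhi _ _] : [/\ differentiable (fun p => coord c' (h (param c p))) (coord c (g t)),
  forall v, {for coord c (g t), continuous (fun q => 'd (fun p => coord c' (h (param c p))) q v)} &
        0 < det2 ('d (fun p => coord c' (h (param c p))) (coord c (g t)) (1, 0))
    ('d (fun p => coord c' (h (param c p))) (coord c (g t)) (0, 1))].
  by apply: C1; split=> //=; rewrite pK.
have := is_derive_comp_diff dv dPhi.
apply: near_eq_is_derive.
have [_ oc _] := cc.
have : \forall u \near t, ccod c (g u).
  by apply: ctg; exact: open_nbhs_nbhs.
by apply: filterS => u /(chart_coord cc)[_ /= ->].
Qed.

End Velocities.

Lemma curve_derive (R : realType) (S : oriented_surface R) (n : nat)
    (D : diagram S n) i t c : atlas c -> ccod c (curve D i t) ->
  is_derive t (1 : R) (coord c \o curve D i) (velocity c (curve D i) t).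
Proof.
move=> ac /(curve_immersed ac)[dc _ _].
by rewrite /velocity derive1E; exact: derivableP.
Qed.

(** * Cones at a crossing *)

Lemma same_point_sym (R : realType) n (i j : 'I_n) (t u : R) :
  same_point i t j u -> same_point j u i t.
Proof. by move=> [-> [z ->]]; split=> //; exists (- z); rewrite mulrNz addrK. Qed.

(** Caratheodory's form of the derivative: the difference quotient, completed at
[t], is continuous there. It avoids dividing by increments that may vanish. *)
Lemma is_derive_caratheodory (R : realType) (V : normedModType R) (g : R -> V)
    t v : is_derive t (1 : R) g v ->
  exists2 q : R -> V, q u @[u --> t] --> v &
    forall u, g u - g t = (u - t) *: q u.
Proof.
move=> dg; pose q u := if u == t then v else (u - t)^-1 *: (g u - g t).
exists q; last first.
  move=> u; rewrite /q; case: eqVneq => [->|ut]; first by rewrite !subrr scale0r.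
  by rewrite scalerA divff ?scale1r // subr_eq0.
have qt : q t = v by rewrite /q eqxx.
suff : {for t, continuous q} by rewrite /prop_for /continuous_at qt.
apply/continuous_withinNx; rewrite qt.
move=> B /(is_derive_quotient dg) /nbhs_ballP[e /= e0 He].
apply/nbhs_ballP; exists e => // u /= tu ut; rewrite /q (negbTE ut).
have := He (u - t); rewrite /ball /= sub0r normrN distrC subrKC subr_eq0.
exact.
Qed.

Lemma cvg_det2 (R : realType) (I : Type) (G : set_system I) (f g : I -> plane R)
    a b : Filter G -> f @ G --> a -> g @ G --> b ->
  det2 (f z) (g z) @[z --> G] --> det2 a b.
Proof.
move=> FG fa gb.
have f1 : (f z).1 @[z --> G] --> a.1 by apply: (cvg_comp _ _ fa); exact: cvg_fst.
have f2 : (f z).2 @[z --> G] --> a.2 by apply: (cvg_comp _ _ fa); exact: cvg_snd.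
have g1 : (g z).1 @[z --> G] --> b.1 by apply: (cvg_comp _ _ gb); exact: cvg_fst.
have g2 : (g z).2 @[z --> G] --> b.2 by apply: (cvg_comp _ _ gb); exact: cvg_snd.
by apply: cvgB; apply: cvgM.
Qed.

Section Cone.
Variables (R : realType) (S : oriented_surface R) (n : nat) (D : diagram S n).

Lemma double_point_sym i t j u :
  double_point (curve D) i t j u -> double_point (curve D) j u i t.
Proof. by move=> [E ns]; split=> // /same_point_sym. Qed.

(** Exactly one of the two preimages is over, so a double point is a crossing once
its two strands are put in the right order. *)
Lemma double_point_crossing i t j u : double_point (curve D) i t j u ->
  exists c v w, crossing D c (curve D i t) v w /\ det2 v w != 0.
Proof.
move=> dp; have dp' := double_point_sym dp.
have [c ac cx] : exists2 c : chart R S, atlas c & ccod c (curve D i t).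
  by apply/atlas_cover; exact: curve_interior.
have cx' : ccod c (curve D j u) by rewrite -(proj1 dp).
have [ov|nov] := pselect (over D i t).
  exists c, (velocity c (curve D i) t), (velocity c (curve D j) u).
  by split; [exists i, t, j, u|exact: curve_transverse dp ac cx].
have ov : over D j u.
  by apply: contrapT => nl; apply: nov; apply/(over_one dp).
exists c, (velocity c (curve D j) u), (velocity c (curve D i) t).
split; last exact: curve_transverse dp' ac cx'.
by exists j, u, i, t; split=> //; exact: (proj1 dp).
Qed.

Lemma velocity_same (c : chart R S) i t j u : same_point i t j u ->
  velocity c (curve D i) t = velocity c (curve D j) u.
Proof.
move=> [<- [z ->]]; rewrite /velocity /derive1; set f1 := (fun h : R => _); set f2 := (fun h : R => _).
suff -> : f1 = f2 by [].
by apply/funext => h; rewrite /f1 /f2 /= addrA !curve_shift.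
Qed.

Lemma cvg_cone (p d : plane R) :
  p + z.1 *: z.2 @[z --> filter_prod (0 : R)^'+ (nbhs d)] --> p.
Proof.
have c1 : p + z.1 *: z.2 @[z --> filter_prod (0 : R)^'+ (nbhs d)] --> p + 0 *: d.
  apply: cvgD; first exact: cvg_cst.
  apply: cvgZ; last exact: cvg_snd.
  apply: cvg_trans (cvg_fst (FG := nbhs_filter d)) _.
  exact: cvg_within.
by rewrite scale0r addr0 in c1.
Qed.

Lemma cvg_ray (F : topologicalType) (c : chart R F) (x : F) (d : plane R) :
  is_chart c -> ccod c x ->
  ray c x z.2 z.1 @[z --> filter_prod (0 : R)^'+ (nbhs d)] --> x.
Proof.
move=> cc cx; have [dx pK] := chart_coord cc cx.
have := cvg_comp _ _ (@cvg_cone (coord c x) d) (param_continuous cc dx).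
by rewrite pK.
Qed.

(** If the strand met the ray in direction d', its difference quotient q would be
parallel to d', so that det2 q d' = 0; but det2 q d' is close to det2 v d,
which is not 0. *)
Lemma strand_off_cone c x (d : plane R) k s v : is_chart c -> ccod c x ->
  curve D k s = x -> is_derive s (1 : R) (coord c \o curve D k) v ->
  det2 v d != 0 ->
  \forall s' \near s & z \near filter_prod (0 : R)^'+ (nbhs d),
    ray c x z.2 z.1 <> curve D k s'.
Proof.
move=> cc cx kx dv vd.
have [q cq qE] := is_derive_caratheodory dv.
have [_ oc _] := cc.
have [dx pK] := chart_coord cc cx.
pose F := filter_prod (0 : R)^'+ (nbhs d).
have G1 (P : set R) : (\forall u \near s, P u) -> \forall y \near filter_prod (nbhs s) F, P y.1.
  by move=> H; apply: (@cvg_fst _ _ (nbhs s) F _ P).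
have G2 (P : set (R * plane R)) : (\forall z \near F, P z) ->
    \forall y \near filter_prod (nbhs s) F, P y.2.
  by move=> H; apply: (@cvg_snd _ _ (nbhs s) F _ P).
have ck : \forall y \near filter_prod (nbhs s) F, ccod c (curve D k y.1).
  apply: (G1 (fun u => ccod c (curve D k u))).
  by apply: curve_continuous; apply: open_nbhs_nbhs; rewrite kx.
have e0 : \forall y \near filter_prod (nbhs s) F, 0 < y.2.1.
  apply: (G2 (fun z => 0 < z.1)).
  by apply: (@cvg_fst _ _ (0:R)^'+ (nbhs d) _ [set e | 0 < e]); exact: nbhs_right_gt.
have cr : \forall y \near filter_prod (nbhs s) F, cdom c (coord c x + y.2.1 *: y.2.2).
  apply: (G2 (fun z => cdom c (coord c x + z.1 *: z.2))).
  by apply: cvg_cone; apply: open_nbhs_nbhs; split=> //; case: cc.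
have nz : \forall y \near filter_prod (nbhs s) F, det2 (q y.1) y.2.2 != 0.
  have : det2 (q y.1) y.2.2 @[y --> filter_prod (nbhs s) F] --> det2 v d.
    apply: cvg_det2.
      by apply: (cvg_comp _ _ _ cq); exact: cvg_fst.
    by apply: (@cvg_comp _ _ _ snd snd _ F); [exact: cvg_snd|exact: cvg_snd].
  by move=> H; apply: (cvgr_neq0 _ H).
suff : \forall y \near filter_prod (nbhs s) F, ray c x y.2.2 y.2.1 <> curve D k y.1 by [].
near=> y => E.
have dy : cdom c (coord c x + y.2.1 *: y.2.2) by near: y.
have qy : det2 (q y.1) y.2.2 != 0 by near: y.
have y0 : 0 < y.2.1 by near: y.
have [_] := chart_param cc dy.
rewrite -/(ray c x y.2.2 y.2.1) E -kx => {}E.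
have := qE y.1; rewrite /= E addrAC subrr add0r => {}E.
have : det2 (q y.1) (y.2.1 *: y.2.2) = y.2.1 * det2 (q y.1) y.2.2.
  by rewrite /det2 /= /GRing.scale /=; ring.
have -> : det2 (q y.1) (y.2.1 *: y.2.2) = 0.
  by rewrite E /det2 /= /GRing.scale /=; ring.
by move/esym/eqP; rewrite mulf_eq0 (negbTE qy) orbF gt_eqF.
Unshelve. all: by end_near.
Qed.

(** Near a crossing the universe is made of the two strands only: there is no
triple point, and the parameters away from both strands fill a compact set,
which stays at a distance from the crossing. The compactness argument covers
each circle by neighbourhoods of its parameters. *)
Lemma cone_off c x v w d : crossing D c x v w -> det2 v d != 0 ->
  det2 w d != 0 ->
  \forall z \near filter_prod (0 : R)^'+ (nbhs d), ~ universe D (ray c x z.2 z.1).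
Proof.
move=> [i [t [j [u [dp ov [ac cx] xE [vE wE]]]]]] vd wd.
have cc := atlas_chart ac.
pose F := filter_prod (0 : R)^'+ (nbhs d).
suff H k : \forall z \near F, forall s, `[0, 1]%classic s -> ray c x z.2 z.1 <> curve D k s.
  have {}H : \forall z \near F, forall k s, `[0, 1]%classic s -> ray c x z.2 z.1 <> curve D k s.
    exact: filter_forall.
  apply: filterS H => z H [k [s E]].
  apply: (H k (s - (Num.floor s)%:~R)).
    rewrite /= in_itv /= subr_ge0 floor_le /= lerBlDl ltW //.
    by have := floorD1_gt s; rewrite intrD.
  by rewrite -mulrNz curve_shift.
have /compact_near_coveringP := @segment_compact R 0 1.
apply => s _ /=.
have [sx|sx] := pselect (curve D k s = x); last first.
  have := @surface_hausdorff R S; rewrite open_hausdorff.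
  move=> /(_ (curve D k s) x) [|[A B] /= [sA xB] [oA oB AB]]; first exact/eqP.
  have nA : \forall s' \near s, A (curve D k s').
    by apply: curve_continuous; apply: open_nbhs_nbhs; split=> //; exact: set_mem.
  have nB : \forall z \near F, B (ray c x z.2 z.1).
    by apply: cvg_ray => //; apply: open_nbhs_nbhs; split=> //; exact: set_mem.
  near=> s' z.
  have As : A (curve D k s') by near: s'.
  have Bz : B (ray c x z.2 z.1) by near: z.
  move=> E; rewrite E in Bz.
  have : (A `&` B) (curve D k s') by [].
  by rewrite (eqP AB).
have cs : ccod c (curve D k s) by rewrite sx.
have ds := curve_derive ac cs.
have [ts|nts] := pselect (same_point i t k s).
  apply: (strand_off_cone cc cx sx ds).
  by rewrite -(velocity_same _ ts) -vE.
have dks : double_point (curve D) i t k s by split=> //; rewrite sx -xE.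
have us := curve_no_triple dp dks.
apply: (strand_off_cone cc cx sx ds).
by rewrite -(velocity_same _ us) -wE.
Unshelve. all: by end_near.
Qed.

End Cone.

(** * Ambient isotopies *)

Section Transport.
Variables (R : realType) (S : oriented_surface R) (n : nat).
Variables (X : Type) (T : X -> X -> X -> X).
Implicit Types D : diagram S n.

(** A curve leaving the crossing in direction [d] stays in a thin cone about the
ray of direction [d], which [cone_off] shows to be free of the universe; so
the curve and the ray end in the same region. This is what compares the
corners of a crossing in two charts, since a change of chart bends rays. *)
Lemma cone_constant D (phi : S -> X) c x v w d (g : R -> plane R) :
  locally_constant_off D phi -> crossing D c x v w ->
  det2 v d != 0 -> det2 w d != 0 ->
  is_derive (0 : R) (1 : R) g d -> g 0 = coord c x ->
  \forall e \near 0^'+, phi (param c (g e)) = phi (ray c x d e).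
Proof.
move=> lc cr vd wd dg g0.
have off := cone_off cr vd wd.
have [_ [_ [_ [_ [_ _ [ac cx] _ _]]]]] := cr.
have cc := atlas_chart ac; have [dx pK] := chart_coord cc cx.
have dom : \forall z \near filter_prod (0 : R)^'+ (nbhs d), cdom c (coord c x + z.1 *: z.2).
  by apply: cvg_cone; apply: open_nbhs_nbhs; split=> //; case: cc.
have [[A B] /= [HA HB] AB] : \forall z \near filter_prod (0 : R)^'+ (nbhs d),
  cdom c (coord c x + z.1 *: z.2) /\ ~ universe D (ray c x z.2 z.1).
  by apply: filterI.
move/nbhs_ballP : HB => [r /= r0 Hr].
have [q cq qE] := is_derive_caratheodory dg.
have qr : \forall e \near 0^'+, ball d r (q e).
  by apply: near_right; apply: cq; exact: nbhsx_ballx.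
near=> e.
have Ae : A e by near: e.
have Be : ball d r (q e) by near: e.
have -> : param c (g e) = ray c x (q e) e.
  by rewrite /ray -g0; congr param; rewrite -[LHS](subrK (g 0)) qE subr0 addrC.
have inB l : 0 <= l <= 1 -> ball d r (d + l *: (q e - d)).
  move=> /andP[l0 l1]; move: Be; rewrite -ball_normE /= => Be.
  rewrite opprD addNKr normrN normrZ ger0_norm // distrC.
  by apply: le_lt_trans Be; rewrite -[leRHS]mul1r ler_wpM2r.
have H l : 0 <= l <= 1 -> cdom c (coord c x + e *: (d + l *: (q e - d))) /\
    ~ universe D (ray c x (d + l *: (q e - d)) e).
  by move=> /inB/Hr Bl; exact: (AB (_, _) (conj Ae Bl)).
apply: (@locally_constant_off_connected _ _ _ _ _ _
  ((fun l => ray c x (d + l *: (q e - d)) e) @` `[0, 1]) _ _ lc).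
- apply: connected_continuous_connected; first exact: segment_connected.
  apply: continuous_in_subspaceT => l; rewrite inE /= in_itv /= => /H [dl _].
  rewrite /ray.
  apply: (@continuous_comp _ _ _ (fun l : R => coord c x + e *: (d + l *: (q e - d))) (param c)).
    apply: cvgD; first exact: cvg_cst.
    by apply: cvgZl_tmp; exact: line_continuous.
  exact: param_continuous.
- by move=> _ [l + <-]; rewrite /= in_itv /= => /H[].
- by exists 1; rewrite /= ?in_itv /= ?ler01 ?lexx // scale1r subrKC.
- by exists 0; rewrite /= ?in_itv /= ?ler01 ?lexx // scale0r addr0.
Unshelve. all: by end_near.
Qed.

Definition transition (F F' : topologicalType) (c : chart R F) (c' : chart R F')
  (h : F -> F') (p : plane R) : plane R := coord c' (h (param c p)).

(** The hypothesis on crossings says that [k] carries the velocities of [D'] to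
positive multiples of those of [D]; since the Jacobian is positive, left and
right, hence the four corners, correspond. *)
Lemma transport_coloring D D' (k : S -> S) (phi : S -> X) :
  continuous k ->
  (forall x, universe D' x <-> universe D (k x)) ->
  (forall c c', atlas c -> atlas c' -> C1_positive_in c c' k) ->
  (forall c c0 x v' w', crossing D' c x v' w' -> atlas c0 -> ccod c0 (k x) ->
    exists v w l m, [/\ crossing D c0 (k x) v w, 0 < l, 0 < m,
      'd (transition c c0 k) (coord c x) v' = l *: v &
      'd (transition c c0 k) (coord c x) w' = m *: w]) ->
  point_coloring T D phi -> point_coloring T D' (phi \o k).
Proof.
move=> ck kU C1 kcr [lc rule]; split.
  move=> x nU; have nUk : ~ universe D (k x) by move/kU.
  exact: (ck x _ (lc _ nUk)).
move=> c x v' w' cr d1 d2 d3 d4 c1 c2 c3 c4 off.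
have [i [t [_ [_ [_ _ [ac cx] xE _]]]]] := cr.
have [c0 ac0 c0x] : exists2 c0 : chart R S, atlas c0 & ccod c0 (k x).
  have : universe D (k x) by apply/kU; exists i, t.
  move=> [i0 [t0 ->]].
  by apply/atlas_cover; exact: curve_interior.
have [v [w [l [m [cr0 l0 m0 dv dw]]]]] := kcr _ _ _ _ _ cr ac0 c0x.
have cc := atlas_chart ac; have cc0 := atlas_chart ac0.
have [dx pK] := chart_coord cc cx.
have [dPhi _ J0] := C1 _ _ ac ac0 (coord c x) (conj dx (eq_ind_r (fun y => ccod c0 (k y)) c0x pK)).
rewrite -/(transition c c0 k) in dPhi J0.
set L := 'd (transition c c0 k) (coord c x) in dv dw dPhi J0.
have sideE (u u' : plane R) (a : R) s d : 0 < a -> L u' = a *: u -> on_side u' s d -> on_side u s (L d).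
  move=> a0 uu.
  have E : a * det2 u (L d) = det2 (L (1, 0)) (L (0, 1)) * det2 u' d.
    by rewrite -det2_linear -/L uu /det2 /= /GRing.scale /=; ring.
  case: s => /=.
    by move=> ud; rewrite -(pmulr_rgt0 _ a0) E mulr_gt0.
  by move=> ud; rewrite -(pmulr_rlt0 _ a0) E pmulr_rlt0.
have cornerE so su d : corner v' w' so su d -> corner v w so su (L d).
  by move=> [/(sideE _ _ _ _ _ l0 dv) ? /(sideE _ _ _ _ _ m0 dw) ?].
have nz u s d : on_side u s d -> det2 u d != 0.
  by case: s => /= ud; [rewrite gt_eqF|rewrite lt_eqF].
have near_ray so su d : corner v' w' so su d ->
    \forall e \near 0^'+, phi (k (ray c x d e)) = phi (ray c0 (k x) (L d) e).
  move=> /cornerE [/nz vd /nz wd].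
  pose g e := transition c c0 k (coord c x + e *: d).
  have dg : is_derive (0 : R) (1 : R) g (L d).
    have := @is_derive_comp_diff _ _ _ (fun e : R => coord c x + e *: d) (transition c c0 k) 0 d (is_derive_line _ _ _).
    by rewrite scale0r addr0; apply.
  have g0 : g 0 = coord c0 (k x) by rewrite /g scale0r addr0 /transition pK.
  have H := cone_constant lc cr0 vd wd dg g0.
  have inc0 : \forall e \near 0^'+, ccod c0 (k (ray c x d e)).
    apply: near_right.
    have [_ oc0 _] := cc0.
    have : \forall y \near x, ccod c0 (k y) by apply: ck; exact: open_nbhs_nbhs.
    have cvr : ray c x d e @[e --> (0:R)] --> x.
      have := cvg_comp _ _ (@line_cvg0 _ (coord c x) d) (param_continuous cc dx).
      by rewrite pK.
    by move/cvr.
  apply: filterS2 H inc0 => e <- /(chart_coord cc0)[_].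
  by rewrite /g /transition -/(ray c x d e) => ->.
have off0 so su d : corner v' w' so su d -> \forall e \near 0^'+, ~ universe D (ray c0 (k x) (L d) e).
  move=> /cornerE [/nz vd /nz wd].
  have [[A B] /= [HA HB] AB] := cone_off cr0 vd wd.
  apply: filterS HA => e Ae; apply: (AB (e, L d)); split=> //=.
  exact: nbhs_singleton HB.
have {}rule := rule _ _ _ _ cr0 _ _ _ _ (cornerE _ _ _ c1) (cornerE _ _ _ c2)
  (cornerE _ _ _ c3) (cornerE _ _ _ c4).
have {}rule : \forall e \near 0^'+, phi (ray c0 (k x) (L d4) e) =
    T (phi (ray c0 (k x) (L d1) e)) (phi (ray c0 (k x) (L d2) e)) (phi (ray c0 (k x) (L d3) e)).
  apply: rule; near=> e; split; near: e.
  - exact: off0 c1.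
  - exact: off0 c2.
  - exact: off0 c3.
  - exact: off0 c4.
near=> e => /=.
have -> : phi (k (ray c x d4 e)) = phi (ray c0 (k x) (L d4) e).
  by near: e; exact: near_ray c4.
have -> : phi (k (ray c x d3 e)) = phi (ray c0 (k x) (L d3) e).
  by near: e; exact: near_ray c3.
have -> : phi (k (ray c x d2 e)) = phi (ray c0 (k x) (L d2) e).
  by near: e; exact: near_ray c2.
have -> : phi (k (ray c x d1 e)) = phi (ray c0 (k x) (L d1) e).
  by near: e; exact: near_ray c1.
by near: e.
Unshelve. all: by end_near.
Qed.

End Transport.

Section CircleReparam.
Variables (R : realType) (f : R -> R).
Hypothesis rf : circle_reparam f.

Lemma circle_reparam_shift (z : int) t : f (t + z%:~R) = f t + z%:~R.
Proof.
have Hn (m : nat) u : f (u + m%:R) = f u + m%:R.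
  elim: m u => [|m IH] u; first by rewrite !addr0.
  by have [_ _] := rf (u + m%:R); rewrite -natr1 !addrA IH.
case: z => m; first exact: Hn.
by rewrite NegzE mulrNz; apply/eqP; rewrite -subr_eq opprK -Hn subrK.
Qed.

Lemma circle_reparam_derive t : is_derive t (1 : R) f (derive1 f t).
Proof. by have [df _ _] := rf t; rewrite derive1E; exact: derivableP. Qed.

Lemma circle_reparam_continuous : continuous f.
Proof. by move=> t; exact: is_derive_cvg (circle_reparam_derive t). Qed.

Lemma circle_reparam_lt t u : t < u -> f t < f u.
Proof.
move=> tu; apply: (@gtr0_derive1_lt_cc _ f t u) => //; rewrite ?in_itv /= ?lexx ?(ltW tu) //.
- by move=> x _; case: (rf x).
- by move=> x _; case: (rf x).
- exact/continuous_subspaceT/circle_reparam_continuous.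
Qed.

Lemma circle_reparam_inj : injective f.
Proof.
move=> t u E; case: (ltgtP t u) => // /circle_reparam_lt; by rewrite E ltxx.
Qed.

Lemma circle_reparam_surj y : exists t, f t = y.
Proof.
have [z yN] : exists z : int, `|y - f 0| < z%:~R.
  by exists (Num.floor (`|y - f 0|) + 1); exact: floorD1_gt.
have fN : f z%:~R = f 0 + z%:~R by rewrite -circle_reparam_shift add0r.
have fN' : f (- z%:~R) = f 0 - z%:~R.
  by rewrite -mulrNz -circle_reparam_shift add0r.
move: (z%:~R : R) yN fN fN' => N yN fN fN'.
have N0 : 0 <= N by exact: le_trans (ltW yN).
have [t _ ft] : exists2 t, t \in `[(- N), N] & f t = y.
  apply: IVT; first by lra.
    exact/continuous_subspaceT/circle_reparam_continuous.
  move: yN; rewrite ltr_norml fN fN' ge_min le_max => /andP[y1 y2].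
  by apply/andP; split; apply/orP; [left|right]; lra.
by exists t.
Qed.

End CircleReparam.

Section Isotopy.
Variables (R : realType) (S : oriented_surface R) (n : nat) (D D' : diagram S n).
Variables (X : Type) (T : X -> X -> X -> X).

(** The argument is run twice, with the final diffeomorphism and with its inverse,
rather than inverting the reparametrizations of the circles. *)
Lemma isotopy_colorings : isotopy_move D D' -> (colorings D T #= colorings D' T)%card.
Proof.
move=> [h [p [f [[H [_ _ H1 Hd]] pinj rf cE oE]]]].
have [k [ch ck hk kh C1]] : oriented_diffeo h.
  have := Hd 1; rewrite ler01 lexx => /(_ isT).
  by rewrite (_ : H 1 = h) //; apply/funext => x; exact: H1.
have psurj i : exists j, p j = i by have [q _ qp] := injF_bij pinj; exists (q i).
have C1h c c' : atlas c -> atlas c' -> C1_positive_in c c' h by move=> ac /(C1 _ _ ac)[].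
have C1k c c' : atlas c -> atlas c' -> C1_positive_in c c' k by move=> ac /(C1 _ _ ac)[].
have ckE i t : k (curve D' i t) = curve D (p i) (f i t) by rewrite cE hk.
have U1 x : universe D' x <-> universe D (k x).
  split=> [[i [t ->]]|[i [t E]]]; first by exists (p i), (f i t).
  have [j ji] := psurj i; subst i; have [u uE] := circle_reparam_surj (rf j) t.
  by exists j, u; rewrite cE uE -E kh.
have U2 x : universe D x <-> universe D' (h x) by rewrite U1 hk.
have same i t j u : same_point (p i) (f i t) (p j) (f j u) <-> same_point i t j u.
  split=> [[/pinj ij [z E]]|[ij [z E]]]; subst j; split=> //; exists z.
    by apply: (circle_reparam_inj (rf i)); rewrite circle_reparam_shift.
  by rewrite E circle_reparam_shift.
have dbl i t j u : double_point (curve D') i t j u <->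
    double_point (curve D) (p i) (f i t) (p j) (f j u).
  rewrite /double_point same -!ckE; split=> -[E ns]; split=> //; first by rewrite E.
  by rewrite -[LHS]kh E kh.
have vel1 (c c0 : chart R S) i t x : x = curve D' i t ->
    atlas c -> ccod c x -> atlas c0 -> ccod c0 (k x) ->
    'd (transition c c0 k) (coord c x) (velocity c (curve D' i) t) =
    derive1 (f i) t *: velocity c0 (curve D (p i)) (f i t).
  move=> xE ac cx ac0 c0x; subst x.
  have A1 := velocity_transport (atlas_chart ac) cx c0x (@curve_continuous _ _ _ D' i t)
    (C1k _ _ ac ac0) (curve_derive ac cx).
  have A2 : is_derive t (1 : R) ((coord c0 \o curve D (p i)) \o f i)
     (derive1 (f i) t *: velocity c0 (curve D (p i)) (f i t)).
    apply: is_derive_scale_comp; first exact: circle_reparam_derive.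
    by apply: curve_derive => //; rewrite -ckE.
  rewrite -[LHS](@derive_val _ _ _ _ _ _ _ A1) -(@derive_val _ _ _ _ _ _ _ A2).
  by congr ('D_1 _ t); apply/funext => u /=; rewrite ckE.
have vel2 (c c0 : chart R S) i t x : x = curve D (p i) (f i t) ->
    atlas c -> ccod c x -> atlas c0 -> ccod c0 (h x) ->
    'd (transition c c0 h) (coord c x) (velocity c (curve D (p i)) (f i t)) =
    (derive1 (f i) t)^-1 *: velocity c0 (curve D' i) t.
  move=> xE ac cx ac0 c0x; subst x.
  have A1 := velocity_transport (atlas_chart ac) cx c0x (@curve_continuous _ _ _ D (p i) (f i t))
    (C1h _ _ ac ac0) (curve_derive ac cx).
  have A2 := is_derive_scale_comp (circle_reparam_derive (rf i) t) A1.
  have A3 : is_derive t (1 : R) (coord c0 \o curve D' i) (velocity c0 (curve D' i) t).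
    by apply: curve_derive => //; rewrite cE.
  have E : derive1 (f i) t *: 'd (transition c c0 h) (coord c (curve D (p i) (f i t)))
      (velocity c (curve D (p i)) (f i t)) = velocity c0 (curve D' i) t.
    rewrite -[LHS](@derive_val _ _ _ _ _ _ _ A2) -(@derive_val _ _ _ _ _ _ _ A3).
    by congr ('D_1 _ t); apply/funext => u /=; rewrite cE.
  by rewrite -E scalerA mulVf ?scale1r // gt_eqF //; case: (rf i t).
rewrite card_eq_le; apply/andP; split.
  apply: (@colorings_card_le _ _ _ _ _ _ _ (fun phi phi' => phi' = phi \o k)).
  - by move=> a x; apply/U1.
  - move=> phi pc; exists (phi \o k); last by [].
    apply: (transport_coloring ck U1 C1k _ pc).
    move=> c c0 x v' w' [i [t [j [u [dp ov [ac cx] xE [-> ->]]]]]] ac0 c0x.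
    exists (velocity c0 (curve D (p i)) (f i t)), (velocity c0 (curve D (p j)) (f j u)),
      (derive1 (f i) t), (derive1 (f j) u); split.
    + by exists (p i), (f i t), (p j), (f j u); split=> //; [exact/dbl|exact/oE|rewrite xE].
    + by case: (rf i t).
    + by case: (rf j u).
    + exact: vel1.
    + by apply: vel1 => //; rewrite xE (proj1 dp).
  - move=> phi psi _ _ _ _ -> -> E x nU; have := E (h x).
    by rewrite /= hk; apply; rewrite -U2.
apply: (@colorings_card_le _ _ _ _ _ _ _ (fun phi phi' => phi' = phi \o h)).
- by move=> a x; apply/U2.
- move=> phi pc; exists (phi \o h); last by [].
  apply: (transport_coloring ch U2 C1h _ pc).
  move=> c c0 x v' w' [i0 [t0 [j0 [u0 [dp ov [ac cx] xE [vE wE]]]]]] ac0 c0x.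
  have [i ii] := psurj i0; subst i0; have [t tE] := circle_reparam_surj (rf i) t0; subst t0.
  have [j jj] := psurj j0; subst j0; have [u uE] := circle_reparam_surj (rf j) u0; subst u0.
  subst v' w'.
  exists (velocity c0 (curve D' i) t), (velocity c0 (curve D' j) u),
      (derive1 (f i) t)^-1, (derive1 (f j) u)^-1; split.
  + exists i, t, j, u; split=> //; [exact/dbl|exact/oE|by rewrite xE cE].
  + by rewrite invr_gt0; case: (rf i t).
  + by rewrite invr_gt0; case: (rf j u).
  + exact: vel2.
  + by apply: vel2 => //; rewrite xE (proj1 dp).
- move=> phi psi _ _ _ _ -> -> E x nU; have := E (k x).
  by rewrite /= kh; apply; rewrite -U1.
Qed.

End Isotopy.

(** * Moves supported in a disc *)

Section LocalMove.
Variables (R : realType) (S : oriented_surface R) (n : nat).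
Variables (X : Type) (T : X -> X -> X -> X).
Variables (c : chart R S) (K Ko : set (plane R)).
Hypotheses (cc : is_chart c) (Kc : K `<=` cdom c) (Kcompact : compact K)
  (Ko_open : open Ko) (KoK : Ko `<=` K).
Variables (Theta : Type) (rules : (Theta -> X) -> Prop).
Implicit Types (D : diagram S n) (theta : plane R -> Theta).

(** The points of the disc off the universe are sorted into types by [theta], and
a coloring of the types obeys [rules]. The three clauses say that types are
locally constant, that every point coloring is a coloring of the types that
obeys the rules, and that conversely the rules imply the equations at the
crossings of the disc. Some types may not occur in [D]: the rules then say
more than the equations of [D] do, which is what lets the two sides of a move
share the same rules. *)
Definition local_model D theta : Prop :=
  [/\ forall p, K p -> ~ universe D (param c p) ->
        \forall q \near p, K q -> theta q = theta p,
      forall phi, point_coloring T D phi -> exists2 G, rules G &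
        forall p, K p -> ~ universe D (param c p) ->
          phi (param c p) = G (theta p) &
      forall G phi, rules G ->
        (forall p, K p -> ~ universe D (param c p) ->
          phi (param c p) = G (theta p)) ->
        forall c0 x v w, crossing D c0 x v w -> (param c @` K) x ->
          crossing_rule T D phi c0 x v w].

(** Off the open disc [D'] contains the universe of [D], and outside the closed
disc it has the crossings of [D]. *)
Definition agree_off D D' : Prop :=
  (forall x, ~ (param c @` Ko) x -> universe D x -> universe D' x) /\
  (forall c0 x v w, ~ (param c @` K) x -> crossing D c0 x v w ->
    crossing D' c0 x v w).

Lemma disc_closed : closed (param c @` K).
Proof.
apply: compact_closed; first exact: surface_hausdorff.
apply: continuous_compact => //.
by apply/continuous_in_subspaceT => p /set_mem/Kc; exact: param_continuous.
Qed.

Lemma disc_interior p : Ko p -> \forall y \near param c p, (param c @` K) y.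
Proof.
move=> Kp; apply: (param_near cc); first exact/Kc/KoK.
have : \forall q \near p, Ko q by exact: open_nbhs_nbhs.
by apply: filterS => q /KoK Kq; exists q.
Qed.

(** Given a point coloring of [D], extract the coloring of the types inside the
disc and read it through the types of [D']. The result glues with the given
coloring since types agree on the boundary. It is determined by its
restriction to the outside, because the rules determine a coloring of the
types from the boundary types. *)
Lemma local_move_le D D' theta theta' :
  local_model D theta -> local_model D' theta' ->
  agree_off D D' -> agree_off D' D ->
  (forall p, K p -> ~ Ko p -> ~ universe D (param c p) -> theta p = theta' p) ->
  (exists2 p, K p & ~ universe D (param c p)) ->
  (forall G1 G2, rules G1 -> rules G2 ->
    (forall p, K p -> ~ Ko p -> ~ universe D (param c p) ->
      G1 (theta p) = G2 (theta p)) -> forall a, G1 a = G2 a) ->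
  (colorings D T #<= colorings D' T)%card.
Proof.
move=> [lcth ext chk] [lcth' ext' chk'] [UU' crD] [U'U crD'] bd [p0 Kp0 nU0] inj.
have notKo p : K p -> ~ Ko p -> ~ (param c @` Ko) (param c p).
  move=> Kp nKo [q Kq /(param_inj cc (Kc (KoK Kq)) (Kc Kp)) E].
  by apply: nKo; rewrite -E.
pose rel (phi phi' : S -> X) := forall x, ~ (param c @` Ko) x ->
  ~ universe D x -> phi x = phi' x.
apply: (@colorings_card_le _ _ _ _ _ _ _ rel).
- by move=> U; case: (nU0 (U _)).
- move=> phi pc; have [G rG phiG] := ext _ pc.
  (* inside the disc, the coloring of the types is read through the regions of D' *)
  pose phi' x := if asbool ((param c @` K) x) then G (theta' (coord c x)) else phi x.
  have phi'K p : K p -> phi' (param c p) = G (theta' p).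
    move=> Kp; rewrite /phi' asboolT; last by exists p.
    by have [_ ->] := chart_param cc (Kc Kp).
  have phi'off x : ~ (param c @` K) x -> phi' x = phi x.
    by move=> nK; rewrite /phi' asboolF.
  have near_off x : ~ (param c @` K) x -> \forall y \near x, ~ (param c @` K) y.
    by move=> nK; apply: open_nbhs_nbhs; split=> //; exact/closed_openC/disc_closed.
  have KoimK x : (param c @` Ko) x -> (param c @` K) x.
    by move=> [p /KoK Kp <-]; exists p.
  exists phi'; last first.
    move=> x nKo nU; rewrite /phi'; case: asboolP => // -[p Kp pE]; subst x.
    have [_ ->] := chart_param cc (Kc Kp).
    have nKop : ~ Ko p by move=> Kop; apply: nKo; exists p.
    by rewrite phiG // bd.
  split.
    move=> x nU'.
    have [[p Kp pE]|nK] := pselect ((param c @` K) x); last first.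
      have nU : ~ universe D x by move=> /UU'; apply: contra_not nU'; apply => /KoimK.
      have [lc _] := pc.
      near=> y; rewrite !phi'off //; first by near: y; exact: lc.
      by near: y; exact: near_off.
    subst x; have [cp pK] := chart_param cc (Kc Kp).
    have nearK : \forall y \near param c p, (param c @` K) y -> phi' y = phi' (param c p).
      apply: (param_near cc (Kc Kp)).
      have [oc _ _] := cc.
      have : \forall q \near p, cdom c q by apply: open_nbhs_nbhs; split=> //; exact: Kc.
      apply: filterS2 (lcth' _ Kp nU') => q H cq [q' Kq'].
      move=> /(param_inj cc (Kc Kq') cq) E; subst q'.
      by rewrite !phi'K // H.
    have [Kop|nKop] := pselect (Ko p).
      by apply: filterS2 nearK (disc_interior Kop) => y; exact.
    have nU : ~ universe D (param c p).
      by move=> /UU'; apply: contra_not nU'; apply; exact: notKo.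
    have [lc _] := pc.
    have nearO := lc _ nU.
    apply: filterS2 nearK nearO => y HK HO.
    have [/HK //|nKy] := pselect ((param c @` K) y).
    by rewrite phi'off // HO phiG // bd // phi'K.
  move=> c0 x v w cr.
  have [xK|xK] := pselect ((param c @` K) x).
    apply: (chk' G phi' rG) cr xK => p Kp _; exact: phi'K.
  have cr0 := crD' _ _ _ _ xK cr.
  have [_ rule] := pc.
  move=> d1 d2 d3 d4 c1 c2 c3 c4 off.
  have [_ [_ [_ [_ [_ _ [ac0 cx] _ _]]]]] := cr.
  have cc0 := atlas_chart ac0; have [dx pK] := chart_coord cc0 cx.
  have rayoff d : \forall e \near 0^'+, ~ (param c @` K) (ray c0 x d e).
    apply: near_right.
    have cvr : ray c0 x d e @[e --> (0:R)] --> x.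
      have := cvg_comp _ _ (@line_cvg0 _ (coord c0 x) d) (param_continuous cc0 dx).
      by rewrite pK.
    by move/cvr: (near_off _ xK).
  have {}rule := rule _ _ _ _ cr0 _ _ _ _ c1 c2 c3 c4.
  have [r1 r2 r3 r4] := And4 (rayoff d1) (rayoff d2) (rayoff d3) (rayoff d4).
  have nUU y : ~ (param c @` K) y -> ~ universe D' y -> ~ universe D y.
    by move=> nK nU' /UU' H; apply/nU'/H => /KoimK.
  have E : \forall e \near 0^'+, phi (ray c0 x d4 e) =
      T (phi (ray c0 x d1 e)) (phi (ray c0 x d2 e)) (phi (ray c0 x d3 e)).
    apply: rule; near=> e.
    have [n1 n2 n3 n4] : [/\ ~ universe D' (ray c0 x d1 e), ~ universe D' (ray c0 x d2 e),
          ~ universe D' (ray c0 x d3 e) & ~ universe D' (ray c0 x d4 e)] by near: e.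
    by split; apply: nUU => //; near: e.
  near=> e.
  rewrite !phi'off; last first.
  + by near: e.
  + by near: e.
  + by near: e.
  + by near: e.
  by near: e.
- move=> phi psi phi' psi' pc qc r q E.
  have E' x : ~ (param c @` Ko) x -> ~ universe D x -> phi x = psi x.
    move=> nKo nU; rewrite r // q //; apply: E => /U'U H; exact/nU/H.
  have [G1 rG1 phiG] := ext _ pc; have [G2 rG2 psiG] := ext _ qc.
  have GG : forall a, G1 a = G2 a.
    apply: inj => // p Kp nKop nU.
    by rewrite -phiG // -psiG // E' //; exact: notKo.
  move=> x nU.
  have [[p Kp pE]|nK] := pselect ((param c @` Ko) x); last exact: E'.
  by subst x; rewrite phiG ?psiG //; exact: KoK.
Unshelve. all: by end_near.
Qed.

End LocalMove.

(** * Strands crossing a rectangle *)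

Section Strand.
Variables (R : realType) (F : topologicalType) (c : chart R F) (g : R -> F).
Variables (a b : R) (P : R -> plane R) (lo hi : R) (s : R -> R) (dir : bool).

(** The data hidden in [traces]: a parameter along the model curve, and whether it
increases. *)
Definition runs : Prop :=
  [/\ {within `[a, b], continuous s},
      if dir then [/\ s a = lo, s b = hi & {in `[a, b] &, {homo s : x y / x < y}}]
      else [/\ s a = hi, s b = lo & {in `[a, b] &, {homo s : x y /~ x < y}}] &
      forall t, a <= t <= b -> g t = param c (P (s t))].

Hypothesis ab : a < b.
Hypothesis rs : runs.

Lemma runs_lt t u : a <= t <= b -> a <= u <= b -> t < u ->
  if dir then s t < s u else s u < s t.
Proof.
by case: rs => _; case: dir => -[_ _ mono] _ tab uab tu; apply: mono; rewrite ?in_itv.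
Qed.

Lemma runs_inj t u : a <= t <= b -> a <= u <= b -> s t = s u -> t = u.
Proof.
move=> tab uab E; case: (ltgtP t u) => // tu.
  by have := runs_lt tab uab tu; case: dir; rewrite E ltxx.
by have := runs_lt uab tab tu; case: dir; rewrite E ltxx.
Qed.

Lemma runs_ends : (s a = lo /\ s b = hi) \/ (s a = hi /\ s b = lo).
Proof. by case: rs => _; case: dir => -[? ? _] _; [left|right]. Qed.

Lemma runs_in_oo t : a < t < b -> lo < s t < hi.
Proof.
move=> /andP[at_ tb].
have aI : a <= a <= b by rewrite lexx ltW.
have bI : a <= b <= b by rewrite lexx ltW.
have tI : a <= t <= b by rewrite !ltW.
have := runs_lt aI tI at_; have := runs_lt tI bI tb.
by case: rs => _; case: dir => -[-> -> _] _ -> ->.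
Qed.

Lemma runs_lohi : lo < hi.
Proof.
have m : a < (a + b) / 2 < b by move: ab => ab'; lra.
by have /andP[] := runs_in_oo m; exact: lt_trans.
Qed.

Lemma runs_in_cc t : a <= t <= b -> lo <= s t <= hi.
Proof.
have lh := runs_lohi.
move=> /andP[]; rewrite le_eqVlt => /orP[/eqP <- _|at_].
  by case: runs_ends => -[-> _]; rewrite lexx ltW.
rewrite le_eqVlt => /orP[/eqP ->|tb].
  by case: runs_ends => -[_ ->]; rewrite lexx ltW.
have tI : a < t < b by rewrite at_.
by have /andP[? ?] := runs_in_oo tI; rewrite !ltW.
Qed.

Lemma runs_surj x : lo <= x <= hi -> exists2 t, a <= t <= b & s t = x.
Proof.
move=> xI; have [cs _ _] := rs.
have [t tab <-] : exists2 t, t \in `[a, b] & s t = x.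
  apply: IVT => //; first exact: ltW.
  by case: runs_ends => -[-> ->]; move: xI => /andP[? ?]; rewrite ge_min le_max; apply/andP; split; apply/orP; [left|right|right|left].
by exists t => //; move: tab; rewrite in_itv.
Qed.

Hypothesis cc : is_chart c.
Hypothesis cg : continuous g.
Hypothesis Pc : forall x, lo <= x <= hi -> cdom c (P x).

Lemma runs_coord t : a <= t <= b -> ccod c (g t) /\ coord c (g t) = P (s t).
Proof.
move=> tab; have [_ _ /(_ _ tab) ->] := rs.
by apply: chart_param => //; apply: Pc; exact: runs_in_cc.
Qed.

(** The model curve is only assumed to be traversed; its continuity, in particular
at the ends, comes from that of the strand because the parameter [s] is a
homeomorphism. *)
Lemma runs_continuous x : lo <= x <= hi ->
  P @ within [set y | lo <= y <= hi] (nbhs x) --> P x.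
Proof.
move=> xI.
have [sg sgE] : exists sg : R -> R, forall y, lo <= y <= hi -> a <= sg y <= b /\ s (sg y) = y.
  have ex y : exists t, lo <= y <= hi -> a <= t <= b /\ s t = y.
    have [yI|nyI] := pselect (lo <= y <= hi); last by exists 0.
    by have [t tab st] := runs_surj yI; exists t.
  by have [sg H] := choice ex; exists sg.
have sgK : {in `[a, b], cancel s sg}.
  move=> t; rewrite in_itv /= => tab.
  have [? ?] := sgE _ (runs_in_cc tab); exact: runs_inj.
have csg : {within `[lo, hi], continuous sg}.
  have [cs m _] := rs.
  case: dir m => -[<- <- _].
    exact: (segment_can_le_continuous (ltW ab) cs sgK).
  exact: (segment_can_ge_continuous (ltW ab) cs sgK).
have csx : sg @ within [set y | lo <= y <= hi] (nbhs x) --> sg x.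
  move/subspace_continuousP : csg => /(_ x); rewrite /= in_itv /= => /(_ xI).
  by rewrite (_ : `[lo, hi]%classic = [set y | lo <= y <= hi]) //; apply/funext => y; rewrite /= in_itv.
have [sx1 sx2] := sgE _ xI.
have [cgx gE] := runs_coord sx1.
have c2 : coord c (g u) @[u --> sg x] --> P x.
  rewrite -[in X in _ --> X]sx2 -gE; apply: (cvg_comp g (coord c) _ (coord_continuous cc cgx)).
  exact: cg.
have c3 := cvg_comp _ _ csx c2.
move=> B HB.
have H : \forall y \near x, lo <= y <= hi -> B (coord c (g (sg y))) by exact: (c3 B HB).
suff : \forall y \near x, lo <= y <= hi -> B (P y) by [].
apply: filterS H => y H yI.
have [y1 y2] := sgE _ yI.
by have := H yI; rewrite /=; have [_ ->] := runs_coord y1; rewrite y2.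
Qed.

Lemma runs_derive_sign t l : a < t < b -> is_derive t (1 : R) s l ->
  if dir then 0 <= l else l <= 0.
Proof.
move=> /andP[at_ tb] ds.
have dh : is_derive (0 : R) (1 : R) (fun h => s (t + h) - s t) l.
  have A : is_derive (0 : R) (1 : R) (fun h => t + h * 1) 1 by exact: is_derive_line.
  have ds' : is_derive (t + 0 * 1) (1 : R) s l by rewrite mul0r addr0.
  have B := is_derive_scale_comp A ds'.
  have := is_deriveB B (is_derive_cst (s t) (0 : R) (1 : R)).
  rewrite subr0 scale1r; apply: near_eq_is_derive; near=> h.
  by rewrite -[LHS]/(s (t + h * 1) - s t) mulr1.
have near_h : \forall h \near (0:R)^'+, t < t + h < b.
  near=> h; rewrite ltrDl -ltrBrDl; apply/andP; split; near: h.
    exact: nbhs_right_gt.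
  by apply: nbhs_right_lt; rewrite subr_gt0.
have tI : a <= t <= b by rewrite !ltW.
have mono h : t < t + h < b -> if dir then s t < s (t + h) else s (t + h) < s t.
  by move=> /andP[h1 h2]; apply: runs_lt => //; lra.
have g0 : s (t + 0) - s t = 0 by rewrite addr0 subrr.
case: dir mono => mono; rewrite leNgt; apply/negP => l0.
  have H := is_derive_right_neg dh g0 l0.
  suff : \forall h \near (0:R)^'+, False by move/filter_ex => [].
  apply: filterS2 H near_h => h H /mono; lra.
have H := is_derive_right_pos dh g0 l0.
suff : \forall h \near (0:R)^'+, False by move/filter_ex => [].
apply: filterS2 H near_h => h H /mono; lra.
Unshelve. all: by end_near.
Qed.

End Strand.

Lemma traces_runs (R : realType) (F : topologicalType) (c : chart R F) g a b P lo hi :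
  traces c g a b P lo hi -> exists sd, runs c g a b P lo hi sd.1 sd.2.
Proof.
move=> [s [cs [m|m] tr]]; [by exists (s, true)|by exists (s, false)].
Qed.

(** * Crossings between graphs of functions *)

Definition orect (R : realType) (x0 x1 y0 y1 : R) : set (plane R) :=
  [set p | x0 < p.1 < x1 /\ y0 < p.2 < y1].

Lemma orect_open (R : realType) (x0 x1 y0 y1 : R) : open (orect x0 x1 y0 y1).
Proof.
have -> : orect x0 x1 y0 y1 = (fst @^-1` `]x0, x1[) `&` (snd @^-1` `]y0, y1[).
  by apply/seteqP; split=> p; rewrite /orect /= !in_itv.
by apply: openI; apply: open_comp; rewrite ?interval_open // => p _;
  [exact: cvg_fst|exact: cvg_snd].
Qed.

Lemma orect_sub (R : realType) (x0 x1 y0 y1 : R) :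
  orect x0 x1 y0 y1 `<=` rect x0 x1 y0 y1.
Proof. by move=> p [/andP[? ?] /andP[? ?]]; split; rewrite !ltW. Qed.

Lemma rect_compact (R : realType) (x0 x1 y0 y1 : R) : compact (rect x0 x1 y0 y1).
Proof.
have -> : rect x0 x1 y0 y1 = `[x0, x1] `*` `[y0, y1].
  by apply/seteqP; split=> p; rewrite /rect /= !in_itv.
by apply: compact_setX; exact: segment_compact.
Qed.

Definition isleft (o : side) : bool := if o is onleft then true else false.

(** The passage from a chart of the atlas, in which crossings are tested, to the
chart of the move: a linear map of positive determinant on velocities and on
directions of rays. *)
Lemma chart_change (R : realType) (S : oriented_surface R) (c c0 : chart R S) x :
  positive_chart c -> atlas c0 -> ccod c x -> ccod c0 x ->
  exists L : plane R -> plane R,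
    [/\ exists2 J, 0 < J & forall v w, det2 (L v) (L w) = J * det2 v w,
        forall (g : R -> S) t v, {for t, continuous g} -> g t = x ->
          is_derive t (1 : R) (coord c0 \o g) v ->
          is_derive t (1 : R) (coord c \o g) (L v) &
        forall d, is_derive (0 : R) (1 : R) (fun e => coord c (ray c0 x d e)) (L d) /\
          \forall e \near 0^'+, ccod c (ray c0 x d e)].
Proof.
move=> [cc pos] ac0 cx c0x; have cc0 := atlas_chart ac0.
have [_ C1] := pos _ ac0.
have [dx pK] := chart_coord cc0 c0x.
have [dPhi _ J0] := C1 (coord c0 x) (conj dx (eq_ind_r (ccod c) cx pK)).
set Phi := (fun p => coord c (id (param c0 p))) in dPhi J0.
exists ('d Phi (coord c0 x)); split.
- exists (det2 ('d Phi (coord c0 x) (1, 0)) ('d Phi (coord c0 x) (0, 1))) => //.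
  by move=> v w; exact: det2_linear.
- move=> g t v cg gx dv; subst x.
  exact: (@velocity_transport _ _ _ c0 c id g t v).
- move=> d; split.
    have := @is_derive_comp_diff _ _ _ (fun e : R => coord c0 x + e *: d) Phi 0 d (is_derive_line _ _ _).
    by rewrite scale0r addr0; apply.
  apply: near_right; have [_ oc _] := cc.
  have : \forall y \near x, ccod c y by exact: open_nbhs_nbhs.
  have cvr : ray c0 x d e @[e --> (0:R)] --> x.
    have := cvg_comp _ _ (@line_cvg0 _ (coord c0 x) d) (param_continuous cc0 dx).
    by rewrite pK.
  by move/cvr.
Qed.

(** The velocity of the strand is l(1, f') with l of the sign given by [dir], and
the height of the ray above the graph has derivative eta.2 - f' eta.1; these
are related by det2 w eta = l(eta.2 - f' eta.1). *)
Lemma graph_side (R : realType) (F : topologicalType) (c : chart R F) (g : R -> F)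
    a b f lo hi s dir t w eta (q : R -> plane R) so :
  a < b -> runs c g a b (graph_of f) lo hi s dir ->
  is_chart c -> continuous g ->
  (forall x, lo <= x <= hi -> cdom c (graph_of f x)) -> a < t < b ->
  derivable f (s t) 1 -> is_derive t (1 : R) (coord c \o g) w ->
  is_derive (0 : R) (1 : R) q eta -> q 0 = graph_of f (s t) ->
  on_side w so eta ->
  \forall e \near 0^'+, f (q e).1 <> (q e).2 /\
    (f (q e).1 < (q e).2) = (dir == isleft so).
Proof.
move=> ab rs cc cg fc tI df dw dq q0 side.
have tn : \forall u \near t, a < u < b.
  move: tI => /andP[at_ tb].
  by near=> u; apply/andP; split; near: u; [exact: lt_nbhsr|exact: lt_nbhsl].
have gE : \forall u \near t, coord c (g u) = graph_of f (s u).
  apply: filterS tn => u uI.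
  have uI' : a <= u <= b by move: uI => /andP[? ?]; rewrite !ltW.
  by have [_ ->] := runs_coord ab rs cc fc uI'.
have ds : is_derive t (1 : R) s w.1.
  by apply: near_eq_is_derive (is_derive_fst dw); apply: filterS gE => u /= ->.
have dfs : is_derive t (1 : R) (f \o s) w.2.
  by apply: near_eq_is_derive (is_derive_snd dw); apply: filterS gE => u /= ->.
pose f' := 'D_1 f (s t).
have df' : is_derive (s t) (1 : R) f f' by exact: derivableP.
have w2 : w.2 = w.1 * f'.
  rewrite -(@derive_val _ _ _ _ _ _ _ dfs).
  exact: (@derive_val _ _ _ _ _ _ _ (is_derive_scale_comp ds df')).
have q1 : (q 0).1 = s t by rewrite q0.
have dq1 := is_derive_fst dq.
have dfq : is_derive (0 : R) (1 : R) (f \o (fun e => (q e).1)) (eta.1 * f').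
  by apply: is_derive_scale_comp => //; rewrite q1.
pose G e := (q e).2 - f (q e).1.
have dG : is_derive (0 : R) (1 : R) G (eta.2 - eta.1 * f').
  exact: (is_deriveB (is_derive_snd dq) dfq).
have GE e : G e = (q e).2 - f (q e).1 by [].
have G0 : G 0 = 0 by rewrite GE q0 subrr.
have detE : det2 w eta = w.1 * (eta.2 - eta.1 * f') by rewrite /det2 w2; ring.
have sgn := runs_derive_sign rs tI ds.
have pos : 0 < eta.2 - eta.1 * f' -> \forall e \near 0^'+, f (q e).1 < (q e).2.
  by move=> H; apply: filterS (is_derive_right_pos dG G0 H) => e; rewrite GE subr_gt0.
have neg : eta.2 - eta.1 * f' < 0 -> \forall e \near 0^'+, (q e).2 < f (q e).1.
  by move=> H; apply: filterS (is_derive_right_neg dG G0 H) => e; rewrite GE subr_lt0.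
have up : 0 < eta.2 - eta.1 * f' -> (dir == isleft so) = true ->
    \forall e \near 0^'+, f (q e).1 <> (q e).2 /\ (f (q e).1 < (q e).2) = (dir == isleft so).
  by move=> /pos H ->; apply: filterS H => e H; split=> //; apply/eqP; rewrite lt_eqF.
have down : eta.2 - eta.1 * f' < 0 -> (dir == isleft so) = false ->
    \forall e \near 0^'+, f (q e).1 <> (q e).2 /\ (f (q e).1 < (q e).2) = (dir == isleft so).
  move=> /neg H ->; apply: filterS H => e H; split; first by apply/eqP; rewrite gt_eqF.
  by rewrite ltNge ltW.
move: side; rewrite /on_side detE; clear rs.
case: so up down => up down side; case: dir sgn up down => sgn up down.
- by apply: up => //; nra.
- by apply: down => //; nra.
- by apply: down => //; nra.
- by apply: up => //; nra.
Unshelve. all: by end_near.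
Qed.

Lemma near_fst (R : realType) (p : plane R) (P : set R) :
  (\forall x \near p.1, P x) -> \forall q \near p, P q.1.
Proof. by move=> H; exact: (@cvg_fst _ _ (nbhs p.1) (nbhs p.2) _ P H). Qed.

Lemma near_snd (R : realType) (p : plane R) (P : set R) :
  (\forall x \near p.2, P x) -> \forall q \near p, P q.2.
Proof. by move=> H; exact: (@cvg_snd _ _ (nbhs p.1) (nbhs p.2) _ P H). Qed.

Lemma same_point_trans (R : realType) n (i j k : 'I_n) (t u v : R) :
  same_point i t j u -> same_point j u k v -> same_point i t k v.
Proof.
by move=> [-> [z ->]] [-> [z' ->]]; split=> //; exists (z + z'); rewrite intrD addrA.
Qed.

Section Graphs.
Variables (R : realType) (S : oriented_surface R) (n : nat) (D : diagram S n).
Variables (c : chart R S) (m : nat) (comp : 'I_m -> 'I_n) (a b : 'I_m -> R).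
Variables (f : 'I_m -> R -> R) (x0 x1 y0 y1 : R).
Variables (s : 'I_m -> R -> R) (dir : 'I_m -> bool).
Let K := rect x0 x1 y0 y1.

Hypothesis pc : positive_chart c.
Hypothesis Kc : K `<=` cdom c.
Hypothesis ab : forall k, a k < b k.
Hypothesis meets : meets_in_strands D c K comp a b.
Hypothesis gr : forall k, graph_in (f k) x0 x1 y0 y1.
Hypothesis rs : forall k,
  runs c (curve D (comp k)) (a k) (b k) (graph_of (f k)) x0 x1 (s k) (dir k).
Hypothesis ends : forall k l, k != l -> f k x0 != f l x0 /\ f k x1 != f l x1.

Let cc : is_chart c. Proof. by case: pc. Qed.

(** The type of a point with respect to a family of graphs: the set of graphs that
it lies above. *)
Definition above_type (p : plane R) : 'I_m -> bool := fun k => f k p.1 < p.2.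

Lemma graph_in_rect k x : x0 <= x <= x1 -> K (graph_of (f k) x).
Proof. by move=> xI; split=> //; have [/(_ _ xI)/andP[? ?] _] := gr k; rewrite !ltW. Qed.

Lemma graph_in_dom k x : x0 <= x <= x1 -> cdom c (graph_of (f k) x).
Proof. by move=> /(graph_in_rect k)/Kc. Qed.

Lemma graph_curve k t : a k <= t <= b k ->
  curve D (comp k) t = param c (graph_of (f k) (s k t)).
Proof. by case: (rs k) => _ _; apply. Qed.

Lemma graph_hits k x : x0 <= x <= x1 ->
  exists t, [/\ a k <= t <= b k, s k t = x &
    curve D (comp k) t = param c (graph_of (f k) x)].
Proof.
move=> /(runs_surj (ab k) (rs k))[t tI sx]; exists t; split=> //.
by rewrite graph_curve // sx.
Qed.

Lemma curve_hits i t p : K p -> curve D i t = param c p ->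
  exists k (z : int), [/\ comp k = i, a k <= t + z%:~R <= b k &
    p = graph_of (f k) (s k (t + z%:~R))].
Proof.
move=> Kp E; have /meets [k [z [ki tI]]] : (param c @` K) (curve D i t) by exists p.
exists k, z; split=> //; apply: (param_inj cc (Kc Kp)).
  exact/graph_in_dom/(runs_in_cc (ab k) (rs k)).
by rewrite -E -graph_curve // ki curve_shift.
Qed.

Lemma graph_universe p : K p ->
  universe D (param c p) <-> exists k, f k p.1 = p.2.
Proof.
move=> Kp; split=> [[i [t E]]|[k E]].
  have [k [z [_ _ ->]]] := curve_hits Kp (esym E).
  by exists k.
have [p1 _] := Kp.
have [t [_ _ H]] := graph_hits k p1.
by exists (comp k), t; rewrite H /graph_of E; case: p {Kp E p1 H}.
Qed.

Lemma graph_cvg k x : x0 <= x <= x1 ->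
  f k @ within [set y | x0 <= y <= x1] (nbhs x) --> f k x.
Proof.
move=> xI.
have := runs_continuous (ab k) (rs k) cc (@curve_continuous _ _ _ D (comp k))
  (graph_in_dom k) xI.
by move=> H; apply: (cvg_comp (graph_of (f k)) snd H); exact: cvg_snd.
Qed.

Lemma above_near k p : K p -> f k p.1 <> p.2 ->
  \forall q \near p, K q -> f k q.1 <> q.2 /\ (f k q.1 < q.2) = (f k p.1 < p.2).
Proof.
move=> Kp /eqP; rewrite neq_lt => /orP[]lt; have [pI _] := Kp.
- pose mid := (f k p.1 + p.2) / 2.
  have H1 : \forall x \near p.1, x0 <= x <= x1 -> f k x < mid.
    have lm : f k p.1 < mid by rewrite /mid; lra.
    exact: (graph_cvg (k := k) pI (lt_nbhsl lm)).
  have H2 : \forall q \near p, x0 <= q.1 <= x1 -> f k q.1 < mid.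
    exact: near_fst H1.
  have H3 : \forall q \near p, mid < q.2.
    by apply: (@near_snd _ p [set y | mid < y]); apply: lt_nbhsr; rewrite /mid; lra.
  apply: filterS2 H2 H3 => q H2 H3 [q1 _].
  have ltq : f k q.1 < q.2 by apply: lt_trans H3; exact: H2.
  by rewrite ltq lt; split=> //; apply/eqP; rewrite lt_eqF.
- pose mid := (f k p.1 + p.2) / 2.
  have H1 : \forall x \near p.1, x0 <= x <= x1 -> mid < f k x.
    have lm : mid < f k p.1 by rewrite /mid; lra.
    exact: (graph_cvg (k := k) pI (lt_nbhsr lm)).
  have H2 : \forall q \near p, x0 <= q.1 <= x1 -> mid < f k q.1.
    exact: near_fst H1.
  have H3 : \forall q \near p, q.2 < mid.
    by apply: (@near_snd _ p [set y | y < mid]); apply: lt_nbhsl; rewrite /mid; lra.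
  apply: filterS2 H2 H3 => q H2 H3 [q1 _].
  have ltq : q.2 < f k q.1 by apply: (lt_trans H3); exact: H2.
  split; first by apply/eqP; rewrite gt_eqF.
  by apply/idP/idP => H; lra.
Qed.

Lemma above_type_near p : K p -> ~ universe D (param c p) ->
  \forall q \near p, K q -> ~ universe D (param c q) /\ above_type q = above_type p.
Proof.
move=> Kp nU.
have H : \forall q \near p, forall k, K q -> f k q.1 <> q.2 /\ (f k q.1 < q.2) = (f k p.1 < p.2).
  apply: (@filter_forall _ 'I_m (fun k q => K q -> f k q.1 <> q.2 /\
    (f k q.1 < q.2) = (f k p.1 < p.2)) (nbhs p)) => k.
  have nE : f k p.1 <> p.2 by move=> E; apply: nU; apply/graph_universe => //; exists k.
  exact: (above_near Kp nE).
apply: filterS H => q H Kq; split; last by apply/funext => k; have [] := H k Kq.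
by move=> /(graph_universe Kq)[k E]; have [] := H k Kq.
Qed.

(** If two strands overlapped as parts of a circle, one of the ends of one of them
would be on both, and the two graphs would share an end point. *)
Lemma strand_unique k l t u : a k <= t <= b k -> a l <= u <= b l ->
  same_point (comp k) t (comp l) u -> k = l.
Proof.
(* follow the strand k' to the start of the strand l', which lies on both *)
have key k' l' t' (z : int) : comp k' = comp l' -> a k' <= t' <= b k' ->
    a l' <= t' + z%:~R <= b l' -> a k' <= a l' - z%:~R -> k' = l'.
  move=> cE /andP[t1 t2] /andP[u1 u2] aa.
  apply/eqP; apply: contraT => /ends [e0 e1].
  have tI : a k' <= a l' - z%:~R <= b k' by apply/andP; split; lra.
  have uI : a l' <= a l' <= b l' by rewrite lexx ltW.
  have := graph_curve tI; rewrite cE -(curve_shift D (comp l') (a l' - z%:~R) z) subrK graph_curve //.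
  move=> /(param_inj cc (graph_in_dom _ (runs_in_cc (ab l') (rs l') uI))
    (graph_in_dom _ (runs_in_cc (ab k') (rs k') tI))) [<-] E.
  by case: (runs_ends (rs l')) E => -[-> _] /esym/eqP; rewrite ?(negbTE e0) ?(negbTE e1).
move=> tI uI [cE [z E]]; subst u.
have [aa|aa] := lerP (a k) (a l - z%:~R); first exact: (key k l t z).
apply/esym; apply: (key l k (t + z%:~R) (- z)) => //.
  by rewrite mulrNz addrK.
by rewrite mulrNz; lra.
Qed.

(** Distinct graphs have distinct ends, so strands cross inside the rectangle. *)
Lemma strand_end_neq k l t u : k != l -> a k <= t <= b k -> a l <= u <= b l ->
  curve D (comp k) t = curve D (comp l) u -> a k < t < b k.
Proof.
move=> kl tI uI; rewrite !graph_curve //.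
move=> /(param_inj cc (graph_in_dom _ (runs_in_cc (ab k) (rs k) tI))
    (graph_in_dom _ (runs_in_cc (ab l) (rs l) uI))) [E1 E2].
rewrite -E1 in E2; have [e0 e1] := ends kl.
have ne (y : R) : s k t = y -> y = x0 \/ y = x1 -> False.
  by move=> sy [yE|yE]; move/eqP: E2; rewrite sy yE ?(negbTE e0) ?(negbTE e1).
move/andP: (tI) => [t1 t2]; rewrite !lt_neqAle t1 t2 !andbT.
apply/andP; split; apply/eqP => tE.
  apply: (ne _ erefl); rewrite -tE.
  by case: (runs_ends (rs k)) => -[-> _]; [left|right].
apply: (ne _ erefl); rewrite tE.
by case: (runs_ends (rs k)) => -[_ ->]; [right|left].
Qed.

(** The type of the points of a corner at the crossing of the strands [k] and [l],
[bs] being the type with respect to the other strands: the left of a strand is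
above it exactly when the strand runs from left to right. *)
Definition corner_type (bs : 'I_m -> bool) (k l : 'I_m) (so su : side) : 'I_m -> bool :=
  fun j => if j == k then dir k == isleft so else
           if j == l then dir l == isleft su else bs j.

Definition crossing_at c0 (x : S) (v w : plane R) (k l : 'I_m) (p : plane R) : Prop :=
  forall so su d (N : set (plane R)), nbhs p N -> corner v w so su d ->
    \forall e \near 0^'+, exists q, [/\ K q /\ N q, ray c0 x d e = param c q,
      ~ universe D (param c q) &
      above_type q = corner_type (above_type p) k l so su].

(** All other strands stay away from the crossing, since there is no triple point;
the sides of the two crossing strands are given by [graph_side]. *)
Lemma graph_crossing c0 x v w : crossing D c0 x v w -> (param c @` K) x ->
  exists k l p t u, [/\ k != l,
    [/\ over D (comp k) t, a k <= t <= b k, a l <= u <= b l &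
        curve D (comp k) t = curve D (comp l) u],
    [/\ K p, x = param c p, f k p.1 = p.2 & f l p.1 = p.2],
    forall j, f j p.1 = p.2 -> j = k \/ j = l &
    crossing_at c0 x v w k l p].
Proof.
move=> [i [t [j [u [dp ov [ac0 c0x] xE [vE wE]]]]]] [p Kp pE].
have [k [z [ki tI pk]]] := curve_hits Kp (etrans (esym xE) (esym pE)).
have xE' : x = curve D j u by rewrite xE; case: dp.
have [l [z' [lj uI pl]]] := curve_hits Kp (etrans (esym xE') (esym pE)).
subst i j.
have [t' t'E] : exists t', t' = t + z%:~R by exists (t + z%:~R).
have [u' u'E] : exists u', u' = u + z'%:~R by exists (u + z'%:~R).
rewrite -t'E in tI pk; rewrite -u'E in uI pl.
have st : same_point (comp k) t (comp k) t' by split=> //; exists z.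
have su : same_point (comp l) u (comp l) u' by split=> //; exists z'.
have xt' : x = curve D (comp k) t' by rewrite xE (curve_same D st).
have xu' : x = curve D (comp l) u' by rewrite xE' (curve_same D su).
have kl : k != l.
  apply/eqP => kl; subst l; have [_] := dp; apply.
  have tu : t' = u'.
    apply: (runs_inj (rs k)) => //.
    by have [-> _] : graph_of (f k) (s k t') = graph_of (f k) (s k u') by rewrite -pk -pl.
  split=> //; exists (z - z'); rewrite intrB addrA -t'E tu u'E; ring.
have tI' : a k < t' < b k by apply: (strand_end_neq kl tI uI); rewrite -xt'.
have uI' : a l < u' < b l.
  by apply: (@strand_end_neq l k u' t') => //; rewrite 1?eq_sym // -xt'.
have ov' : over D (comp k) t' by exact: over_same st ov.
have fk : f k p.1 = p.2 by rewrite pk.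
have fl : f l p.1 = p.2 by rewrite pl.
have fjE j : f j p.1 = p.2 -> j = k \/ j = l.
  move=> fj; have [t1 [tI1 _ tc]] := graph_hits j (proj1 Kp).
  have {}tc : x = curve D (comp j) t1 by rewrite tc -pE /graph_of fj; case: (p).
  have [sp|nsp] := pselect (same_point (comp k) t (comp j) t1).
    left; apply/esym/(strand_unique tI tI1).
    exact: same_point_trans (same_point_sym st) sp.
  right; apply/esym/(strand_unique uI tI1).
  apply: (same_point_trans (same_point_sym su)).
  by apply: (curve_no_triple dp); split=> //; rewrite -xE.
exists k, l, p, t', u'; split=> //; first by split=> //; rewrite -xt'.
move=> so sd d N nN cd.
have cx : ccod c x by rewrite -pE; have [] := chart_param cc (Kc Kp).
have pK : coord c x = p by rewrite -pE; have [] := chart_param cc (Kc Kp).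
have [L [[J J0 LJ] Lg Ld]] := chart_change pc ac0 cx c0x.
have [dq cq] := Ld d.
pose q e := coord c (ray c0 x d e).
have q0 : q 0 = p.
  rewrite /q /ray scale0r addr0.
  by have [_ ->] := chart_coord (atlas_chart ac0) c0x.
have vk : is_derive t' (1 : R) (coord c \o curve D (comp k)) (L v).
  apply: Lg; [exact: curve_continuous|by []|].
  by rewrite vE (velocity_same D c0 st); apply: curve_derive => //; rewrite -xt'.
have wl : is_derive u' (1 : R) (coord c \o curve D (comp l)) (L w).
  apply: Lg; [exact: curve_continuous|by []|].
  by rewrite wE (velocity_same D c0 su); apply: curve_derive => //; rewrite -xu'.
have sideL y o : on_side y o d -> on_side (L y) o (L d).
  by case: o => /=; rewrite LJ ?pmulr_rgt0 ?pmulr_rlt0.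
have dfk : derivable (f k) (s k t') 1.
  by have [_ H] := gr k; apply: H; have p1 := runs_in_oo (ab k) (rs k) tI'; exact: p1.
have dfl : derivable (f l) (s l u') 1.
  by have [_ H] := gr l; apply: H; have p1 := runs_in_oo (ab l) (rs l) uI'; exact: p1.
have [cdv cdw] := cd.
have Hk := graph_side (ab k) (rs k) cc (@curve_continuous _ _ _ D (comp k))
  (graph_in_dom k) tI' dfk vk dq (etrans q0 pk) (sideL _ _ cdv).
have Hl := graph_side (ab l) (rs l) cc (@curve_continuous _ _ _ D (comp l))
  (graph_in_dom l) uI' dfl wl dq (etrans q0 pl) (sideL _ _ cdw).
have cvq : q e @[e --> (0:R)] --> p by rewrite -q0; exact: is_derive_cvg dq.
have Ko : orect x0 x1 y0 y1 p.
  have p1 := runs_in_oo (ab k) (rs k) tI'.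
  rewrite pk; split=> //=; have [H _] := gr k; apply: H.
  by move/andP: p1 => [? ?]; rewrite !ltW.
have nK : \forall e \near (0 : R)^'+, K (q e).
  apply: near_right; apply: cvq.
  have : \forall y \near p, orect x0 x1 y0 y1 y.
    by apply: open_nbhs_nbhs; split=> //; exact: orect_open.
  by apply: filterS; exact: orect_sub.
have nN' : \forall e \near (0 : R)^'+, N (q e) by apply: near_right; exact: cvq.
have others : \forall e \near (0 : R)^'+, forall j, f j p.1 <> p.2 ->
    K (q e) -> f j (q e).1 <> (q e).2 /\ (f j (q e).1 < (q e).2) = (f j p.1 < p.2).
  apply: (@filter_forall _ 'I_m (fun j e => f j p.1 <> p.2 -> K (q e) ->
    f j (q e).1 <> (q e).2 /\ (f j (q e).1 < (q e).2) = (f j p.1 < p.2))) => j.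
  have [E|nE] := pselect (f j p.1 = p.2); first by near=> e => /(_ E).
  by apply: filterS (near_right (cvq _ (above_near Kp nE))) => e H _.
near=> e; exists (q e).
have Ke : K (q e) by near: e.
have rayE : ray c0 x d e = param c (q e).
  by have [_ ->] : cdom c (coord c (ray c0 x d e)) /\ param c (q e) = ray c0 x d e
    by apply: chart_coord => //; near: e.
have [gk1 gk2] : f k (q e).1 <> (q e).2 /\ (f k (q e).1 < (q e).2) = (dir k == isleft so).
  by near: e.
have [gl1 gl2] : f l (q e).1 <> (q e).2 /\ (f l (q e).1 < (q e).2) = (dir l == isleft sd).
  by near: e.
have oth : forall j, f j p.1 <> p.2 -> K (q e) ->
    f j (q e).1 <> (q e).2 /\ (f j (q e).1 < (q e).2) = (f j p.1 < p.2) by near: e.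
have allj j : f j (q e).1 <> (q e).2 /\
    (f j (q e).1 < (q e).2) = corner_type (above_type p) k l so sd j.
  rewrite /corner_type; case: eqVneq => [->//|jk]; case: eqVneq => [->//|jl].
  apply: oth => // /fjE [] jE; first by rewrite jE eqxx in jk.
  by rewrite jE eqxx in jl.
split=> //.
- by split=> //; near: e.
- by move=> /(graph_universe Ke)[j E]; have [] := allj j.
- by apply/funext => j; have [] := allj j.
Unshelve. all: by end_near.
Qed.

Lemma graph_crossing_exists k l x : k != l -> x0 <= x <= x1 -> f k x = f l x ->
  exists c0 v w, crossing D c0 (param c (x, f k x)) v w /\ det2 v w != 0.
Proof.
move=> kl xI E.
have [t [tI st tc]] := graph_hits k xI; have [u [uI su uc]] := graph_hits l xI.
have dp : double_point (curve D) (comp k) t (comp l) u.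
  split; first by rewrite tc uc /graph_of E.
  by move/(strand_unique tI uI)/eqP; rewrite (negbTE kl).
by have := double_point_crossing dp; rewrite tc.
Qed.

End Graphs.

(** * Colorings of a tangle of graphs *)

(** A diagram that meets a rectangle in graphs of functions, with distinct ends,
together with a relation telling which of two strands passes over. *)
Record graph_tangle (R : realType) (S : oriented_surface R) (n : nat)
    (D : diagram S n) (c : chart R S) (m : nat) (comp : 'I_m -> 'I_n)
    (a b : 'I_m -> R) (f : 'I_m -> R -> R) (x0 x1 y0 y1 : R)
    (s : 'I_m -> R -> R) (dir : 'I_m -> bool) (above : 'I_m -> 'I_m -> Prop) : Prop :=
  GraphTangle {
  gt_chart : positive_chart c;
  gt_dom : rect x0 x1 y0 y1 `<=` cdom c;
  gt_ab : forall k, a k < b k;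
  gt_meets : meets_in_strands D c (rect x0 x1 y0 y1) comp a b;
  gt_graph : forall k, graph_in (f k) x0 x1 y0 y1;
  gt_runs : forall k, runs c (curve D (comp k)) (a k) (b k) (graph_of (f k))
    x0 x1 (s k) (dir k);
  gt_ends : forall k l, k != l -> f k x0 != f l x0 /\ f k x1 != f l x1;
  gt_total : forall k l, k != l -> above k l \/ above l k;
  gt_over : forall k l, above k l -> strand_above D comp a b k l }.

Lemma corner_ex (R : realType) (v w : plane R) so su : det2 v w != 0 ->
  exists d, corner v w so su d.
Proof.
move=> vw; pose sg o : R := if o is onleft then 1 else -1.
pose k := det2 v w.
exists (((sg so / k) *: w) - ((sg su / k) *: v)).
have e1 : det2 v ((sg so / k) *: w - (sg su / k) *: v) = sg so.
  transitivity ((sg so / k) * det2 v w); last by rewrite mulfVK.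
  by rewrite /det2 /= /GRing.scale /=; ring.
have e2 : det2 w ((sg so / k) *: w - (sg su / k) *: v) = sg su.
  transitivity ((sg su / k) * det2 v w); last by rewrite mulfVK.
  by rewrite /det2 /= /GRing.scale /=; ring.
by split; rewrite /on_side ?e1 ?e2; [case: so {e1 e2}|case: su {e1 e2}]; rewrite /sg ?ltr01 ?ltrN10.
Qed.

Section CornerColors.
Variables (R : realType) (S : oriented_surface R) (n : nat) (D : diagram S n).
Variables (X : Type) (T : X -> X -> X -> X) (phi : S -> X).
Variables (c : chart R S) (x : S) (v w : plane R) (C : side -> side -> X).

Let at_corner so su d e :=
  ~ universe D (ray c x d e) /\ phi (ray c x d e) = C so su.

Hypothesis phiC : forall so su d, corner v w so su d ->
  \forall e \near (0 : R)^'+, at_corner so su d e.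

Let corner_eq : Prop :=
  C onleft onright = T (C onright onright) (C onright onleft) (C onleft onleft).

Lemma corner_colors_rule : corner_eq -> crossing_rule T D phi c x v w.
Proof.
move=> E d1 d2 d3 d4 /phiC h1 /phiC h2 /phiC h3 /phiC h4 _.
near=> e.
have [_ ->] : at_corner onright onright d1 e by near: e.
have [_ ->] : at_corner onright onleft d2 e by near: e.
have [_ ->] : at_corner onleft onleft d3 e by near: e.
have [_ ->] : at_corner onleft onright d4 e by near: e.
exact: E.
Unshelve. all: by end_near.
Qed.

(** The strands being transverse, every corner contains a ray along which the
equation can be read. *)
Lemma rule_corner_colors :
  det2 v w != 0 -> crossing_rule T D phi c x v w -> corner_eq.
Proof.
move=> vw rule.
have [d1 c1] := corner_ex onright onright vw.
have [d2 c2] := corner_ex onright onleft vw.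
have [d3 c3] := corner_ex onleft onleft vw.
have [d4 c4] := corner_ex onleft onright vw.
have h1 := phiC c1; have h2 := phiC c2; have h3 := phiC c3; have h4 := phiC c4.
suff : \forall e \near (0 : R)^'+, corner_eq by move/filter_ex => [].
have {}rule : \forall e \near (0 : R)^'+, phi (ray c x d4 e) =
    T (phi (ray c x d1 e)) (phi (ray c x d2 e)) (phi (ray c x d3 e)).
  apply: (rule d1 d2 d3 d4) => //; near=> e.
  have [? _] : at_corner onright onright d1 e by near: e.
  have [? _] : at_corner onright onleft d2 e by near: e.
  have [? _] : at_corner onleft onleft d3 e by near: e.
  by have [? _] : at_corner onleft onright d4 e by near: e.
near=> e.
have [_ E1] : at_corner onright onright d1 e by near: e.
have [_ E2] : at_corner onright onleft d2 e by near: e.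
have [_ E3] : at_corner onleft onleft d3 e by near: e.
have [_ E4] : at_corner onleft onright d4 e by near: e.
by rewrite /corner_eq -E1 -E2 -E3 -E4; near: e.
Unshelve. all: by end_near.
Qed.

End CornerColors.

Lemma vertical_cvg (R : realType) (x z : R) : (x, t) @[t --> z] --> (x, z).
Proof. by apply: (@cvg_pair _ _ _ (nbhs z) (nbhs x) (nbhs z)); [exact: cvg_cst|exact: cvg_id]. Qed.

Lemma horizontal_cvg (R : realType) (x z : R) : (t, z) @[t --> x] --> (x, z).
Proof. by apply: (@cvg_pair _ _ _ (nbhs x) (nbhs x) (nbhs z)); [exact: cvg_id|exact: cvg_cst]. Qed.

Section GraphModel.
Variables (R : realType) (S : oriented_surface R) (n : nat) (D : diagram S n).
Variables (c : chart R S) (m : nat) (comp : 'I_m -> 'I_n) (a b : 'I_m -> R).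
Variables (f : 'I_m -> R -> R) (x0 x1 y0 y1 : R).
Variables (s : 'I_m -> R -> R) (dir : 'I_m -> bool) (above : 'I_m -> 'I_m -> Prop).
Variables (X : Type) (T : X -> X -> X -> X).
Let K := rect x0 x1 y0 y1.
Hypothesis gt : graph_tangle D c comp a b f x0 x1 y0 y1 s dir above.
Let theta := above_type f.

Let pc := gt_chart gt. Let Kc := gt_dom gt. Let ab := gt_ab gt.
Let meets := gt_meets gt. Let gr := gt_graph gt. Let rs := gt_runs gt.
Let ends := gt_ends gt.
Let cc : is_chart c. Proof. by case: pc. Qed.

(** The equation at a crossing of the strand [k] over the strand [l]. For fixed
[bs] the four types involved form a two-dimensional face of the cube of all
types. *)
Definition face (G : ('I_m -> bool) -> X) (bs : 'I_m -> bool) k l : Prop :=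
  G (corner_type dir bs k l onleft onright) =
  T (G (corner_type dir bs k l onright onright))
    (G (corner_type dir bs k l onright onleft))
    (G (corner_type dir bs k l onleft onleft)).

(** All the faces are required, whether or not the corresponding crossing occurs
in the diagram. *)
Definition faces (G : ('I_m -> bool) -> X) : Prop :=
  forall k l bs, k != l -> above k l -> face G bs k l.

Section AtCrossing.
Variables (c0 : chart R S) (x : S) (v w : plane R) (k l : 'I_m) (p : plane R).
Hypothesis cr : crossing_at D c f x0 x1 y0 y1 dir c0 x v w k l p.
Variables (phi : S -> X) (G : ('I_m -> bool) -> X).
Hypothesis phiG : \forall q \near p, K q -> ~ universe D (param c q) ->
  phi (param c q) = G (theta q).

Let phi_corner so su d : corner v w so su d -> \forall e \near (0 : R)^'+,
  ~ universe D (ray c0 x d e) /\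
  phi (ray c0 x d e) = G (corner_type dir (theta p) k l so su).
Proof.
move=> cd; have H0 := cr phiG cd.
apply: filterS H0 => e [q [[Kq H] E nU tE]]; rewrite E -tE.
by split=> //; exact: H.
Qed.

Lemma face_crossing_rule : face G (theta p) k l -> crossing_rule T D phi c0 x v w.
Proof. exact: (corner_colors_rule phi_corner). Qed.

Lemma crossing_rule_face : det2 v w != 0 -> crossing_rule T D phi c0 x v w ->
  face G (theta p) k l.
Proof. exact: (rule_corner_colors phi_corner). Qed.

End AtCrossing.

Lemma crossing_above k l t u : k != l -> over D (comp k) t ->
  a k <= t <= b k -> a l <= u <= b l ->
  curve D (comp k) t = curve D (comp l) u -> above k l.
Proof.
move=> kl ov tI uI E; have [//|lk] := gt_total gt kl.
have ol := gt_over gt lk uI tI (esym E).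
have dp : double_point (curve D) (comp k) t (comp l) u.
  split=> // sp; move/eqP: kl; apply.
  exact: (strand_unique pc Kc ab gr rs ends tI uI).
by have [/(_ ov)] := over_one dp.
Qed.

Lemma faces_crossing_rule (G : ('I_m -> bool) -> X) (phi : S -> X) : faces G ->
  (forall p, K p -> ~ universe D (param c p) -> phi (param c p) = G (theta p)) ->
  forall c0 x v w, crossing D c0 x v w -> (param c @` K) x ->
  crossing_rule T D phi c0 x v w.
Proof.
move=> fG phiG c0 x v w cr xK.
have [k [l [p [t [u [kl [ov tI uI tu] _ _ ca]]]]]] :=
  graph_crossing pc Kc ab meets gr rs ends cr xK.
apply: (face_crossing_rule ca (G := G)).
  by near=> q => Kq nU; exact: phiG.
by apply: fG => //; exact: (crossing_above kl ov tI uI).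
Unshelve. all: by end_near.
Qed.

Lemma point_coloring_face (G : ('I_m -> bool) -> X) (phi : S -> X) k l x :
  (forall k l, above k l -> above l k -> False) ->
  point_coloring T D phi -> above k l -> x0 <= x <= x1 -> f k x = f l x ->
  (\forall q \near (x, f k x), K q -> ~ universe D (param c q) ->
     phi (param c q) = G (theta q)) ->
  face G (theta (x, f k x)) k l.
Proof.
move=> anti [_ rule] kl xI fkl phiG.
have kl' : k != l by apply/eqP => E; rewrite E in kl; exact: (anti _ _ kl kl).
have [c0 [v [w [cr vw]]]] := graph_crossing_exists pc Kc ab gr rs ends kl' xI fkl.
have pK : K (x, f k x) by exact: (graph_in_rect gr k xI).
have xK : (param c @` K) (param c (x, f k x)) by exists (x, f k x).
have [k' [l' [p [t [u [kl2 [ov tI uI tu] [Kp pE fk fl] only ca]]]]]] :=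
  graph_crossing pc Kc ab meets gr rs ends cr xK.
have pp := param_inj cc (Kc pK) (Kc Kp) pE; subst p.
have ab' := crossing_above kl2 ov tI uI tu.
have H := crossing_rule_face ca phiG vw (rule _ _ _ _ cr).
have [kE|kE] := only k erefl; have [lE|lE] := only l (esym fkl).
- by move: kl'; rewrite kE lE eqxx.
- by rewrite -kE -lE in H.
- by rewrite kE lE in kl; case: (anti _ _ kl ab').
- by move: kl'; rewrite kE lE eqxx.
Qed.

Lemma graph_type_near p : K p -> ~ universe D (param c p) ->
  \forall q \near p, K q -> theta q = theta p.
Proof.
move=> Kp nU; apply: filterS (above_type_near pc Kc ab meets gr rs Kp nU) => q H /H[].
done.
Qed.

Section Strips.
Variable phi : S -> X.
Hypothesis lc : locally_constant_off D phi.
Hypothesis y01 : y0 < y1.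

Definition has_type (tau : 'I_m -> bool) (p : plane R) :=
  [/\ K p, ~ universe D (param c p) & theta p = tau].

Let lc_near p : K p -> ~ universe D (param c p) ->
  \forall q \near p, phi (param c q) = phi (param c p).
Proof.
by move=> Kp nU; exact: (param_continuous cc (Kc Kp) (lc nU)).
Qed.

Lemma has_typeP tau p : K p ->
  has_type tau p <-> forall k, f k p.1 <> p.2 /\ (f k p.1 < p.2) = tau k.
Proof.
move=> Kp; have U := graph_universe pc Kc ab meets gr rs Kp; split.
  move=> [_ nU <-] k; split=> // E; apply: nU; apply/U; by exists k.
move=> H; split=> //; last by apply/funext => k; have [] := H k.
by move/U => [k E]; have [] := H k.
Qed.

(** The points of a given type on a vertical line form an interval. *)
Lemma vertical_constant tau x y y' : has_type tau (x, y) -> has_type tau (x, y') ->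
  phi (param c (x, y)) = phi (param c (x, y')).
Proof.
wlog yy : y y' / y <= y'.
  move=> wl h h'; have [/wl|/ltW/wl] := lerP y y'; first exact.
  by move=> ->.
move=> h h'.
have [K1 _ _] := h; have [K2 _ _] := h'.
have tb z : y <= z <= y' -> has_type tau (x, z).
  move=> /andP[z1 z2].
  have Kz : K (x, z) by case: K1 K2 => /= ? /andP[? ?] [/= ? /andP[? ?]]; split=> //=; apply/andP; split; lra.
  apply/has_typeP => // k /=.
  have [/= n1 t1] := (has_typeP tau K1).1 h k; have [/= n2 t2] := (has_typeP tau K2).1 h' k.
  rewrite -t1; split.
    move=> E; subst z; move: t1; rewrite -t2.
    have -> : (f k x < y) = false by rewrite ltNge z1.
    by move/esym/negbT; rewrite -leNgt => z3; apply: n2; apply/eqP; rewrite eq_le z3 z2.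
  apply/idP/idP => [fz|fy]; last exact: lt_le_trans z1.
  by rewrite t1 -t2; exact: lt_le_trans z2.
apply: (@locally_constant_segment R X y y' (fun z => phi (param c (x, z)))) => //.
move=> z /tb[Kz nz _].
have cz := @vertical_cvg R x z.
have H : \forall t \near z, phi (param c (x, t)) = phi (param c (x, z)).
  exact: (cz _ (lc_near Kz nz)).
by apply: filterS H.
Qed.

(** The color of the fibre over x does not depend on the height chosen in it, and
keeping that height while x varies shows that it is locally constant in x. *)
Lemma strip_constant tau p p' : has_type tau p -> has_type tau p' ->
  p.1 <= p'.1 -> (forall x, p.1 <= x <= p'.1 -> exists y, has_type tau (x, y)) ->
  phi (param c p) = phi (param c p').
Proof.
move=> h h' le fib.
have ex x : exists y, p.1 <= x <= p'.1 -> has_type tau (x, y).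
  have [/fib[y hy]|nx] := pselect (p.1 <= x <= p'.1); [by exists y|by exists 0].
have [V HV] := choice ex.
have E : phi (param c (p.1, V p.1)) = phi (param c (p'.1, V p'.1)).
  apply: (@locally_constant_segment R X p.1 p'.1 (fun x => phi (param c (x, V x)))) => //.
  move=> x xI; have hx := HV _ xI; have [Kx nx tx] := hx.
  have cz := @horizontal_cvg R x (V x).
  have n1 : \forall t \near x, phi (param c (t, V x)) = phi (param c (x, V x)).
    exact: (cz _ (lc_near Kx nx)).
  have n2 : \forall t \near x, K (t, V x) -> ~ universe D (param c (t, V x)) /\
      theta (t, V x) = theta (x, V x).
    exact: (cz _ (above_type_near pc Kc ab meets gr rs Kx nx)).
  apply: filterS2 n1 n2 => t /= n1 n2 tI; rewrite -n1.
  have ht := HV _ tI; have [Kt _ _] := ht.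
  have Kt' : K (t, V x) by split; [case: Kt|case: Kx].
  apply: (@vertical_constant tau) => //.
  by have [? tE] := n2 Kt'; split=> //; rewrite tE.
case: p h le fib ex HV E => x y h le fib ex HV E; case: p' h' le fib ex HV E => x' y' h' le fib ex HV E.
rewrite (@vertical_constant tau x y (V x)) //; last by apply: HV; rewrite /= lexx.
by rewrite E; apply: (@vertical_constant tau) => //; apply: HV; rewrite /= lexx andbT.
Qed.

(** Take the middle between the highest graph that has to be below and the lowest
one that has to be above. *)
Lemma fiber_ex (tau : 'I_m -> bool) x : x0 <= x <= x1 ->
  (forall i j, tau i -> ~~ tau j -> f i x < f j x) ->
  exists y, has_type tau (x, y).
Proof.
move=> xI H.
have gI k : y0 < f k x < y1 by have [] := gr k; move=> /(_ _ xI).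
pose lo := \big[Num.max/y0]_(i | tau i) f i x.
pose hi := \big[Num.min/y1]_(j | ~~ tau j) f j x.
have lohi : lo < hi.
  apply: lt_bigmin.
    by apply: bigmax_lt => // i _; case/andP: (gI i).
  move=> j tj; apply: bigmax_lt; first by case/andP: (gI j).
  by move=> i ti; exact: H.
have lo0 : y0 <= lo by exact: bigmax_ge_id.
have hi1 : hi <= y1 by exact: bigmin_le_id.
exists ((lo + hi) / 2).
have Kx : K (x, (lo + hi) / 2) by split=> //=; apply/andP; split; lra.
apply/has_typeP => // k /=; case E : (tau k).
  have : f k x <= lo by exact: le_bigmax_cond.
  move=> ?; have lt : f k x < (lo + hi) / 2 by lra.
  by rewrite lt; split=> //; apply/eqP; rewrite lt_eqF.
have : hi <= f k x by apply: bigmin_le_cond; rewrite E.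
move=> ?; have lt : (lo + hi) / 2 < f k x by lra.
split; first by apply/eqP; rewrite gt_eqF.
by apply/negbTE; rewrite -leNgt ltW.
Qed.

(** A type occurs over x exactly when the graphs of the type are below all the
others; if this set of x is convex, then the points of that type form one
strip. *)
Lemma class_constant tau p p' : has_type tau p -> has_type tau p' ->
  (forall i j x, tau i -> ~~ tau j -> f i p.1 < f j p.1 -> f i p'.1 < f j p'.1 ->
    (p.1 <= x <= p'.1) || (p'.1 <= x <= p.1) -> f i x < f j x) ->
  phi (param c p) = phi (param c p').
Proof.
wlog le : p p' / p.1 <= p'.1.
  move=> wl h h'; have [/wl|/ltW/wl] := lerP p.1 p'.1; first exact.
  move=> E H; apply/esym/E => // i j x ti tj p1 p2; rewrite orbC; exact: H.
move=> h h' H; apply: (strip_constant h h' le) => x xI.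
have [[/= p1 p2] _ _] := h; have [[/= p1' _] _ _] := h'.
have hlt q i j : has_type tau q -> tau i -> ~~ tau j -> f i q.1 < f j q.1.
  move=> hq ti /negbTE tj; have [Kq _ _] := hq.
  have /(has_typeP tau Kq) Hq := hq; have [_ E1] := Hq i; have [n2 E2] := Hq j.
  have l1 : f i q.1 < q.2 by rewrite E1.
  apply: (lt_le_trans l1); rewrite leNgt; by rewrite E2 tj.
apply: fiber_ex.
- by move: p1 p1' xI => /andP[? ?] /andP[? ?] /andP[? ?]; apply/andP; split; lra.
- move=> i j ti tj; apply: (H i j) => //; [exact: hlt|exact: hlt|by rewrite xI].
Qed.

End Strips.

End GraphModel.

(** * The cube of a third move *)

Section Algebra.
Variables (X : Type) (T : X -> X -> X -> X).

(** In the equation r4 = T r1 r2 r3, any three of the four entries determine the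
last one. *)
Lemma quasigroup_face : ternary_quasigroup T ->
  forall a b c a' b' c',
  [/\ a = a' -> b = b' -> c = c' -> T a b c = T a' b' c',
      b = b' -> c = c' -> T a b c = T a' b' c' -> a = a',
      a = a' -> c = c' -> T a b c = T a' b' c' -> b = b' &
      a = a' -> b = b' -> T a b c = T a' b' c' -> c = c'].
Proof.
move=> [q1 q2 q3] a b c a' b' c'; split.
- by move=> -> -> ->.
- move=> -> -> E; have [z [_ u]] := q1 b' c' (T a b' c').
  by rewrite -(u a) // -(u a').
- move=> -> -> E; have [z [_ u]] := q2 a' c' (T a' b c').
  by rewrite -(u b) // -(u b').
- move=> -> -> E; have [z [_ u]] := q3 a' b' (T a' b' c).
  by rewrite -(u c) // -(u c').
Qed.

(** A map on the cube colors the regions cut by three strands in general position,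
the coordinates telling whether a region is on the left of the top, of the
middle and of the bottom strand. A face is the equation at the crossing of two
strands, the third coordinate being fixed. *)
Definition top_middle (F : bool -> bool -> bool -> X) z :=
  F true false z = T (F false false z) (F false true z) (F true true z).
Definition top_bottom (F : bool -> bool -> bool -> X) y :=
  F true y false = T (F false y false) (F false y true) (F true y true).
Definition middle_bottom (F : bool -> bool -> bool -> X) x :=
  F x true false = T (F x false false) (F x false true) (F x true true).

(** A coloring of the cube is determined by a chain from the source to the target
of all three strands. Each of the other four values is given by one face, and
the two remaining faces are exactly the two KTQ axioms. *)
Definition chain_cube (a b c d : X) (x y z : bool) : X :=
  match x, y, z with
  | false, false, false => a
  | false, false, true => b
  | false, true, true => c
  | true, true, true => d
  | false, true, false => T a b c
  | true, false, true => T b c d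
  | true, true, false => T (T a b c) c d
  | true, false, false => T a b (T b c d)
  end.

Lemma chain_cubeP : ktq T -> forall a b c d,
  [/\ forall z, top_middle (chain_cube a b c d) z,
      forall y, top_bottom (chain_cube a b c d) y &
      forall x, middle_bottom (chain_cube a b c d) x].
Proof.
move=> [_ A1 A2] a b c d.
by split; case; rewrite /top_middle /top_bottom /middle_bottom /=.
Qed.

(** Three faces sharing the vertex w involve all the vertices but the one opposite
to w. Whatever w is, these seven values come from a chain, so that the
opposite vertex can be colored and the three other faces follow. This is the
algebraic content of the third Reidemeister move. *)
Lemma cube_complete : ktq T -> forall F wx wy wz,
  top_middle F wz -> top_bottom F wy -> middle_bottom F wx ->
  exists F', [/\ forall z, top_middle F' z, forall y, top_bottom F' y,
    forall x, middle_bottom F' x &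
    forall x y z, ~ [/\ x = ~~ wx, y = ~~ wy & z = ~~ wz] -> F' x y z = F x y z].
Proof.
move=> kT F wx wy wz; have [qT A1 A2] := kT; have [q1 q2 q3] := qT.
have qf := quasigroup_face qT.
move=> tm tb mb.
suff [a [b [c [d H]]]] : exists a b c d,
    forall x y z, ~ [/\ x = ~~ wx, y = ~~ wy & z = ~~ wz] ->
    chain_cube a b c d x y z = F x y z.
  by have [? ? ?] := chain_cubeP kT a b c d; exists (chain_cube a b c d).
move: tm tb mb; rewrite /top_middle /top_bottom /middle_bottom.
have cube_by_values a b c d : (forall x y z, (x == ~~ wx) && (y == ~~ wy) && (z == ~~ wz) ||
    asbool (chain_cube a b c d x y z = F x y z)) ->
    exists a b c d, forall x y z, ~ [/\ x = ~~ wx, y = ~~ wy & z = ~~ wz] ->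
    chain_cube a b c d x y z = F x y z.
  move=> H; exists a, b, c, d => x y z nw; have := H x y z.
  by case/orP => [/andP[/andP[/eqP e1 /eqP e2] /eqP e3]|/asboolP //]; case: nw.
(* the links 000, 001, 011, 111 of the chain are the given values, except the
   one opposite to w, if any, which is solved for in a face that contains it *)
case: wx wy wz cube_by_values => [] [] [] cube_by_values /= tm tb mb.
- have [a [aE _]] := q1 (F false false true) (F false true true) (F false true false).
  apply: (cube_by_values a (F false false true) (F false true true) (F true true true)).
  have E : T a (F false false true) (F true false true) = F true false false.
    have [_ u _ _] := qf (T a (F false false true) (F true false true)) (F true false true) (F true true true)
      (F true false false) (F true false true) (F true true true).
    by apply: u => //; rewrite -mb tb -aE; rewrite [RHS]A1 -tm.
  move=> [] [] [] //=; apply/asboolP => //.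
  - by rewrite aE -tb.
  - by rewrite -tm E.
- have [b [bE _]] := q2 (F false false false) (F false true true) (F false true false).
  apply: (cube_by_values (F false false false) b (F false true true) (F true true true)).
  have E : T (F false false false) b (T b (F false true true) (F true true true)) = F true false false.
    by rewrite A2 bE -tb -tm.
  have E' : T b (F false true true) (F true true true) = F true false true.
    have [_ _ u _] := qf (F true false false) (T b (F false true true) (F true true true)) (F true true true)
      (F true false false) (F true false true) (F true true true).
    by apply: u => //; rewrite -mb tb -bE A1 E.
  by move=> [] [] [] //=; apply/asboolP => //; rewrite bE -tb.
- apply: (cube_by_values (F false false false) (F false false true) (F false true true) (F true true true)).
  move=> [] [] [] //=; apply/asboolP => //.
  - by rewrite [LHS]A1 -tm -tb -mb.
  - by rewrite -tm -tb.
- have [c [cE _]] := q2 (F false false true) (F true true true) (F true false true).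
  apply: (cube_by_values (F false false false) (F false false true) c (F true true true)).
  have E : T (T (F false false false) (F false false true) c) c (F true true true) = F true true false.
    by rewrite A1 cE -tb -mb.
  have E' : T (F false false false) (F false false true) c = F false true false.
    have [_ _ u _] := qf (F false false false) (T (F false false false) (F false false true) c) (F true true false)
      (F false false false) (F false true false) (F true true false).
    by apply: u => //; rewrite -tm -E -A2 cE.
  by move=> [] [] [] //=; apply/asboolP => //; rewrite cE -tb.
- apply: (cube_by_values (F false false false) (F false false true) (F false true true) (F true true true)).
  move=> [] [] [] //=; apply/asboolP => //.
  by rewrite -mb -tb.
- apply: (cube_by_values (F false false false) (F false false true) (F false true true) (F true true true)).
  move=> [] [] [] //=; apply/asboolP => //.
  - by rewrite -mb -tb.
  - by rewrite A2 -mb -tb -tm.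
- apply: (cube_by_values (F false false false) (F false false true) (F false true true) (F true true true)).
  move=> [] [] [] //=; apply/asboolP => //.
  by rewrite -tm -tb.
- have [d [dE _]] := q3 (F false false true) (F false true true) (F true false true).
  apply: (cube_by_values (F false false false) (F false false true) (F false true true) d).
  have E : T (F false true false) (F false true true) d = F true true false.
    have [_ _ _ u] := qf (F false false false) (F false true false) (T (F false true false) (F false true true) d)
      (F false false false) (F false true false) (F true true false).
    by apply: u => //; rewrite -tm {1 2}mb -A2 dE -tb.
  move=> [] [] [] //=; apply/asboolP => //.
  - by rewrite -mb E.
  - by rewrite dE -tb.
Qed.

End Algebra.

(** * The two sides of a move *)

Section Supported.
Variables (R : realType) (S : oriented_surface R) (n : nat).
Implicit Types D : diagram S n.
Variables (c : chart R S) (m : nat) (comp : 'I_m -> 'I_n) (a b : 'I_m -> R).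

Lemma supported_in_sym D D' K :
  supported_in D D' c K comp a b -> supported_in D' D c K comp a b.
Proof.
move=> [pc ab m1 m2 off]; split=> // i t /off[-> H]; split=> //.
by split=> /H.
Qed.

Lemma supported_agree D D' (K Ko : set (plane R)) : compact K ->
  supported_in D D' c K comp a b ->
  (forall k t, a k < t < b k -> (param c @` Ko) (curve D (comp k) t)) ->
  agree_off c K Ko D D'.
Proof.
move=> Kcpt [[[cc _] Kc] ab m1 m2 off] inn.
have clK := disc_closed cc Kc Kcpt.
have offK i t : ~ (param c @` K) (curve D i t) ->
    curve D i t = curve D' i t /\ (over D i t <-> over D' i t).
  move=> nK; apply: off => -[k [z [kE /andP[t1 t2]]]]; apply: nK.
  by apply/m1; exists k, z; split=> //; rewrite !ltW.
split.
- move=> x nKo [i [t xE]]; exists i, t; rewrite xE; apply: (proj1 (off i t _)).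
  move=> [k [z [kE tI]]]; apply: nKo; rewrite xE -(curve_shift D i t z) -kE.
  exact: inn.
- move=> c0 x v w nK [i [t [j [u [[tu ns] ov acx xE [vE wE]]]]]].
  have nKt : ~ (param c @` K) (curve D i t) by rewrite -xE.
  have nKu : ~ (param c @` K) (curve D j u) by rewrite -tu.
  have vel i' t' : ~ (param c @` K) (curve D i' t') ->
      velocity c0 (curve D i') t' = velocity c0 (curve D' i') t'.
    move=> nK'; rewrite /velocity !derive1E; apply: near_eq_derive.
    have nO : \forall y \near curve D i' t', ~ (param c @` K) y.
      by apply: open_nbhs_nbhs; split=> //; exact: closed_openC.
    have nr : \forall r \near t', ~ (param c @` K) (curve D i' r).
      exact: (@curve_continuous _ _ _ D i' t' _ nO).
    apply: filterS nr => r nKr.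
    by rewrite /= (proj1 (offK _ _ nKr)).
  have [Et ot] := offK _ _ nKt; have [Eu ou] := offK _ _ nKu.
  exists i, t, j, u; split=> //.
  + by split=> //; rewrite -Et -Eu.
  + by apply/ot.
  + by rewrite -Et.
  + by rewrite vE wE !vel.
Qed.

End Supported.

Section GraphMoveSetup.
Variables (R : realType) (S : oriented_surface R) (n : nat) (D D' : diagram S n).
Variables (c : chart R S) (m : nat) (comp : 'I_m -> 'I_n) (a b : 'I_m -> R).
Variables (f : 'I_m -> R -> R) (x0 x1 y0 y1 : R).
Hypothesis sup : supported_in D D' c (rect x0 x1 y0 y1) comp a b.
Hypothesis gr : forall k, graph_in (f k) x0 x1 y0 y1.
Variables (s : 'I_m -> R -> R) (dir : 'I_m -> bool).
Hypothesis rs : forall k,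
  runs c (curve D (comp k)) (a k) (b k) (graph_of (f k)) x0 x1 (s k) (dir k).
Hypothesis ends : forall k l, k != l -> f k x0 != f l x0 /\ f k x1 != f l x1.

Let pc : positive_chart c. Proof. by have [[]] := sup. Qed.
Let cc : is_chart c. Proof. by case: pc. Qed.
Let Kc : rect x0 x1 y0 y1 `<=` cdom c. Proof. by have [[]] := sup. Qed.
Let ab k : a k < b k. Proof. by have [_ /(_ k)/andP[]] := sup. Qed.

(** The ends of a strand are not inside any strand, so the two diagrams agree
there. *)
Lemma strand_end_outside k t : t = a k \/ t = b k ->
  curve D (comp k) t = curve D' (comp k) t.
Proof.
move=> te; have [_ _ _ _ off] := sup; apply: (proj1 (off _ _ _)).
move=> [l [z [lk tz]]].
have tI : a k <= t <= b k by have := ab k; case: te => -> ?; rewrite lexx ltW.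
have uI : a l <= t + z%:~R <= b l by move/andP: tz => [? ?]; rewrite !ltW.
have sp : same_point (comp k) t (comp l) (t + z%:~R) by split=> //; exists z.
have kl := strand_unique pc Kc ab gr rs ends tI uI sp; subst l.
have E : s k t = s k (t + z%:~R).
  have := curve_shift D (comp k) t z; rewrite !(graph_curve rs) // => /esym.
  move=> /(param_inj cc (graph_in_dom Kc gr _ (runs_in_cc (ab k) (rs k) tI))
    (graph_in_dom Kc gr _ (runs_in_cc (ab k) (rs k) uI))) [].
  done.
have := runs_inj (rs k) tI uI E => tE.
by rewrite -tE in tz; case: te tz => ->; rewrite ltxx ?andbF.
Qed.

Lemma graph_strand_inside k t : a k < t < b k ->
  (param c @` orect x0 x1 y0 y1) (curve D (comp k) t).
Proof.
move=> tI; have tI' : a k <= t <= b k by move/andP: tI => [? ?]; rewrite !ltW.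
exists (graph_of (f k) (s k t)); last by rewrite (graph_curve rs).
have sI := runs_in_oo (ab k) (rs k) tI.
split=> //=; have [H _] := gr k; apply: H.
by move/andP: sI => [? ?]; rewrite !ltW.
Qed.

End GraphMoveSetup.

Lemma rect_boundary (R : realType) (x0 x1 y0 y1 : R) p :
  rect x0 x1 y0 y1 p -> ~ orect x0 x1 y0 y1 p ->
  [\/ p.1 = x0, p.1 = x1, p.2 = y0 | p.2 = y1].
Proof.
move=> [/andP[p1 p2] /andP[p3 p4]] no.
have [->|n1] := eqVneq p.1 x0; first by constructor 1.
have [->|n2] := eqVneq p.1 x1; first by constructor 2.
have [->|n3] := eqVneq p.2 y0; first by constructor 3.
have [->|n4] := eqVneq p.2 y1; first by constructor 4.
case: no; split; apply/andP; split; rewrite lt_neqAle.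
- by rewrite eq_sym n1.
- by rewrite n2.
- by rewrite eq_sym n3.
- by rewrite n4.
Qed.

Section GraphMove.
Variables (R : realType) (S : oriented_surface R) (n : nat) (D D' : diagram S n).
Variables (c : chart R S) (m : nat) (comp : 'I_m -> 'I_n) (a b : 'I_m -> R).
Variables (f f' : 'I_m -> R -> R).
Hypothesis mv : graph_move D D' c comp a b f f'.
Hypothesis ends : forall k l, k != l -> f k (-1) != f l (-1) /\ f k 1 != f l 1.
Hypothesis ends' : forall k l, k != l -> f' k (-1) != f' l (-1) /\ f' k 1 != f' l 1.

(** Since the two diagrams agree at the ends of the strands, the strands run in
the same direction on both sides, so that the corners have the same types. *)
Lemma graph_move_setup : exists s s' dir, [/\
  forall k, f k (-1) = f' k (-1) /\ f k 1 = f' k 1,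
  forall above : 'I_m -> 'I_m -> Prop,
    (forall k l, k != l -> above k l \/ above l k) ->
    (forall k l, above k l -> strand_above D comp a b k l) ->
    graph_tangle D c comp a b f (-1) 1 (-1) 1 s dir above,
  forall above : 'I_m -> 'I_m -> Prop,
    (forall k l, k != l -> above k l \/ above l k) ->
    (forall k l, above k l -> strand_above D' comp a b k l) ->
    graph_tangle D' c comp a b f' (-1) 1 (-1) 1 s' dir above,
  agree_off c (rect (-1) 1 (-1) 1) (orect (-1) 1 (-1) 1) D D' &
  agree_off c (rect (-1) 1 (-1) 1) (orect (-1) 1 (-1) 1) D' D].
Proof.
have [sup gm] := mv; have sup' := supported_in_sym sup.
have gr k : graph_in (f k) (-1) 1 (-1) 1 by have [] := gm k.
have gr' k : graph_in (f' k) (-1) 1 (-1) 1 by have [] := gm k.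
have ex k : exists sd, runs c (curve D (comp k)) (a k) (b k) (graph_of (f k)) (-1) 1 sd.1 sd.2.
  by apply: traces_runs; have [] := gm k.
have ex' k : exists sd, runs c (curve D' (comp k)) (a k) (b k) (graph_of (f' k)) (-1) 1 sd.1 sd.2.
  by apply: traces_runs; have [] := gm k.
have [sd rs] := choice ex; have [sd' rs'] := choice ex'.
have [[pc Kc] ab m1 m2 off] := sup.
have ab1 k : a k < b k by case/andP: (ab k).
have [cc _] := pc.
have endE k t : t = a k \/ t = b k ->
    graph_of (f k) ((sd k).1 t) = graph_of (f' k) ((sd' k).1 t).
  move=> te.
  have tI : a k <= t <= b k by have := ab1 k; case: te => -> ?; rewrite lexx ltW.
  have := strand_end_outside sup gr rs ends te.
  rewrite (graph_curve rs) // (graph_curve rs') //.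
  apply: (param_inj cc).
    exact: (graph_in_dom Kc gr _ (runs_in_cc (ab1 k) (rs k) tI)).
  exact: (graph_in_dom Kc gr' _ (runs_in_cc (ab1 k) (rs' k) tI)).
have dirE k : (sd' k).2 = (sd k).2.
  have [E _] := endE k (a k) (or_introl erefl).
  have [_ m0 _] := rs k; have [_ m0' _] := rs' k.
  case: (sd k).2 m0 => -[e0 _ _]; case: (sd' k).2 m0' => -[e0' _ _] //.
    by exfalso; rewrite e0 e0' in E; lra.
  by exfalso; rewrite e0 e0' in E; lra.
exists (fun k => (sd k).1), (fun k => (sd' k).1), (fun k => (sd k).2); split.
- move=> k.
  have [Ea1 Ea2] := endE k (a k) (or_introl erefl).
  have [Eb1 Eb2] := endE k (b k) (or_intror erefl).
  rewrite -Ea1 in Ea2; rewrite -Eb1 in Eb2.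
  by case: (runs_ends (rs k)) Ea2 Eb2 => -[-> ->].
- by move=> above tot ov; split.
- by move=> above tot ov; split=> // k; rewrite -dirE.
- by apply: (supported_agree (@rect_compact _ _ _ _ _) sup); exact: (graph_strand_inside sup gr rs).
- by apply: (supported_agree (@rect_compact _ _ _ _ _) sup'); exact: (graph_strand_inside sup' gr' rs').
Qed.

End GraphMove.

(** * Second Reidemeister move *)

(** A map that is constant on the fibres of [theta] factors through it, the
default [x0] being the value at the types that do not occur. *)
Lemma class_fun (P Th X : Type) (x0 : X) (A : set P) (phi : P -> X) (theta : P -> Th) :
  (forall p p', A p -> A p' -> theta p = theta p' -> phi p = phi p') ->
  exists G, forall p, A p -> phi p = G (theta p).
Proof.
move=> H.
have ex t : exists x, forall p, A p -> theta p = t -> phi p = x.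
  have [[p Ap pt]|n] := pselect (exists2 p, A p & theta p = t).
    by exists (phi p) => p' Ap' p't; apply: H => //; rewrite p't.
  by exists x0 => p Ap pt; case: n; exists p.
by have [G HG] := choice ex; exists G => p Ap; exact: HG.
Qed.

Section CornerTypes.
Variables (m : nat) (dir : 'I_m -> bool).

Lemma corner_type_ex tau bs k l :
  (forall j, j != k -> j != l -> tau j = bs j) ->
  exists so su, tau = corner_type dir bs k l so su.
Proof.
move=> H; pose side_of j := if dir j == tau j then onleft else onright.
exists (side_of k), (side_of l); apply/funext => j; rewrite /corner_type.
have E i : (dir i == isleft (side_of i)) = tau i.
  by rewrite /side_of; case: (dir i); case: (tau i).
by case: eqVneq => [->|jk]; rewrite ?E //; case: eqVneq => [->|jl]; rewrite ?E // H.
Qed.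

Lemma corner_type_inj bs k l so su so' su' : k != l ->
  corner_type dir bs k l so su = corner_type dir bs k l so' su' ->
  so = so' /\ su = su'.
Proof.
move=> kl E; have := congr1 (fun t => t k) E; have := congr1 (fun t => t l) E.
rewrite /corner_type !eqxx eq_sym (negbTE kl).
by case: so {E}; case: so'; case: su; case: su'; case: (dir k); case: (dir l).
Qed.

Variables (X : Type) (T : X -> X -> X -> X).
Hypothesis qT : ternary_quasigroup T.

(** A face determines each of its vertices from the three others. *)
Lemma face_fourth G1 G2 bs k l so0 su0 :
  face dir T G1 bs k l -> face dir T G2 bs k l ->
  (forall so su, (so, su) <> (so0, su0) ->
    G1 (corner_type dir bs k l so su) = G2 (corner_type dir bs k l so su)) ->
  G1 (corner_type dir bs k l so0 su0) = G2 (corner_type dir bs k l so0 su0).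
Proof.
rewrite /face => f1 f2 H; have qf := quasigroup_face qT.
set a1 := G1 (corner_type dir bs k l onright onright) in f1.
set b1 := G1 (corner_type dir bs k l onright onleft) in f1.
set c1 := G1 (corner_type dir bs k l onleft onleft) in f1.
set a2 := G2 (corner_type dir bs k l onright onright) in f2.
set b2 := G2 (corner_type dir bs k l onright onleft) in f2.
set c2 := G2 (corner_type dir bs k l onleft onleft) in f2.
have [u0 u1 u2 u3] := qf a1 b1 c1 a2 b2 c2.
rewrite -f1 -f2 in u0 u1 u2 u3.
by case: so0 su0 H => -[] H; [apply: u3|apply: u0|apply: u2|apply: u1]; rewrite /a1 /b1 /c1; apply: H.
Qed.

Lemma face_solve (G : ('I_m -> bool) -> X) bs k l so0 su0 : k != l ->
  exists z, face dir T (fun tau =>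
    if asbool (tau = corner_type dir bs k l so0 su0) then z else G tau) bs k l.
Proof.
move=> kl; have [q1 q2 q3] := qT.
pose ct := corner_type dir bs k l.
have ne so su z : (so, su) <> (so0, su0) -> (if asbool (ct so su = ct so0 su0) then z else G (ct so su)) = G (ct so su).
  by move=> n; rewrite asboolF // => /(corner_type_inj kl)[E1 E2]; apply: n; rewrite E1 E2.
have eqz so su z : (so, su) = (so0, su0) -> (if asbool (ct so su = ct so0 su0) then z else G (ct so su)) = z.
  by move=> [-> ->]; rewrite asboolT.
rewrite /face -/ct.
case: so0 su0 ne eqz => -[] ne eqz.
- have [z [zE _]] := q3 (G (ct onright onright)) (G (ct onright onleft)) (G (ct onleft onright)).
  by exists z; cbv beta; rewrite (eqz onleft onleft) // !ne.
- exists (T (G (ct onright onright)) (G (ct onright onleft)) (G (ct onleft onleft))).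
  by cbv beta; rewrite (eqz onleft onright) // !ne.
- have [z [zE _]] := q2 (G (ct onright onright)) (G (ct onleft onleft)) (G (ct onleft onright)).
  by exists z; cbv beta; rewrite (eqz onright onleft) // !ne.
- have [z [zE _]] := q1 (G (ct onright onleft)) (G (ct onleft onleft)) (G (ct onleft onright)).
  by exists z; cbv beta; rewrite (eqz onright onright) // !ne.
Qed.

End CornerTypes.

(** Over a set [B] of abscissas on which the order of any two graphs changes in a
convex way, every type occurs in one strip, so that the coloring is a function
of the type. *)
Lemma slab_fun (R : realType) (S : oriented_surface R) (n : nat) (D : diagram S n)
    (c : chart R S) (m : nat) (comp : 'I_m -> 'I_n) (a b : 'I_m -> R)
    (f : 'I_m -> R -> R) (x0 x1 y0 y1 : R) (s : 'I_m -> R -> R) (dir : 'I_m -> bool)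
    (above : 'I_m -> 'I_m -> Prop) (X : Type) (phi : S -> X) (B : set R) :
  graph_tangle D c comp a b f x0 x1 y0 y1 s dir above ->
  locally_constant_off D phi -> y0 < y1 ->
  (forall i j x y z, i != j -> B x -> B y -> x0 <= x -> y <= x1 -> x <= z <= y ->
    f i x < f j x -> f i y < f j y -> f i z < f j z) ->
  exists G, forall p, rect x0 x1 y0 y1 p -> ~ universe D (param c p) -> B p.1 ->
    phi (param c p) = G (above_type f p).
Proof.
move=> gt lc y01 conv.
pose A p := [/\ rect x0 x1 y0 y1 p, ~ universe D (param c p) & B p.1].
have [p p' [Kp nU Bp] [Kp' nU' Bp'] tE|G GE] := @class_fun _ _ _ (phi (param c 0)) A (phi \o param c) (above_type f).
  apply: (class_constant gt lc y01 (tau := above_type f p')) => //.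
  move=> i j x ti tj fp fp' xI.
  have ij : i != j by apply: contraTneq ti => ->.
  have [[/andP[? ?] _] [/andP[? ?] _]] := (Kp, Kp').
  case/orP: xI => xI.
    by apply: (conv i j p.1 p'.1).
  by apply: (conv i j p'.1 p.1).
by exists G => p Kp nU Bp; exact: GE.
Qed.

Section ReidemeisterTwo.
Variables (R : realType) (S : oriented_surface R) (n : nat) (D : diagram S n).
Variables (c : chart R S) (comp : 'I_2 -> 'I_n) (a b : 'I_2 -> R).
Variables (f : 'I_2 -> R -> R) (s : 'I_2 -> R -> R) (dir : 'I_2 -> bool).
Variables (X : Type) (T : X -> X -> X -> X).
Variables (i0 i1 h0 h1 : 'I_2).
Hypothesis i01 : i0 != i1.
Hypothesis h01 : h0 != h1.
Let above (k l : 'I_2) := k = h0 /\ l = h1.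
Let K : set (plane R) := rect (-1) 1 (-1) 1.
Hypothesis gt : graph_tangle D c comp a b f (-1) 1 (-1) 1 s dir above.
Hypothesis qT : ternary_quasigroup T.

Let ord2P (k l : 'I_2) : k != l -> forall j, j = k \/ j = l.
Proof. by case: k => -[|[|//]] ?; case: l => -[|[|//]] ?; rewrite // => _ [[|[|//]] ?]; [left|right|right|left]; apply: val_inj. Qed.

Let corner2 bs tau : exists so su, tau = corner_type dir bs h0 h1 so su.
Proof.
by apply: corner_type_ex => j j0 j1; case: (ord2P h01 j) => E; rewrite E eqxx in j0 j1.
Qed.

Let corner2_bs bs bs' so su : corner_type dir bs h0 h1 so su = corner_type dir bs' h0 h1 so su.
Proof.
by apply/funext => j; rewrite /corner_type; case: (ord2P h01 j) => ->; rewrite eqxx // eqxx; case: ifP.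
Qed.

Let faces2 G bs : face dir T G bs h0 h1 -> faces dir above T G.
Proof.
move=> fG k l bs' _ [-> ->]; move: fG.
by rewrite /face !(corner2_bs bs' bs).
Qed.

Lemma faces2_unique (i j : 'I_2) G1 G2 : i != j ->
  faces dir above T G1 -> faces dir above T G2 ->
  (forall tau, ~~ (tau j && ~~ tau i) -> G1 tau = G2 tau) ->
  forall tau, G1 tau = G2 tau.
Proof.
move=> ij f1 f2 H tau; have [mt|/H //] := boolP (tau j && ~~ tau i).
have [so [su E]] := corner2 tau tau; rewrite E.
apply: (face_fourth qT); [exact: f1|exact: f2|].
move=> so' su' ne; apply: H; apply/negP => mt'; apply: ne.
have [|-> ->//] := @corner_type_inj _ dir tau h0 h1 so' su' so su h01.
rewrite -E; move: mt mt' => /andP[t1 /negbTE t0] /andP[t1' /negbTE t0'].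
by apply/funext => r; case: (ord2P ij r) => ->; rewrite ?t0 ?t1 ?t0' ?t1'.
Qed.

Let two_model : (forall phi, point_coloring T D phi ->
    exists2 G, faces dir above T G & forall p, K p -> ~ universe D (param c p) ->
      phi (param c p) = G (above_type f p)) ->
  local_model T c K (faces dir above T) D (above_type f).
Proof.
move=> ext; split=> //; first exact: (graph_type_near gt).
exact: (faces_crossing_rule gt).
Qed.

Let y01 : (-1 : R) < 1. Proof. lra. Qed.

(** The type of the bigon, above the upper strand and below the lower one, does
not occur here; its color is chosen so that the rule holds. *)
Lemma parallel_model : (forall x, -1 <= x <= 1 -> f i0 x < f i1 x) ->
  local_model T c K (faces dir above T) D (above_type f).
Proof.
move=> par; apply: two_model => phi [lc rule].
have [G0 G0E] : exists G, forall p, K p -> ~ universe D (param c p) -> True ->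
    phi (param c p) = G (above_type f p).
  apply: (slab_fun gt lc y01 (B := fun=> True)) => i j x y z ij _ _ xl yl /andP[xz zy] fx fy.
  have par' u : -1 <= u -> u <= 1 -> f i0 u < f i1 u by move=> ? ?; apply: par; apply/andP.
  have px := par' x xl (le_trans (le_trans xz zy) yl).
  have pz := par' z (le_trans xl xz) (le_trans zy yl).
  have [iE|iE] := ord2P i01 i; have [jE|jE] := ord2P i01 j; subst i j => //.
  - by rewrite eqxx in ij.
  - by have := lt_trans fx px; rewrite ltxx.
  - by rewrite eqxx in ij.
have [so [su E]] := corner2 (fun=> false) (fun j => j == i1).
have [z fz] := face_solve dir qT G0 (fun=> false) so su h01.
rewrite -E in fz.
exists (fun tau => if asbool (tau = (fun j => j == i1)) then z else G0 tau).
  exact: faces2 fz.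
move=> p Kp nU; rewrite asboolF; first exact: G0E.
move=> tE; have [p1 _] := Kp.
have := congr1 (fun t => t i0) tE; have := congr1 (fun t => t i1) tE.
rewrite /above_type eqxx (negbTE i01) => t1 /negbT; rewrite -leNgt => t0.
by have := par _ p1; lra.
Qed.

(** The points above [i0] and below [i1] form two strips, one at each end of the
bigon. Both crossings impose the same equation with the same three other
colors, so the strips have the same color. *)
Lemma crossed_model p q : -1 < p -> p < q -> q < 1 ->
  f i0 p = f i1 p -> f i0 q = f i1 q ->
  (forall x, -1 <= x < p -> f i0 x < f i1 x) ->
  (forall x, p < x < q -> f i1 x < f i0 x) ->
  (forall x, q < x <= 1 -> f i0 x < f i1 x) ->
  local_model T c K (faces dir above T) D (above_type f).
Proof.
move=> p1 pq q1 Ep Eq lt1 lt2 lt3; apply: two_model => phi pcol; have [lc rule] := pcol.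
have pI : -1 <= p <= 1 by apply/andP; split; lra.
have qI : -1 <= q <= 1 by apply/andP; split; lra.
have left_ x : -1 <= x -> x < q -> f i0 x < f i1 x -> x < p.
  move=> x1 xq fx; rewrite ltNge; apply/negP; rewrite le_eqVlt => /orP[/eqP pE|px].
    by rewrite -pE Ep ltxx in fx.
  by have := lt2 x; rewrite px xq => /(_ isT) gx; have := lt_trans fx gx; rewrite ltxx.
have right_ x : x <= 1 -> p < x -> f i0 x < f i1 x -> q < x.
  move=> x1 px fx; rewrite ltNge; apply/negP; rewrite le_eqVlt => /orP[/eqP xE|xq].
    by rewrite xE Eq ltxx in fx.
  by have := lt2 x; rewrite px xq => /(_ isT) gx; have := lt_trans fx gx; rewrite ltxx.
have mid_ x : -1 <= x <= 1 -> f i1 x < f i0 x -> p < x < q.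
  move=> /andP[x1 x2] fx; apply/andP; split; rewrite ltNge; apply/negP; rewrite le_eqVlt => /orP[/eqP xE|xp].
  - by rewrite xE Ep ltxx in fx.
  - by have := lt1 x; rewrite x1 xp => /(_ isT) gx; have := lt_trans fx gx; rewrite ltxx.
  - by rewrite -xE Eq ltxx in fx.
  - by have := lt3 x; rewrite x2 xp => /(_ isT) gx; have := lt_trans fx gx; rewrite ltxx.
(* GA and GB color the types on the left of q and on the right of p; at this
   stage they may differ on the type of the two strips *)
have [GA GAE] : exists G, forall r, K r -> ~ universe D (param c r) -> r.1 < q ->
    phi (param c r) = G (above_type f r).
  apply: (slab_fun gt lc y01 (B := fun x => x < q)) => i j x y z ij xq yq xl yl /andP[xz zy] fx fy.
  have [iE|iE] := ord2P i01 i; have [jE|jE] := ord2P i01 j; subst i j; try by rewrite eqxx in ij.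
  - have yp := left_ y (le_trans xl (le_trans xz zy)) yq fy.
    by apply: lt1; rewrite (le_trans xl xz) (le_lt_trans zy yp).
  - have /andP[px _] : p < x < q by apply: mid_ => //; rewrite xl (le_trans xz) // (le_trans zy).
    by apply: lt2; rewrite (lt_le_trans px xz) (le_lt_trans zy yq).
have [GB GBE] : exists G, forall r, K r -> ~ universe D (param c r) -> p < r.1 ->
    phi (param c r) = G (above_type f r).
  apply: (slab_fun gt lc y01 (B := fun x => p < x)) => i j x y z ij xq yq xl yl /andP[xz zy] fx fy.
  have [iE|iE] := ord2P i01 i; have [jE|jE] := ord2P i01 j; subst i j; try by rewrite eqxx in ij.
  - have yp := right_ x (le_trans (le_trans xz zy) yl) xq fx.
    by apply: lt3; rewrite (lt_le_trans yp xz) (le_trans zy yl).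
  - have /andP[_ px] : p < y < q by apply: mid_ => //; rewrite yl (le_trans xl) // (le_trans xz).
    by apply: lt2; rewrite (lt_le_trans xq xz) (le_lt_trans zy px).
have anti (k l : 'I_2) : above k l -> above l k -> False.
  by move=> [-> ->] [E _]; move: h01; rewrite E eqxx.
have eqf x : f i0 x = f i1 x -> f h0 x = f h1 x.
  by have [->|->] := ord2P i01 h0; have [->|->] := ord2P i01 h1.
have fA : faces dir above T GA.
  apply: faces2; apply: (point_coloring_face gt anti pcol (conj erefl erefl) pI (eqf _ Ep)).
  have : \forall r \near (p, f h0 p), r.1 < q by apply: (@near_fst _ (p, f h0 p) [set u | u < q]); exact: lt_nbhsl.
  by apply: filterS => r rq Kr nU; exact: GAE.
have fB : faces dir above T GB.
  apply: faces2; apply: (point_coloring_face gt anti pcol (conj erefl erefl) qI (eqf _ Eq)).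
  have : \forall r \near (q, f h0 q), p < r.1 by apply: (@near_fst _ (q, f h0 q) [set u | p < u]); exact: lt_nbhsr.
  by apply: filterS => r rq Kr nU; exact: GBE.
(* the three other types occur over the middle of the bigon *)
pose x := (p + q) / 2.
have xI : -1 <= x <= 1 by rewrite /x; apply/andP; split; lra.
have xp : p < x by rewrite /x; lra.
have xq : x < q by rewrite /x; lra.
have AB tau : ~~ (tau i0 && ~~ tau i1) -> GA tau = GB tau.
  move=> nt; have [y [Kxy nU tE]] : exists y, has_type D c f (-1) 1 (-1) 1 tau (x, y).
    apply: (fiber_ex gt) => // i j ti tj.
    have [iE|iE] := ord2P i01 i; have [jE|jE] := ord2P i01 j; subst i j.
    - by rewrite ti in tj.
    - by rewrite ti tj in nt.
    - by apply: lt2; rewrite xp xq.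
    - by rewrite ti in tj.
  by rewrite -tE -GAE // -GBE.
have i10 : i1 != i0 by rewrite eq_sym.
have ABall := faces2_unique i10 fA fB AB.
exists GA => // r Kr nU; have [rq|qr] := ltrP r.1 q; first exact: GAE.
by rewrite ABall; apply: GBE => //; exact: lt_le_trans qr.
Qed.

End ReidemeisterTwo.

(** The uniqueness hypothesis need only be checked on one side, because the
boundary types of both sides agree. *)
Lemma local_move_card (R : realType) (S : oriented_surface R) (n : nat)
    (X : Type) (T : X -> X -> X -> X) (c : chart R S) (K Ko : set (plane R))
    (Theta : Type) (rules : (Theta -> X) -> Prop) (D D' : diagram S n)
    (theta theta' : plane R -> Theta) :
  is_chart c -> K `<=` cdom c -> compact K -> open Ko -> Ko `<=` K ->
  local_model T c K rules D theta -> local_model T c K rules D' theta' ->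
  agree_off c K Ko D D' -> agree_off c K Ko D' D ->
  (forall p, K p -> ~ Ko p -> theta p = theta' p) ->
  (exists2 p, K p /\ ~ Ko p & ~ universe D (param c p)) ->
  (forall G1 G2, rules G1 -> rules G2 ->
    (forall p, K p -> ~ Ko p -> ~ universe D (param c p) ->
      G1 (theta p) = G2 (theta p)) -> forall a, G1 a = G2 a) ->
  (colorings D T #= colorings D' T)%card.
Proof.
move=> cc Kc Kcpt oKo KoK lm lm' ag ag' bd [p0 [Kp0 nKo0] nU0] inj.
have notKo p : K p -> ~ Ko p -> ~ (param c @` Ko) (param c p).
  move=> Kp nKo [q Kq /(param_inj cc (Kc _ (KoK _ Kq)) (Kc _ Kp)) E].
  by apply: nKo; rewrite -E.
have UU' p : K p -> ~ Ko p -> universe D' (param c p) -> universe D (param c p).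
  by move=> Kp nKo; apply: (proj1 ag'); exact: notKo.
have U'U p : K p -> ~ Ko p -> universe D (param c p) -> universe D' (param c p).
  by move=> Kp nKo; apply: (proj1 ag); exact: notKo.
rewrite card_eq_le; apply/andP; split.
  apply: (local_move_le cc Kc Kcpt oKo KoK lm lm' ag ag') => //.
    by move=> p Kp nKo _; exact: bd.
  by exists p0.
apply: (local_move_le cc Kc Kcpt oKo KoK lm' lm ag' ag) => //.
- by move=> p Kp nKo _; rewrite bd.
- by exists p0 => // /(UU' _ Kp0 nKo0).
- move=> G1 G2 r1 r2 H; apply: inj => // p Kp nKo nU.
  by rewrite bd //; apply: H => // /(UU' _ Kp nKo).
Qed.

Lemma boundary_type (R : realType) m (f f' : 'I_m -> R -> R) (x0 x1 y0 y1 : R) p :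
  (forall k, graph_in (f k) x0 x1 y0 y1) -> (forall k, graph_in (f' k) x0 x1 y0 y1) ->
  (forall k, f k x0 = f' k x0 /\ f k x1 = f' k x1) ->
  rect x0 x1 y0 y1 p -> ~ orect x0 x1 y0 y1 p -> above_type f p = above_type f' p.
Proof.
move=> gr gr' fE Kp /(rect_boundary Kp); have [p1 p2] := Kp => bd.
apply/funext => k; rewrite /above_type.
have [/(_ _ p1)/andP[a1 a2] _] := gr k; have [/(_ _ p1)/andP[b1 b2] _] := gr' k.
have [e0 e1] := fE k.
case: bd => E; rewrite E.
- by rewrite e0.
- by rewrite e1.
- by rewrite !ltNge !ltW.
- by rewrite a2 b2.
Qed.

Lemma corner_off (R : realType) (S : oriented_surface R) (n : nat) (D : diagram S n)
    (c : chart R S) (m : nat) (comp : 'I_m -> 'I_n) (a b : 'I_m -> R)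
    (f : 'I_m -> R -> R) (x0 x1 y0 y1 : R) (s : 'I_m -> R -> R) (dir : 'I_m -> bool)
    (above : 'I_m -> 'I_m -> Prop) :
  graph_tangle D c comp a b f x0 x1 y0 y1 s dir above -> x0 < x1 -> y0 < y1 ->
  exists2 p, rect x0 x1 y0 y1 p /\ ~ orect x0 x1 y0 y1 p & ~ universe D (param c p).
Proof.
move=> gt x01 y01; have Kp : rect x0 x1 y0 y1 (x0, y0) by split; rewrite /= lexx ltW.
exists (x0, y0); first by split=> // -[]; rewrite /= ltxx.
move=> /(graph_universe (gt_chart gt) (gt_dom gt) (gt_ab gt) (gt_meets gt) (gt_graph gt) (gt_runs gt) Kp) [k /= E].
have [+ _] := gt_graph gt k; move=> /(_ x0); rewrite lexx ltW // => /(_ isT).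
by rewrite E ltxx.
Qed.

Section MoveTwo.
Variables (R : realType) (S : oriented_surface R) (n : nat) (D D' : diagram S n).
Variables (X : Type) (T : X -> X -> X -> X).
Hypothesis kT : ktq T.

(** Before the move the strands do not cross, so either of them may be called the
over strand there. *)
Lemma R2_colorings : R2_move D D' -> (colorings D T #= colorings D' T)%card.
Proof.
move=> [c [comp [a [b [f [f' [p [q [mv par [p1 pq q1] [Ep Eq l1 l2 l3] sa]]]]]]]]].
have [qT _ _] := kT.
pose i0 : 'I_2 := inord 0; pose i1 : 'I_2 := inord 1.
have i01 : i0 != i1 by rewrite -val_eqE /= !inordK.
have ordP (j : 'I_2) : j = i0 \/ j = i1.
  by case: j => -[|[|//]] ?; [left|right]; apply: val_inj; rewrite /= inordK.
have neqP (P : 'I_2 -> 'I_2 -> Prop) : P i0 i1 -> P i1 i0 -> forall k l, k != l -> P k l.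
  move=> P01 P10 k l; case: (ordP k) => ->; case: (ordP l) => -> //; by rewrite eqxx.
have ends k l : k != l -> f k (-1) != f l (-1) /\ f k 1 != f l 1.
  move: k l; apply: neqP.
    by split; rewrite lt_eqF // par //; apply/andP; split; lra.
  by split; rewrite gt_eqF // par //; apply/andP; split; lra.
have ends' k l : k != l -> f' k (-1) != f' l (-1) /\ f' k 1 != f' l 1.
  move: k l; apply: neqP.
    by split; rewrite lt_eqF //; [apply: l1|apply: l3]; apply/andP; split; lra.
  by split; rewrite gt_eqF //; [apply: l1|apply: l3]; apply/andP; split; lra.
have [s [s' [dir [fE gtD gtD' ag ag']]]] := graph_move_setup mv ends ends'.
have [h0 [h1 [h01 sa' hP]]] : exists h0 h1 : 'I_2, [/\ h0 != h1, strand_above D' comp a b h0 h1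
    & forall P : 'I_2 -> 'I_2 -> Prop, P h0 h1 -> P h1 h0 -> P i0 i1].
  by case: sa => sa; [exists i0, i1|exists i1, i0; split=> //; rewrite eq_sym].
pose above (k l : 'I_2) := k = h0 /\ l = h1.
have tot k l : k != l -> above k l \/ above l k.
  move: k l; apply: neqP.
    by apply: (hP (fun k l => above k l \/ above l k)); [left|right].
  by apply: (hP (fun k l => above l k \/ above k l)); [right|left].
have ov' k l : above k l -> strand_above D' comp a b k l by move=> [-> ->].
have [[[pc Kc] ab m1 m2 off] gm] := mv.
have gr k : graph_in (f k) (-1) 1 (-1) 1 by have [] := gm k.
have gr' k : graph_in (f' k) (-1) 1 (-1) 1 by have [] := gm k.
have lt11 : (-1 : R) < 1 by lra.
(* vacuous, as the graphs are disjoint *)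
have ov k l : above k l -> strand_above D comp a b k l.
  move=> [-> ->] t u tI uI E; exfalso.
  have [sd rs] : exists sd, forall k, runs c (curve D (comp k)) (a k) (b k) (graph_of (f k)) (-1) 1 (sd k).1 (sd k).2.
    have ex j : exists sd, runs c (curve D (comp j)) (a j) (b j) (graph_of (f j)) (-1) 1 sd.1 sd.2.
      by apply: traces_runs; have [] := gm j.
    by have [sd H] := choice ex; exists sd.
  have ab1 j : a j < b j by case/andP: (ab j).
  have sI := runs_in_cc (ab1 h0) (rs h0) tI; have uI' := runs_in_cc (ab1 h1) (rs h1) uI.
  have [cc _] := pc.
  move: E; rewrite (graph_curve rs) // (graph_curve rs) //.
  move=> /(param_inj cc (graph_in_dom Kc gr _ sI) (graph_in_dom Kc gr _ uI')) [E1 E2].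
  rewrite -E1 in E2.
  have : f i0 ((sd h0).1 t) = f i1 ((sd h0).1 t).
    by apply: (hP (fun k l => f k ((sd h0).1 t) = f l ((sd h0).1 t))).
  by apply/eqP; rewrite lt_eqF // par.
have gt := gtD above tot ov; have gt' := gtD' above tot ov'.
have [cc _] := pc.
apply: (@local_move_card _ _ _ _ T c _ _ _ (faces dir above T) D D' (above_type f) (above_type f') cc Kc
  (@rect_compact _ _ _ _ _) (@orect_open _ _ _ _ _) (@orect_sub _ _ _ _ _)) => //.
- exact: (parallel_model i01 h01 gt qT).
- exact: (crossed_model i01 h01 gt' qT p1 pq q1).
- by move=> r; exact: boundary_type.
- exact: (corner_off gt).
- move=> G1 G2 r1 r2 H; apply: (faces2_unique h01 qT i01 r1 r2) => tau nm.
  have [y [Kxy nU tE]] : exists y, has_type D c f (-1) 1 (-1) 1 tau (-1, y).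
    apply: (fiber_ex gt) => //; first by apply/andP; split; lra.
    move=> i j ti tj; have [iE|iE] := ordP i; have [jE|jE] := ordP j; rewrite iE jE in ti tj *.
    - by rewrite ti in tj.
    - by apply: par; apply/andP; split; lra.
    - by rewrite ti tj in nm.
    - by rewrite ti in tj.
  rewrite -tE; apply: H => // -[]; by rewrite /= ltxx.
Qed.

End MoveTwo.

(** * Third Reidemeister move *)

Section ReidemeisterThree.
Variables (R : realType) (S : oriented_surface R) (n : nat) (D : diagram S n).
Variables (c : chart R S) (comp : 'I_3 -> 'I_n) (a b : 'I_3 -> R).
Variables (f : 'I_3 -> R -> R) (s : 'I_3 -> R -> R) (dir : 'I_3 -> bool).
Variables (X : Type) (T : X -> X -> X -> X).
Variables (above : 'I_3 -> 'I_3 -> Prop) (st sm sb : 'I_3).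
Let K : set (plane R) := rect (-1) 1 (-1) 1.
Hypothesis tm : st != sm.
Hypothesis tb : st != sb.
Hypothesis mb : sm != sb.
Hypothesis ord3 : forall j, [\/ j = st, j = sm | j = sb].
Hypothesis aboveP : forall k l, above k l <->
  [\/ k = st /\ l = sm, k = st /\ l = sb | k = sm /\ l = sb].
Hypothesis kT : ktq T.

Let qT : ternary_quasigroup T. Proof. by case: kT. Qed.

(** The type of the points that are on prescribed sides (true for left) of the
top, the middle and the bottom strand. *)
Definition vec3 (x y z : bool) : 'I_3 -> bool := fun j =>
  if j == st then dir st == x else if j == sm then dir sm == y else dir sb == z.

Let eqK (u v : bool) : (u == (u == v)) = v. Proof. by case: u; case: v. Qed.

Let vec3E (tau : 'I_3 -> bool) x y z : tau st = (dir st == x) ->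
  tau sm = (dir sm == y) -> tau sb = (dir sb == z) -> tau = vec3 x y z.
Proof.
move=> ex ey ez; apply/funext => j; rewrite /vec3.
case: (ord3 j) => ->; rewrite ?eqxx //.
  by rewrite eq_sym (negbTE tm).
by rewrite !(eq_sym sb) (negbTE tb) (negbTE mb).
Qed.

Let vec3_st x y z : vec3 x y z st = (dir st == x). Proof. by rewrite /vec3 eqxx. Qed.
Let vec3_sm x y z : vec3 x y z sm = (dir sm == y).
Proof. by rewrite /vec3 eq_sym (negbTE tm) eqxx. Qed.
Let vec3_sb x y z : vec3 x y z sb = (dir sb == z).
Proof. by rewrite /vec3 !(eq_sym sb) (negbTE tb) (negbTE mb). Qed.

Let vec3_id tau : tau = vec3 (dir st == tau st) (dir sm == tau sm) (dir sb == tau sb).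
Proof. by apply: vec3E; rewrite eqK. Qed.

Let ct_tm bs so su : corner_type dir bs st sm so su =
  vec3 (isleft so) (isleft su) (dir sb == bs sb).
Proof.
apply: vec3E; rewrite /corner_type ?eqxx //; first by rewrite eq_sym (negbTE tm).
by rewrite !(eq_sym sb) (negbTE tb) (negbTE mb) eqK.
Qed.

Let ct_tb bs so su : corner_type dir bs st sb so su =
  vec3 (isleft so) (dir sm == bs sm) (isleft su).
Proof.
apply: vec3E; rewrite /corner_type ?eqxx //; last by rewrite eq_sym (negbTE tb).
by rewrite eq_sym (negbTE tm) (negbTE mb) eqK.
Qed.

Let ct_mb bs so su : corner_type dir bs sm sb so su =
  vec3 (dir st == bs st) (isleft so) (isleft su).
Proof.
apply: vec3E; rewrite /corner_type ?eqxx //; last by rewrite eq_sym (negbTE mb).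
by rewrite (negbTE tm) (negbTE tb) eqK.
Qed.

Let cube_of (G : ('I_3 -> bool) -> X) x y z := G (vec3 x y z).

Let face_tm G bs : face dir T G bs st sm <-> top_middle T (cube_of G) (dir sb == bs sb).
Proof. by rewrite /face !ct_tm. Qed.
Let face_tb G bs : face dir T G bs st sb <-> top_bottom T (cube_of G) (dir sm == bs sm).
Proof. by rewrite /face !ct_tb. Qed.
Let face_mb G bs : face dir T G bs sm sb <-> middle_bottom T (cube_of G) (dir st == bs st).
Proof. by rewrite /face !ct_mb. Qed.

(** Only the color of the type opposite to [w] has to be changed; no region has
that type when the strands bound a triangle of type [w]. *)
Lemma faces_complete G (w : 'I_3 -> bool) :
  face dir T G w st sm -> face dir T G w st sb -> face dir T G w sm sb ->
  exists2 G', faces dir above T G' &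
    forall tau, tau <> (fun j => ~~ w j) -> G' tau = G tau.
Proof.
move=> /face_tm ftm /face_tb ftb /face_mb fmb.
have [F' [Ftm Ftb Fmb FE]] := cube_complete kT ftm ftb fmb.
pose G' (tau : 'I_3 -> bool) := F' (dir st == tau st) (dir sm == tau sm) (dir sb == tau sb).
have G'E : cube_of G' = F'.
  by apply/funext => x; apply/funext => y; apply/funext => z; rewrite /cube_of /G' vec3_st vec3_sm vec3_sb !eqK.
exists G'.
  move=> k l bs kl /aboveP[] [-> ->]; [apply/face_tm|apply/face_tb|apply/face_mb]; by rewrite G'E.
move=> tau ne; rewrite /G' FE; first by rewrite /cube_of -vec3_id.
move=> [e1 e2 e3]; apply: ne; apply/funext => j.
have eqN (u v v' : bool) : (u == v) = ~~ (u == v') -> v = ~~ v' by case: u; case: v; case: v'.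
by case: (ord3 j) => ->; apply: eqN; [exact: e1|exact: e2|exact: e3].
Qed.

Lemma faces3_unique (w : 'I_3 -> bool) G1 G2 : faces dir above T G1 -> faces dir above T G2 ->
  (forall tau, tau <> w -> tau <> (fun j => ~~ w j) -> G1 tau = G2 tau) ->
  forall tau, G1 tau = G2 tau.
Proof.
move=> f1 f2 H tau.
have st_sm : above st sm by apply/aboveP; constructor 1.
have [so [su E]] : exists so su, tau = corner_type dir tau st sm so su by exact: corner_type_ex.
have key : (tau = w \/ tau = (fun j => ~~ w j)) -> G1 tau = G2 tau.
  move=> tw; rewrite E; apply: (face_fourth qT); [exact: f1|exact: f2|].
  move=> so' su' ne; set tau' := corner_type _ _ _ _ _ _.
  have bE : tau' sb = tau sb.
    by rewrite /tau' /corner_type !(eq_sym sb) (negbTE tb) (negbTE mb).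
  have nE : tau' <> tau.
    move=> E'; apply: ne; have [|-> ->//] := @corner_type_inj _ dir tau st sm so' su' so su tm.
    by rewrite -E.
  have bneg (P Q : 'I_3 -> bool) : P sb = Q sb -> P = (fun j => ~~ Q j) -> False.
    by move=> + PE; rewrite PE; case: (Q sb).
  apply: H => E'; case: tw => tE.
  - by apply: nE; rewrite tE.
  - by apply: (bneg tau w _ tE); rewrite -bE E'.
  - by apply: (bneg tau' w _ E'); rewrite bE tE.
  - by apply: nE; rewrite tE.
have [tw|tw] := pselect (tau = w); first by apply: key; left.
have [tw'|tw'] := pselect (tau = (fun j => ~~ w j)); first by apply: key; right.
exact: H.
Qed.

Hypothesis gt : graph_tangle D c comp a b f (-1) 1 (-1) 1 s dir above.

(** The three crossings bound a triangle, of type [w]: the third strand is on the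
side [w] of the crossing of the two others. They give the three faces at [w].
*)
Lemma triangle_model (w : 'I_3 -> bool) :
  (forall i j x y z, i != j -> -1 <= x -> y <= 1 -> x <= z <= y ->
    f i x < f j x -> f i y < f j y -> f i z < f j z) ->
  (forall k l, k != l -> exists x, [/\ -1 <= x <= 1, f k x = f l x &
     forall h, h != k -> h != l -> (f h x < f k x) = w h]) ->
  (forall p, K p -> (forall k, f k p.1 <> p.2) ->
     above_type f p <> (fun j => ~~ w j)) ->
  local_model T c K (faces dir above T) D (above_type f).
Proof.
move=> conv cross unre; split; first exact: (graph_type_near gt); last exact: (faces_crossing_rule gt).
move=> phi pcol; have [lc _] := pcol.
have [G0 G0E] : exists G, forall p, K p -> ~ universe D (param c p) -> True ->
    phi (param c p) = G (above_type f p).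
  apply: (slab_fun gt lc _ (B := fun=> True)); first by lra.
  by move=> i j x y z ij _ _; exact: conv.
have anti k l : above k l -> above l k -> False.
  move=> /aboveP[] [-> ->] /aboveP[] [] /eqP; by rewrite ?(eq_sym sm st) ?(eq_sym sb) ?(negbTE tm) ?(negbTE tb) ?(negbTE mb) // => _ /eqP; rewrite ?(negbTE tm) ?(negbTE tb) ?(negbTE mb) ?(eq_sym sm st) ?(negbTE tm).
have fw k l : k != l -> above k l -> face dir T G0 w k l.
  move=> kl akl; have [x [xI E wE]] := cross _ _ kl.
  have H : face dir T G0 (above_type f (x, f k x)) k l.
    apply: (point_coloring_face gt anti pcol akl xI E).
    by near=> q => Kq nU; exact: G0E.
  have ctE so su : corner_type dir (above_type f (x, f k x)) k l so su = corner_type dir w k l so su.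
    apply/funext => j; rewrite /corner_type; case: eqVneq => // jk; case: eqVneq => // jl.
    exact: wE.
  by move: H; rewrite /face !ctE.
have [||| G fG GE] := @faces_complete G0 w.
- by apply: fw => //; apply/aboveP; constructor 1.
- by apply: fw => //; apply/aboveP; constructor 2.
- by apply: fw => //; apply/aboveP; constructor 3.
exists G => // p Kp nU; rewrite GE; first exact: G0E.
apply: unre => // k E; apply: nU.
by apply/(graph_universe (gt_chart gt) (gt_dom gt) (gt_ab gt) (gt_meets gt) (gt_graph gt) (gt_runs gt) Kp); exists k.
Unshelve. all: by end_near.
Qed.

End ReidemeisterThree.

Section MoveThree.
Variables (R : realType).

Lemma cross_conv (f g : R -> R) p : cross_at f g p ->
  (forall x y z, -1 <= x -> y <= 1 -> x <= z <= y -> f x < g x -> f y < g y -> f z < g z) /\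
  (forall x y z, -1 <= x -> y <= 1 -> x <= z <= y -> g x < f x -> g y < f y -> g z < f z).
Proof.
move=> [/andP[p1 p2] E lt gt_]; split=> x y z x1 y1 /andP[xz zy] fx fy.
  apply: lt; rewrite (le_trans x1 xz) /= ltNge; apply/negP => pz.
  have := le_trans pz zy; rewrite le_eqVlt => /orP[/eqP pE|py].
    by rewrite -pE E ltxx in fy.
  by have := gt_ y; rewrite py y1 => /(_ isT) gy; have := lt_trans fy gy; rewrite ltxx.
apply: gt_; rewrite (le_trans zy y1) andbT ltNge; apply/negP => zp.
have := le_trans xz zp; rewrite le_eqVlt => /orP[/eqP pE|py].
  by rewrite pE E ltxx in fx.
by have := lt x; rewrite py x1 => /(_ isT) gx; have := lt_trans fx gx; rewrite ltxx.
Qed.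

Lemma cross_lt (f g : R -> R) p x : cross_at f g p -> -1 <= x <= 1 ->
  (f x < g x -> x < p) /\ (g x < f x -> p < x).
Proof.
move=> [/andP[p1 p2] E lt gt_] /andP[x1 x2]; split=> fx; rewrite ltNge; apply/negP;
  rewrite le_eqVlt => /orP[/eqP xE|h].
- by rewrite -xE E ltxx in fx.
- by have := gt_ x; rewrite h x2 => /(_ isT) gx; have := lt_trans fx gx; rewrite ltxx.
- by rewrite xE E ltxx in fx.
- by have := lt x; rewrite h x1 => /(_ isT) gx; have := lt_trans fx gx; rewrite ltxx.
Qed.

Lemma order3 (height : 'I_3 -> nat) : injective height ->
  exists t m b : 'I_3, [/\ [/\ t != m, t != b & m != b],
    forall j, [\/ j = t, j = m | j = b] &
    forall k l, (height l < height k)%N <->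
      [\/ k = t /\ l = m, k = t /\ l = b | k = m /\ l = b]].
Proof.
move=> hi.
have key (t m b : 'I_3) : (height m < height t)%N -> (height b < height m)%N ->
    (forall j, [\/ j = t, j = m | j = b]) ->
  exists t m b : 'I_3, [/\ [/\ t != m, t != b & m != b],
    forall j, [\/ j = t, j = m | j = b] &
    forall k l, (height l < height k)%N <->
      [\/ k = t /\ l = m, k = t /\ l = b | k = m /\ l = b]].
  move=> mt bm ord.
  have bt := ltn_trans bm mt.
  have neq (i j : 'I_3) : (height i < height j)%N -> j != i.
    by apply: contraTneq => ->; rewrite ltnn.
  exists t, m, b; split=> //; first by split; exact: neq.
  move=> k l; split; last by case=> -[-> ->].
  case: (ord k) => ->; case: (ord l) => ->; rewrite ?ltnn // => h.
  - by constructor 1.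
  - by constructor 2.
  - by have := ltn_trans h mt; rewrite ltnn.
  - by constructor 3.
  - by have := ltn_trans h bt; rewrite ltnn.
  - by have := ltn_trans h bm; rewrite ltnn.
pose i0 : 'I_3 := inord 0; pose i1 : 'I_3 := inord 1; pose i2 : 'I_3 := inord 2.
have ord (j : 'I_3) : [\/ j = i0, j = i1 | j = i2].
  by case: j => -[|[|[|//]]] ?; [constructor 1|constructor 2|constructor 3]; apply: val_inj; rewrite /= inordK.
have n01 : i0 <> i1 by move/(congr1 val); rewrite /= !inordK.
have n02 : i0 <> i2 by move/(congr1 val); rewrite /= !inordK.
have n12 : i1 <> i2 by move/(congr1 val); rewrite /= !inordK.
case: (ltngtP (height i0) (height i1)) => [h01|h01|/hi//];
case: (ltngtP (height i0) (height i2)) => [h02|h02|/hi//];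
case: (ltngtP (height i1) (height i2)) => [h12|h12|/hi//].
- by apply: (key i2 i1 i0) => // j; case: (ord j); [constructor 3|constructor 2|constructor 1].
- by apply: (key i1 i2 i0) => // j; case: (ord j); [constructor 3|constructor 1|constructor 2].
- by have := ltn_trans (ltn_trans h12 h02) h01; rewrite ltnn.
- by apply: (key i1 i0 i2) => // j; case: (ord j); [constructor 2|constructor 1|constructor 3].
- by apply: (key i2 i0 i1) => // j; case: (ord j); [constructor 2|constructor 3|constructor 1].
- by have := ltn_trans (ltn_trans h12 h01) h02; rewrite ltnn.
- by apply: (key i0 i2 i1) => // j; case: (ord j); [constructor 1|constructor 3|constructor 2].
- exact: (key i0 i1 i2).
Qed.

Variables (S : oriented_surface R) (n : nat) (D D' : diagram S n).
Variables (X : Type) (T : X -> X -> X -> X).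
Hypothesis kT : ktq T.

(** Before the move the triangle is above the strand 1 only, after it is above the
strands 0 and 2 only: two opposite types. So each side has three faces at a
vertex, and the rules are those of the whole cube. *)
Lemma R3_colorings : R3_move D D' -> (colorings D T #= colorings D' T)%card.
Proof.
move=> [c [comp [a [b [f [f' [p01 [p02 [p12 [q01 [q02 [q12 [height
  [mv [c01 c02 c12 p1 p2] [d01 d02 d12 q1 q2] hi sa]]]]]]]]]]]]]].
have [qT _ _] := kT.
have [st [sm [sb [[tm tb mb] ord aboveP]]]] := order3 hi.
set i0 : 'I_3 := inord 0 in c01 c02 d01 d02.
set i1 : 'I_3 := inord 1 in c01 c12 d01 d12.
set i2 : 'I_3 := inord 2 in c02 c12 d02 d12.
have ordi (j : 'I_3) : [\/ j = i0, j = i1 | j = i2].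
  by case: j => -[|[|[|//]]] ?; [constructor 1|constructor 2|constructor 3]; apply: val_inj; rewrite /= inordK.
have n01 : i0 != i1 by rewrite -val_eqE /= !inordK.
have n02 : i0 != i2 by rewrite -val_eqE /= !inordK.
have n12 : i1 != i2 by rewrite -val_eqE /= !inordK.
have pairs (P : 'I_3 -> 'I_3 -> Prop) : P i0 i1 -> P i0 i2 -> P i1 i2 ->
    P i1 i0 -> P i2 i0 -> P i2 i1 -> forall k l, k != l -> P k l.
  move=> P1 P2 P3 P4 P5 P6 k l; case: (ordi k) => ->; case: (ordi l) => -> //; by rewrite eqxx.
have m1 : -1 <= (-1 : R) <= 1 by apply/andP; split; lra.
have e1 : -1 <= (1 : R) <= 1 by apply/andP; split; lra.
have crossends (g h : R -> R) p : cross_at g h p -> [/\ g (-1) < h (-1), h 1 < g 1 & -1 <= p <= 1].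
  move=> [/andP[? ?] _ H1 H2]; split; [apply: H1|apply: H2|]; apply/andP; split; lra.
have mkends (g : 'I_3 -> R -> R) r01 r02 r12 : cross_at (g i0) (g i1) r01 ->
    cross_at (g i0) (g i2) r02 -> cross_at (g i1) (g i2) r12 ->
    forall k l, k != l -> g k (-1) != g l (-1) /\ g k 1 != g l 1.
  move=> /crossends[u1 u2 _] /crossends[u3 u4 _] /crossends[u5 u6 _].
  by apply: pairs; split; rewrite ?(lt_eqF u1, lt_eqF u2, lt_eqF u3, lt_eqF u4, lt_eqF u5, lt_eqF u6,
    gt_eqF u1, gt_eqF u2, gt_eqF u3, gt_eqF u4, gt_eqF u5, gt_eqF u6).
have mkconv (g : 'I_3 -> R -> R) r01 r02 r12 : cross_at (g i0) (g i1) r01 ->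
    cross_at (g i0) (g i2) r02 -> cross_at (g i1) (g i2) r12 ->
    forall i j x y z, i != j -> -1 <= x -> y <= 1 -> x <= z <= y ->
    g i x < g j x -> g i y < g j y -> g i z < g j z.
  move=> /cross_conv[u1 u2] /cross_conv[u3 u4] /cross_conv[u5 u6] i j x y z ij.
  move: i j ij; apply: pairs => ? ? ? ? ?; [apply: (u1 x y)|apply: (u3 x y)|apply: (u5 x y)
    |apply: (u2 x y)|apply: (u4 x y)|apply: (u6 x y)] => //.
have ends := mkends f _ _ _ c01 c02 c12.
have ends' := mkends f' _ _ _ d01 d02 d12.
have [s [s' [dir [fE gtD gtD' ag ag']]]] := graph_move_setup mv ends ends'.
pose above (k l : 'I_3) : Prop := (height l < height k)%N.
have tot k l : k != l -> above k l \/ above l k.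
  move=> kl; rewrite /above; case: (ltngtP (height l) (height k)) => [|_|/hi E]; [by left|by right|].
  by rewrite E eqxx in kl.
have gt := gtD above tot (fun k l h => proj1 (sa k l h)).
have gt' := gtD' above tot (fun k l h => proj2 (sa k l h)).
have [[[pc Kc] ab _ _ _] gm] := mv; have [cc _] := pc.
have gr k : graph_in (f k) (-1) 1 (-1) 1 by have [] := gm k.
have gr' k : graph_in (f' k) (-1) 1 (-1) 1 by have [] := gm k.
(* the triangle of D is above strand 1 only *)
pose w (j : 'I_3) := j == i1.
have mkcross (g : 'I_3 -> R -> R) r01 r02 r12 (w' : 'I_3 -> bool) :
    cross_at (g i0) (g i1) r01 -> cross_at (g i0) (g i2) r02 -> cross_at (g i1) (g i2) r12 ->
    (g i2 r01 < g i0 r01) = w' i2 -> (g i1 r02 < g i0 r02) = w' i1 ->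
    (g i0 r12 < g i1 r12) = w' i0 ->
    forall k l, k != l -> exists x, [/\ -1 <= x <= 1, g k x = g l x &
     forall h, h != k -> h != l -> (g h x < g k x) = w' h].
  move=> u01 u02 u12 E2 E1 E0.
  have [_ _ I1] := crossends _ _ _ u01; have [_ _ I2] := crossends _ _ _ u02.
  have [_ _ I3] := crossends _ _ _ u12.
  have [_ F1 _ _] := u01; have [_ F2 _ _] := u02; have [_ F3 _ _] := u12.
  apply: pairs; [exists r01|exists r02|exists r12|exists r01|exists r02|exists r12]; split=> //;
    move=> h; case: (ordi h) => ->; rewrite ?eqxx // => _ _; by rewrite -?F1 -?F2 -?F3.
have lt11 : (-1 : R) < 1 by lra.
apply: (@local_move_card _ _ _ _ T c _ _ _ (faces dir above T) D D' (above_type f) (above_type f') cc Kc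
  (@rect_compact _ _ _ _ _) (@orect_open _ _ _ _ _) (@orect_sub _ _ _ _ _)) => //.
- apply: (triangle_model tm tb mb ord aboveP kT gt (w := w)).
  + exact: mkconv c01 c02 c12.
  + apply: (mkcross f _ _ _ w c01 c02 c12).
    * have [_ _ I] := crossends _ _ _ c01; have [_ _ lt _] := c02.
      have lt2 : f i0 p01 < f i2 p01 by apply: lt; case/andP: I => -> _.
      by rewrite /w (eq_sym i2) (negbTE n12) ltNge ltW.
    * have [_ _ I] := crossends _ _ _ c02; have [_ _ _ gt2] := c01.
      by rewrite /w eqxx gt2 // p1; case/andP: I.
    * have [_ _ I] := crossends _ _ _ c12; have [_ _ _ gt2] := c01.
      have lt2 : f i1 p12 < f i0 p12.
        by apply: gt2; rewrite (lt_trans p1 p2); case/andP: I.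
      by rewrite /w (negbTE n01) ltNge ltW.
  + move=> p [pI _] off tE.
    have t0 : f i0 p.1 < p.2 by have := congr1 (fun t => t i0) tE; rewrite /above_type /w n01.
    have t2 : f i2 p.1 < p.2 by have := congr1 (fun t => t i2) tE; rewrite /above_type /w eq_sym n12.
    have t1 : p.2 <= f i1 p.1.
      by have := congr1 (fun t => t i1) tE; rewrite /above_type /w eqxx leNgt => ->.
    have [/(_ (lt_le_trans t0 t1)) x1 _] := cross_lt c01 pI.
    have [_ /(_ (lt_le_trans t2 t1)) x2] := cross_lt c12 pI.
    by have := lt_trans x2 (lt_trans x1 (lt_trans p1 p2)); rewrite ltxx.
- apply: (triangle_model tm tb mb ord aboveP kT gt' (w := fun j => ~~ w j)).
  + exact: mkconv d01 d02 d12.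
  + apply: (mkcross f' _ _ _ _ d01 d02 d12).
    * have [_ _ I] := crossends _ _ _ d01; have [_ _ _ gt2] := d02.
      by rewrite /w (eq_sym i2) n12 gt2 // q2; case/andP: I.
    * have [_ _ I] := crossends _ _ _ d02; have [_ _ lt _] := d01.
      have lt2 : f' i0 q02 < f' i1 q02 by apply: lt; rewrite q2 andbT; case/andP: I.
      have [_ E _ _] := d02.
      by rewrite /w eqxx ltNge ltW.
    * have [_ _ I] := crossends _ _ _ d12; have [_ _ lt _] := d01.
      by rewrite /w n01 lt // (lt_trans q1 q2) andbT; case/andP: I.
  + move=> p [pI _] off tE.
    have t0 : p.2 <= f' i0 p.1.
      by have := congr1 (fun t => t i0) tE; rewrite /above_type /w n01 leNgt => ->.
    have t2 : p.2 <= f' i2 p.1.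
      by have := congr1 (fun t => t i2) tE; rewrite /above_type /w eq_sym n12 leNgt => ->.
    have t1 : f' i1 p.1 < p.2 by have := congr1 (fun t => t i1) tE; rewrite /above_type /w eqxx.
    have [_ /(_ (lt_le_trans t1 t0)) x1] := cross_lt d01 pI.
    have [/(_ (lt_le_trans t1 t2)) x2 _] := cross_lt d12 pI.
    by have := lt_trans x2 (lt_trans q1 (lt_trans q2 x1)); rewrite ltxx.
- by move=> r; exact: boundary_type.
- exact: (corner_off gt).
- move=> G1 G2 r1 r2 H; have key := faces3_unique tm tb mb aboveP kT (w := w) r1 r2; apply: key => tau nw nw'.
  have [u1 u2 _] := crossends _ _ _ c01; have [u3 u4 _] := crossends _ _ _ c02.
  have [u5 u6 _] := crossends _ _ _ c12.
  have atx x : -1 <= x <= 1 -> (x = -1 \/ x = 1) ->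
      (forall i j, tau i -> ~~ tau j -> f i x < f j x) -> G1 tau = G2 tau.
    move=> xI xE lt.
    have [y [Kxy nU tE]] : exists y, has_type D c f (-1) 1 (-1) 1 tau (x, y) by apply: (fiber_ex gt).
    by rewrite -tE; apply: H => // -[] /=; case: xE => ->; rewrite ltxx ?andbF.
  have tauE t0 t1 t2 : tau i0 = t0 -> tau i1 = t1 -> tau i2 = t2 ->
    (forall v : 'I_3 -> bool, v i0 = t0 -> v i1 = t1 -> v i2 = t2 -> tau = v).
    move=> e0 e1' e2 v v0 v1 v2; apply/funext => j.
    by case: (ordi j) => ->; rewrite ?e0 ?e1' ?e2.
  have w0 : w i0 = false by rewrite /w (negbTE n01).
  have w1 : w i1 = true by rewrite /w eqxx.
  have w2 : w i2 = false by rewrite /w eq_sym (negbTE n12).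
  case E0 : (tau i0); case E1 : (tau i1); case E2 : (tau i2).
  + by apply: (atx _ m1 (or_introl erefl)) => i j; case: (ordi j) => ->; rewrite ?E0 ?E1 ?E2.
  + by apply: (atx _ m1 (or_introl erefl)) => i j; case: (ordi j) => ->; rewrite ?E0 ?E1 ?E2 // ; case: (ordi i) => ->; rewrite ?E0 ?E1 ?E2.
  + by case: nw'; apply: (tauE _ _ _ E0 E1 E2); rewrite ?w0 ?w1 ?w2.
  + by apply: (atx _ m1 (or_introl erefl)) => i j; case: (ordi j) => ->; rewrite ?E0 ?E1 ?E2 // ; case: (ordi i) => ->; rewrite ?E0 ?E1 ?E2.
  + by apply: (atx _ e1 (or_intror erefl)) => i j; case: (ordi j) => ->; rewrite ?E0 ?E1 ?E2 // ; case: (ordi i) => ->; rewrite ?E0 ?E1 ?E2.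
  + by case: nw; apply: (tauE _ _ _ E0 E1 E2).
  + by apply: (atx _ e1 (or_intror erefl)) => i j; case: (ordi j) => ->; rewrite ?E0 ?E1 ?E2 // ; case: (ordi i) => ->; rewrite ?E0 ?E1 ?E2.
  + by apply: (atx _ m1 (or_introl erefl)) => i j; case: (ordi i) => ->; rewrite ?E0 ?E1 ?E2.
Qed.

End MoveThree.

(** * First Reidemeister move *)

Inductive curl_region := CurlTop | CurlLoop | CurlOuter.

Section CurlPlane.
Variable R : realType.
Implicit Types p : plane R.

(** The curl is the zero set of this polynomial in the rectangle. *)
Definition curl_eq p : R := p.1 ^+ 2 - p.2 * (p.2 - 1) ^+ 2.

Definition curl_type p : curl_region :=
  if curl_eq p < 0 then (if 1 < p.2 then CurlTop else CurlLoop) else CurlOuter.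

Definition corner_region (u v : bool) : curl_region :=
  if u && v then CurlTop else if u || v then CurlOuter else CurlLoop.

Lemma curl_eq0 (s : R) : curl_eq (curl s) = 0.
Proof. by rewrite /curl_eq /curl /=; ring. Qed.

Lemma curl_eq0P p : rect (-6) 6 (-1) 5 p -> curl_eq p = 0 ->
  exists2 s, -2 <= s <= 2 & p = curl s.
Proof.
case: p => x y [/andP[/= x1 x2] /andP[/= y1 y2]]; rewrite /curl_eq /= => E.
have y0 : 0 <= y.
  rewrite leNgt; apply/negP => yn; have : 0 < (y - 1) ^+ 2 by rewrite exprn_even_gt0 //= subr_eq0; apply/eqP; lra.
  move=> yy; have := sqr_ge0 x; nra.
have y4 : y <= 4.
  rewrite leNgt; apply/negP => yn.
  have a1 : x ^+ 2 <= 36 by nra.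
  have a2 : 9 <= (y - 1) ^+ 2 by nra.
  nra.
pose r := Num.sqrt y.
have rr : r ^+ 2 = y by exact: sqr_sqrtr.
have r0 : 0 <= r by exact: sqrtr_ge0.
have r2 : r <= 2 by rewrite leNgt; apply/negP => h; nra.
have : (x - r * (y - 1)) * (x + r * (y - 1)) = 0.
  transitivity (x ^+ 2 - r ^+ 2 * (y - 1) ^+ 2); first by ring.
  by rewrite rr.
move/eqP; rewrite mulf_eq0 => /orP[/eqP H|/eqP H].
  exists r; first by apply/andP; split; lra.
  rewrite /curl rr; congr pair.
  have -> : x = r * (y - 1) by lra.
  by rewrite -rr; ring.
exists (- r); first by apply/andP; split; lra.
rewrite /curl sqrrN rr; congr pair.
have -> : x = - r * (y - 1) by lra.
by rewrite -rr; ring.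
Qed.

Lemma curl_double (s u : R) : s != u -> curl s = curl u ->
  [/\ s = 1 \/ s = -1, u = - s & curl s = (0, 1)].
Proof.
move=> su [E1 E2].
have us : u = - s.
  have : (s - u) * (s + u) = 0 by move: E2; rewrite -subr_sqr => ->; rewrite subrr.
  by move/eqP; rewrite mulf_eq0 subr_eq0 (negbTE su) /= => /eqP; lra.
have s1 : s ^+ 2 = 1.
  subst u.
  have : s * (s ^+ 2 - 1) = 0.
    have -> : s * (s ^+ 2 - 1) = s ^+ 3 - s by ring.
    have : (- s) ^+ 3 - - s = - (s ^+ 3 - s) by ring.
    by move: E1 => -> ; lra.
  move/eqP; rewrite mulf_eq0 => /orP[/eqP s0|/eqP]; last lra.
  by move: su; rewrite s0 oppr0 eqxx.
split=> //.
  by move/eqP: s1; rewrite sqrf_eq1 => /orP[/eqP|/eqP]; [left|right].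
rewrite /curl s1; congr pair.
have -> : s ^+ 3 - s = s * (s ^+ 2 - 1) by ring.
by rewrite s1 subrr mulr0.
Qed.

Lemma curl_eq_continuous : continuous (curl_eq : plane R -> R).
Proof.
have -> : curl_eq = (fun p : plane R => p.1 * p.1 - p.2 * ((p.2 - 1) * (p.2 - 1))).
  by apply/funext => p; rewrite /curl_eq; ring.
move=> p; have c1 : (q.1) @[q --> p] --> p.1 by exact: cvg_fst.
have c2 : (q.2) @[q --> p] --> p.2 by exact: cvg_snd.
have c3 : (q.2 - 1) @[q --> p] --> p.2 - 1 by apply: cvgB => //; exact: cvg_cst.
by apply: cvgB; [exact: cvgM|apply: cvgM => //; exact: cvgM].
Qed.

Lemma curl_type_near p : curl_eq p <> 0 ->
  \forall q \near p, curl_eq q <> 0 /\ curl_type q = curl_type p.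
Proof.
move=> /eqP; rewrite neq_lt => /orP[lt|gt_].
  have H1 : \forall q \near p, curl_eq q < 0 by exact: (curl_eq_continuous (lt_nbhsl lt)).
  have n1 : p.2 != 1.
    apply/eqP => E; move: lt; rewrite /curl_eq E subrr expr0n mulr0 subr0 ltNge.
    by rewrite sqr_ge0.
  have H2 : \forall q \near p, (1 < q.2) = (1 < p.2).
    move: n1; rewrite neq_lt => /orP[l|l].
      have : \forall q \near p, q.2 < 1 by apply: (@near_snd _ p [set y | y < 1]); exact: lt_nbhsl.
      by apply: filterS => q lq; apply/idP/idP => h; lra.
    have : \forall q \near p, 1 < q.2 by apply: (@near_snd _ p [set y | 1 < y]); exact: lt_nbhsr.
    by apply: filterS => q lq; rewrite lq l.
  apply: filterS2 H1 H2 => q h1 h2; split; first by apply/eqP; rewrite lt_eqF.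
  by rewrite /curl_type h1 lt h2.
have H1 : \forall q \near p, 0 < curl_eq q by exact: (curl_eq_continuous (lt_nbhsr gt_)).
apply: filterS H1 => q h1; split; first by apply/eqP; rewrite gt_eqF.
by rewrite /curl_type (lt_gtF h1) (lt_gtF gt_).
Qed.

(** Near the double point the polynomial is, to second order, -(y - 1 + x)(y - 1 -
x), the product of the equations of the two tangents. *)
Lemma curl_side (q : R -> plane R) eta : is_derive (0 : R) (1 : R) q eta ->
  q 0 = (0, 1) -> eta.2 + eta.1 != 0 -> eta.2 - eta.1 != 0 ->
  \forall e \near 0^'+, curl_eq (q e) <> 0 /\
    curl_type (q e) = corner_region (0 < eta.2 + eta.1) (0 < eta.2 - eta.1).
Proof.
move=> dq q0 n1 n2.
have [r cr rE] := is_derive_caratheodory dq.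
have d2 : is_derive (0 : R) (1 : R) (fun e => (q e).2 - 1) eta.2.
  have := is_deriveB (is_derive_snd dq) (is_derive_cst (1 : R) (0 : R) (1 : R)).
  by rewrite subr0.
have z2 : (q 0).2 - 1 = 0 by rewrite q0 /= subrr.
have c1 : (r e).1 @[e --> (0:R)] --> eta.1 by apply: (cvg_comp _ _ cr); exact: cvg_fst.
have c2 : (r e).2 @[e --> (0:R)] --> eta.2 by apply: (cvg_comp _ _ cr); exact: cvg_snd.
have cq : (q e).2 @[e --> (0:R)] --> (1 : R).
  have -> : (1 : R) = (q 0).2 by rewrite q0.
  exact: is_derive_cvg (is_derive_snd dq).
pose k e := (r e).1 * (r e).1 - (q e).2 * ((r e).2 * (r e).2).
have ck : k e @[e --> (0:R)] --> eta.1 * eta.1 - 1 * (eta.2 * eta.2).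
  by apply: cvgB; [exact: cvgM|apply: cvgM => //; exact: cvgM].
have hE e : curl_eq (q e) = e ^+ 2 * k e.
  have := rE e; rewrite subr0 q0 => E.
  have E1 : (q e).1 = e * (r e).1 by have := congr1 fst E; rewrite /= subr0.
  have E2 : (q e).2 - 1 = e * (r e).2 by have := congr1 snd E.
  by rewrite /curl_eq E2 E1 /k; ring.
have kneg : eta.1 * eta.1 - 1 * (eta.2 * eta.2) < 0 -> \forall e \near 0^'+, curl_eq (q e) < 0.
  move=> H; have nk : \forall e \near (0:R)^'+, k e < 0 by apply: near_right; exact: (ck _ (lt_nbhsl H)).
  have ep : \forall e \near (0:R)^'+, 0 < e by exact: nbhs_right_gt.
  by apply: filterS2 nk ep => e ke e0; rewrite hE pmulr_rlt0 // exprn_gt0.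
have kpos : 0 < eta.1 * eta.1 - 1 * (eta.2 * eta.2) -> \forall e \near 0^'+, 0 < curl_eq (q e).
  move=> H; have nk : \forall e \near (0:R)^'+, 0 < k e by apply: near_right; exact: (ck _ (lt_nbhsr H)).
  have ep : \forall e \near (0:R)^'+, 0 < e by exact: nbhs_right_gt.
  by apply: filterS2 nk ep => e ke e0; rewrite hE pmulr_rgt0 // exprn_gt0.
rewrite /corner_region.
move: n1 n2; rewrite !neq_lt => /orP[u|u] /orP[v|v].
- have y1 := is_derive_right_neg d2 z2 ltac:(lra).
  have kn := kneg ltac:(nra).
  apply: filterS2 y1 kn => e y1 kn; split; first by apply/eqP; rewrite lt_eqF.
  rewrite /curl_type kn; have -> : (1 < (q e).2) = false by apply/negbTE; rewrite -leNgt; lra.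
  by rewrite (lt_gtF u) (lt_gtF v).
- have kn := kpos ltac:(nra).
  apply: filterS kn => e kn; split; first by apply/eqP; rewrite gt_eqF.
  by rewrite /curl_type v (lt_gtF u) (lt_gtF kn).
- have kn := kpos ltac:(nra).
  apply: filterS kn => e kn; split; first by apply/eqP; rewrite gt_eqF.
  by rewrite /curl_type u (lt_gtF v) (lt_gtF kn).
- have y1 := is_derive_right_pos d2 z2 ltac:(lra).
  have kn := kneg ltac:(nra).
  apply: filterS2 y1 kn => e y1 kn; split; first by apply/eqP; rewrite lt_eqF.
  rewrite /curl_type kn; have -> : (1 < (q e).2) = true by lra.
  by rewrite u v.
Qed.

End CurlPlane.

Lemma curl_in (R : realType) (s : R) : -2 <= s <= 2 -> rect (-6) 6 (-1) 5 (curl s).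
Proof.
move=> /andP[s1 s2]; split=> /=; apply/andP; split; rewrite ?expr2; last by nra.
- have : 0 <= (s + 2) * ((s - 1) ^+ 2 + 2) by apply: mulr_ge0; [lra|have := sqr_ge0 (s - 1); lra].
  have -> : (s + 2) * ((s - 1) ^+ 2 + 2) = s ^+ 3 - s + 6 by ring.
  by move=> ?; lra.
- have : 0 <= (2 - s) * ((s + 1) ^+ 2 + 2) by apply: mulr_ge0; [lra|have := sqr_ge0 (s + 1); lra].
  have -> : (2 - s) * ((s + 1) ^+ 2 + 2) = 6 - (s ^+ 3 - s) by ring.
  by move=> ?; lra.
- by nra.
Qed.

Lemma curl_inside (R : realType) (s : R) : -2 < s < 2 -> orect (-6) 6 (-1) 5 (curl s).
Proof.
move=> /andP[s1 s2]; split=> /=; apply/andP; split; rewrite ?expr2; last by nra.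
- have : 0 < (s + 2) * ((s - 1) ^+ 2 + 2) by apply: mulr_gt0; [lra|have := sqr_ge0 (s - 1); lra].
  have -> : (s + 2) * ((s - 1) ^+ 2 + 2) = s ^+ 3 - s + 6 by ring.
  by move=> ?; lra.
- have : 0 < (2 - s) * ((s + 1) ^+ 2 + 2) by apply: mulr_gt0; [lra|have := sqr_ge0 (s + 1); lra].
  have -> : (2 - s) * ((s + 1) ^+ 2 + 2) = 6 - (s ^+ 3 - s) by ring.
  by move=> ?; lra.
- by nra.
Qed.

Lemma side_sign (R : realType) (l z : R) (o : side) (d : bool) :
  (if d then 0 <= l else l <= 0) ->
  (match o with onleft => 0 < 2 * l * z | onright => 2 * l * z < 0 end) ->
  z != 0 /\ (0 < z) = (d == isleft o).
Proof.
case: o; case: d => sgn side.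
- have z0 : 0 < z by nra.
  by rewrite z0 gt_eqF.
- have z0 : z < 0 by nra.
  by rewrite (lt_gtF z0) lt_eqF.
- have z0 : z < 0 by nra.
  by rewrite (lt_gtF z0) lt_eqF.
- have z0 : 0 < z by nra.
  by rewrite z0 gt_eqF.
Qed.

Section CurlDiagram.
Variables (R : realType) (S : oriented_surface R) (n : nat) (D : diagram S n).
Variables (c : chart R S) (i : 'I_n) (a b : R) (s : R -> R) (d : bool).
Variables (X : Type) (T : X -> X -> X -> X).
Let K : set (plane R) := rect (-6) 6 (-1) 5.
Hypothesis pc : positive_chart c.
Hypothesis Kc : K `<=` cdom c.
Hypothesis ab : a < b.
Hypothesis meets : meets_in_strands D c K (fun _ : 'I_1 => i) (fun _ => a) (fun _ => b).
Hypothesis rs : runs c (curve D i) a b (@curl R) (-2) 2 s d.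

Let cc : is_chart c. Proof. by case: pc. Qed.

Let curl_dom x : -2 <= x <= 2 -> cdom c (curl x).
Proof. by move=> /curl_in /Kc. Qed.

Let curl_curve t : a <= t <= b -> curve D i t = param c (curl (s t)).
Proof. by case: rs => _ _; apply. Qed.

Lemma curl_hits j t p : K p -> curve D j t = param c p ->
  j = i /\ exists z : int, a <= t + z%:~R <= b /\ p = curl (s (t + z%:~R)).
Proof.
move=> Kp E; have /meets [k [z [/= ji tI]]] : (param c @` K) (curve D j t) by exists p.
split=> //; exists z; split=> //; apply: (param_inj cc (Kc Kp)).
  exact/curl_dom/(runs_in_cc ab rs).
by rewrite -E -curl_curve // -ji curve_shift.
Qed.

Lemma curl_universe p : K p -> universe D (param c p) <-> curl_eq p = 0.
Proof.
move=> Kp; split=> [[j [t E]]|E].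
  by have [_ [z [_ ->]]] := curl_hits Kp (esym E); rewrite curl_eq0.
have [u uI ->] := curl_eq0P Kp E.
have [t tI <-] := runs_surj ab rs uI.
by exists i, t; rewrite curl_curve.
Qed.

(** Near the double point the parameter is a square root of the ordinate, up to
sign, hence differentiable; the velocity is then a multiple of (1, eps). *)
Lemma curl_strand_side t w eta o eps : a <= t <= b -> s t = eps ->
  eps = 1 \/ eps = -1 -> is_derive t (1 : R) (coord c \o curve D i) w ->
  on_side w o eta ->
  eta.2 - eps * eta.1 != 0 /\ (0 < eta.2 - eps * eta.1) = (d == isleft o).
Proof.
move=> tI st eps1 dw side.
have eps2 : eps * eps = 1 by case: eps1 => ->; ring.
have tI' : a < t < b.
  have nend : ~ (s t = -2 \/ s t = 2) by rewrite st; case: eps1 => ->; lra.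
  case/andP: tI => t1 t2; rewrite !lt_neqAle t1 t2 !andbT; apply/andP; split; apply/eqP => E; apply: nend.
    by rewrite -E; case: (runs_ends rs) => -[-> _]; [left|right].
  by rewrite E; case: (runs_ends rs) => -[_ ->]; [right|left].
have gE : \forall u \near t, a <= u <= b.
  case/andP: tI' => t1 t2; near=> u; apply/andP; split; apply: ltW; near: u;
    [exact: lt_nbhsr|exact: lt_nbhsl].
have gE' : \forall u \near t, coord c (curve D i u) = curl (s u).
  apply: filterS gE => u uI.
  by have [_ ->] := runs_coord ab rs cc curl_dom uI.
have d1 := is_derive_fst dw; have d2 := is_derive_snd dw.
have g2t : (coord c (curve D i t)).2 = 1.
  by rewrite (nbhs_singleton gE') /curl /= st expr2.
have d0 : is_derive ((coord c (curve D i t)).2) (1 : R) Num.sqrt (2 * Num.sqrt 1)^-1.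
  by rewrite g2t; apply: is_derive1_sqrt.
have dsq := is_derive_scale_comp d2 d0.
rewrite sqrtr1 mulr1 in dsq.
have deps : \forall u \near t, eps * Num.sqrt ((coord c (curve D i u)).2) = s u.
  have [cs _ _] := rs.
  have cst : s @ within `[a, b] (nbhs t) --> s t.
    by move/subspace_continuousP : cs; apply; rewrite /= in_itv.
  have pos : \forall u \near t, 0 < eps * s u.
    have ces : eps * s u @[u --> within `[a, b] (nbhs t)] --> eps * s t.
      by apply: cvgM => //; exact: cvg_cst.
    have e0 : 0 < eps * s t by rewrite st eps2.
    have H : \forall u \near t, `[a, b]%classic u -> 0 < eps * s u by exact: (ces _ (lt_nbhsr e0)).
    by apply: filterS2 gE H => u uI; apply; rewrite /= in_itv.
  apply: filterS2 gE' pos => u -> pu; rewrite /curl /= sqrtr_sqr.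
  case: eps1 pu => ->; first by rewrite !mul1r => pu; rewrite gtr0_norm.
  by rewrite !mulN1r oppr_gt0 => pu; rewrite ltr0_norm // opprK.
have ds : is_derive t (1 : R) s (eps * (w.2 / 2)).
  exact: (near_eq_is_derive deps (is_deriveZ eps dsq)).
have w1 : w.1 = eps * w.2.
  have dm := is_deriveM ds (is_deriveB d2 (is_derive_cst (1 : R) t (1 : R))).
  have dm' : is_derive t (1 : R) (fun u => (coord c (curve D i u)).1) (eps * w.2).
    have E : s t *: (w.2 - 0) + ((coord c (curve D i t)).2 - 1) *: (eps * (w.2 / 2)) = eps * w.2.
      by rewrite g2t subrr scale0r addr0 subr0 st.
    rewrite -E; apply: near_eq_is_derive dm.
    apply: filterS gE' => u uE; rewrite uE -[LHS]/(s u * ((coord c (curve D i u)).2 - 1)) uE /curl /=.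
    by ring.
  by rewrite -(@derive_val _ _ _ _ _ _ _ d1) (@derive_val _ _ _ _ _ _ _ dm').
have sgn := runs_derive_sign rs tI' ds.
have detE : det2 w eta = 2 * (eps * (w.2 / 2)) * (eta.2 - eps * eta.1).
  rewrite /det2 w1; transitivity (eps * w.2 * eta.2 - (eps * eps) * w.2 * eta.1); last by field.
  by rewrite eps2; ring.
set l := eps * (w.2 / 2) in sgn detE.
by apply: (side_sign sgn); move: side; rewrite /on_side detE.
Unshelve. all: by end_near.
Qed.

(** Two opposite corners of the crossing lie in the same outer region, whatever
strand is over; the source corner is in the loop or at the top according to
the direction [d] of the strand. *)
Definition curl_rules (G : curl_region -> X) : Prop :=
  G CurlOuter = if d then T (G CurlLoop) (G CurlOuter) (G CurlTop)
                else T (G CurlTop) (G CurlOuter) (G CurlLoop).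

Let p0 : plane R := (0, 1).

Definition curl_crossing_at c0 (x : S) (v w : plane R) : Prop :=
  forall so su d0, corner v w so su d0 ->
    \forall e \near (0 : R)^'+, exists q, [/\ K q, ray c0 x d0 e = param c q,
      ~ universe D (param c q) &
      curl_type q = corner_region (d == isleft so) (d == isleft su)].

Let Kp0 : K p0. Proof. by split=> /=; apply/andP; split; lra. Qed.

Lemma corner_regionC u v : corner_region u v = corner_region v u.
Proof. by case: u; case: v. Qed.

Lemma curl_crossing c0 x v w : crossing D c0 x v w -> (param c @` K) x ->
  x = param c p0 /\ curl_crossing_at c0 x v w.
Proof.
move=> [i' [t [j' [u [dp ov [ac0 c0x] xE [vE wE]]]]]] [p Kp pE].
have [iE [z [tI pt]]] := curl_hits Kp (etrans (esym xE) (esym pE)).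
have xE' : x = curve D j' u by rewrite xE; case: dp.
have [jE [z' [uI pu]]] := curl_hits Kp (etrans (esym xE') (esym pE)).
subst i' j'.
have [t' t'E] : exists t', t' = t + z%:~R by exists (t + z%:~R).
have [u' u'E] : exists u', u' = u + z'%:~R by exists (u + z'%:~R).
rewrite -t'E in tI pt; rewrite -u'E in uI pu.
have stt : same_point i t i t' by split=> //; exists z.
have suu : same_point i u i u' by split=> //; exists z'.
have ne : s t' != s u'.
  apply/eqP => /(runs_inj rs tI uI) tu; have [_] := dp; apply.
  by apply: same_point_trans stt _; rewrite tu; exact: same_point_sym.
have [eps1 us pp0] := curl_double ne (etrans (esym pt) pu).
have pE0 : p = p0 by rewrite pt pp0.
split=> [|so su d0 [cv cw]]; first by rewrite -pE pE0.
have [cx pK] : ccod c x /\ coord c x = p0.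
  by rewrite -pE -[in RHS]pE0; exact: chart_param (Kc Kp).
have [L [[J J0 LJ] Lg Ld]] := chart_change pc ac0 cx c0x.
have [dq cq] := Ld d0.
pose q e := coord c (ray c0 x d0 e).
have q0 : q 0 = p0.
  rewrite /q /ray scale0r addr0.
  by have [_ ->] := chart_coord (atlas_chart ac0) c0x.
have xt' : x = curve D i t' by rewrite xE (curve_same D stt).
have xu' : x = curve D i u' by rewrite xE' (curve_same D suu).
have vt : is_derive t' (1 : R) (coord c \o curve D i) (L v).
  apply: Lg; [exact: curve_continuous|by []|].
  by rewrite vE (velocity_same D c0 stt); apply: curve_derive => //; rewrite -xt'.
have wu : is_derive u' (1 : R) (coord c \o curve D i) (L w).
  apply: Lg; [exact: curve_continuous|by []|].
  by rewrite wE (velocity_same D c0 suu); apply: curve_derive => //; rewrite -xu'.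
have sideL y o : on_side y o d0 -> on_side (L y) o (L d0).
  by case: o => /=; rewrite LJ ?pmulr_rgt0 ?pmulr_rlt0.
have [n1 s1] := curl_strand_side tI erefl eps1 vt (sideL _ _ cv).
have eps2 : s u' = 1 \/ s u' = -1.
  by rewrite us; case: eps1 => ->; [right|left; rewrite opprK].
have [n2 s2] := curl_strand_side uI erefl eps2 wu (sideL _ _ cw).
have sides : \forall e \near (0 : R)^'+, curl_eq (q e) <> 0 /\
    curl_type (q e) = corner_region (d == isleft so) (d == isleft su).
  rewrite -s1 -s2 us in n2 *.
  case: eps1 n1 n2 => ->; rewrite ?mulN1r ?opprK ?mul1r => n1 n2.
    by rewrite corner_regionC; exact: curl_side.
  exact: curl_side.
have cvq : q e @[e --> (0:R)] --> p0 by rewrite -q0; exact: is_derive_cvg dq.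
have nK : \forall e \near (0 : R)^'+, K (q e).
  apply: near_right; apply: cvq.
  have : \forall y \near p0, orect (-6) 6 (-1) 5 y.
    by apply: open_nbhs_nbhs; split; [exact: orect_open|split=> /=; apply/andP; split; lra].
  by apply: filterS; exact: orect_sub.
near=> e; exists (q e).
have Ke : K (q e) by near: e.
have [h1 h2] : curl_eq (q e) <> 0 /\
    curl_type (q e) = corner_region (d == isleft so) (d == isleft su) by near: e.
split=> //.
- by have [_ ->] : cdom c (coord c (ray c0 x d0 e)) /\ param c (q e) = ray c0 x d0 e
    by apply: chart_coord => //; near: e.
- by move/(curl_universe Ke).
Unshelve. all: by end_near.
Qed.

End CurlDiagram.

Section CurlModel.
Variables (R : realType) (S : oriented_surface R) (n : nat) (D : diagram S n).
Variables (c : chart R S) (i : 'I_n) (a b : R) (s : R -> R) (d : bool).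
Variables (X : Type) (T : X -> X -> X -> X).
Let K : set (plane R) := rect (-6) 6 (-1) 5.
Hypothesis pc : positive_chart c.
Hypothesis Kc : K `<=` cdom c.
Hypothesis ab : a < b.
Hypothesis ba1 : b < a + 1.
Hypothesis meets : meets_in_strands D c K (fun _ : 'I_1 => i) (fun _ => a) (fun _ => b).
Hypothesis rs : runs c (curve D i) a b (@curl R) (-2) 2 s d.

Let cc : is_chart c. Proof. by case: pc. Qed.
Let U_curl p (Kp : K p) := curl_universe pc Kc ab meets rs Kp.

Section AtCurlCrossing.
Variables (c0 : chart R S) (x : S) (v w : plane R).
Hypothesis cr : curl_crossing_at D c d c0 x v w.
Variables (phi : S -> X) (G : curl_region -> X).
Hypothesis phiG : forall p, K p -> ~ universe D (param c p) ->
  phi (param c p) = G (curl_type p).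

Let phi_corner so su d0 : corner v w so su d0 ->
  \forall e \near (0 : R)^'+, ~ universe D (ray c0 x d0 e) /\
    phi (ray c0 x d0 e) = G (corner_region (d == isleft so) (d == isleft su)).
Proof.
move=> cd; have H0 := cr cd.
apply: filterS H0 => e [q [Kq E nU tE]]; rewrite E -tE.
by split=> //; exact: phiG.
Qed.

Lemma curl_crossing_rule : curl_rules d T G -> crossing_rule T D phi c0 x v w.
Proof.
by move=> fG; apply: (corner_colors_rule phi_corner); move: fG; rewrite /curl_rules; case: (d).
Qed.

Lemma crossing_rule_curl : det2 v w != 0 -> crossing_rule T D phi c0 x v w ->
  curl_rules d T G.
Proof.
by move=> vw /(rule_corner_colors phi_corner vw); rewrite /curl_rules; case: (d).
Qed.

End AtCurlCrossing.

Section CurlConstant.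
Variable phi : S -> X.
Hypothesis lc : locally_constant_off D phi.

Let lc_near p : K p -> curl_eq p <> 0 ->
  \forall q \near p, phi (param c q) = phi (param c p).
Proof.
move=> Kp nU; have nU' : ~ universe D (param c p) by move/(U_curl Kp).
exact: (param_continuous cc (Kc Kp) (lc nU')).
Qed.

Let horizontal x x' y : x <= x' ->
  (forall z, x <= z <= x' -> K (z, y) /\ curl_eq (z, y) <> 0) ->
  phi (param c (x, y)) = phi (param c (x', y)).
Proof.
move=> xx H; apply: (@locally_constant_segment R X x x' (fun z => phi (param c (z, y)))) => //.
move=> z /H[Kz nz].
have N : \forall t \near z, phi (param c (t, y)) = phi (param c (z, y)).
  exact: ((@horizontal_cvg R z y) _ (lc_near Kz nz)).
by apply: filterS N.
Qed.

Let vertical x y y' : y <= y' ->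
  (forall z, y <= z <= y' -> K (x, z) /\ curl_eq (x, z) <> 0) ->
  phi (param c (x, y)) = phi (param c (x, y')).
Proof.
move=> yy H; apply: (@locally_constant_segment R X y y' (fun z => phi (param c (x, z)))) => //.
move=> z /H[Kz nz].
have N : \forall t \near z, phi (param c (x, t)) = phi (param c (x, z)).
  exact: ((@vertical_cvg R x z) _ (lc_near Kz nz)).
by apply: filterS N.
Qed.

Let KE x y : K (x, y) <-> [/\ -6 <= x, x <= 6, -1 <= y & y <= 5].
Proof. by split=> [[/andP[? ?] /andP[? ?]]|[? ? ? ?]] //; split; apply/andP. Qed.

Let to_axis x y : K (x, y) -> curl_eq (x, y) < 0 ->
  phi (param c (x, y)) = phi (param c (0, y)).
Proof.
move=> /KE[x1 x2 y1 y2]; rewrite /curl_eq /= => h.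
have [x0|x0] := lerP 0 x.
  apply/esym; apply: horizontal => // z /andP[z1 z2]; split; first by apply/KE; split; lra.
  apply/eqP; rewrite lt_eqF // /curl_eq /=; apply: le_lt_trans h.
  by rewrite lerD2r; rewrite ler_sqr ?nnegrE //; exact: le_trans z2.
apply: horizontal; first exact: ltW.
move=> z /andP[z1 z2]; split; first by apply/KE; split; lra.
apply/eqP; rewrite lt_eqF // /curl_eq /=; apply: le_lt_trans h.
rewrite lerD2r -(sqrrN x) -(sqrrN z) ler_sqr ?nnegrE ?oppr_ge0 ?lerN2 //; lra.
Qed.

Let axis_neg z : z != 1 -> 0 < z -> curl_eq (0, z) < 0 :> R.
Proof.
move=> z1 z0; rewrite /curl_eq /= expr0n /= sub0r oppr_lt0 mulr_gt0 //.
by rewrite exprn_even_gt0 //= subr_eq0.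
Qed.

Let top_constant x y : K (x, y) -> curl_type (x, y) = CurlTop ->
  phi (param c (x, y)) = phi (param c (0, 5)).
Proof.
move=> Kp; rewrite /curl_type; case: ifP => // h; case: ifP => //= y1 _.
rewrite to_axis //; move/KE: Kp => [x1 x2 y3 y2].
apply: vertical => // z /andP[z1 z2]; split; first by apply/KE; split; lra.
apply/eqP; rewrite lt_eqF // axis_neg //; last by lra.
by rewrite gt_eqF //; lra.
Qed.

Let loop_constant x y : K (x, y) -> curl_type (x, y) = CurlLoop ->
  phi (param c (x, y)) = phi (param c (0, 1 / 2)).
Proof.
move=> Kp; rewrite /curl_type; case: ifP => // h; case: ifP => //= /negbT; rewrite -leNgt => y1 _.
have y0 : 0 < y.
  rewrite ltNge; apply/negP => yn; move: h; rewrite /curl_eq /= ltNge => /negP; apply.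
  by rewrite subr_ge0 (le_trans _ (sqr_ge0 x)) // mulr_le0_ge0 // sqr_ge0.
have yn1 : y < 1.
  rewrite lt_neqAle y1 andbT; apply/eqP => E; move: h.
  by rewrite /curl_eq /= E subrr expr0n mulr0 subr0 ltNge sqr_ge0.
rewrite to_axis //; move/KE: Kp => [x1 x2 y3 y2].
have nz z : 0 < z -> z < 1 -> K (0, z) /\ curl_eq (0, z) <> 0.
  move=> z0 z1; split; first by apply/KE; split; lra.
  by apply/eqP; rewrite lt_eqF // axis_neg // lt_eqF.
have [yh|yh] := lerP y (1 / 2).
  by apply: vertical => // z /andP[z1 z2]; apply: nz; lra.
apply/esym; apply: vertical; first exact: ltW.
by move=> z /andP[z1 z2]; apply: nz; lra.
Qed.

Let side_pos (z : R) : z < 4 -> z * (z - 1) ^+ 2 < 36.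
Proof.
move=> z4; have [z0|z0] := lerP z 0.
  by apply: (@le_lt_trans _ _ 0) => //; rewrite mulr_le0_ge0 // sqr_ge0.
have : (z - 1) ^+ 2 < 9 by rewrite expr2; nra.
move=> h; have := sqr_ge0 (z - 1); nra.
Qed.

Let outer_constant x y : K (x, y) -> 0 < curl_eq (x, y) ->
  phi (param c (x, y)) = phi (param c (6, -1)).
Proof.
move=> Kp h; have [x1 x2 y1 y2] := (KE x y).1 Kp.
have y4 : y < 4.
  rewrite ltNge; apply/negP => y4; move: h; rewrite /curl_eq /=.
  have a1 : x ^+ 2 <= 36 by rewrite expr2; nra.
  have a2 : 9 <= (y - 1) ^+ 2 by rewrite expr2; nra.
  have a3 : 36 <= y * (y - 1) ^+ 2 by nra.
  lra.
have down u : u = 6 \/ u = -6 -> phi (param c (u, y)) = phi (param c (u, -1)).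
  move=> u6; apply/esym; apply: vertical => // z /andP[z1 z2]; split.
    by apply/KE; case: u6 => ->; split; lra.
  apply/eqP; rewrite gt_eqF // /curl_eq /=.
  have -> : u ^+ 2 = 36 by case: u6 => ->; rewrite expr2; ring.
  by rewrite subr_gt0; apply: side_pos; exact: le_lt_trans y4.
have bottom : phi (param c (-6, -1)) = phi (param c (6, -1)).
  apply: horizontal; first by lra.
  move=> z /andP[z1 z2]; split; first by apply/KE; split; lra.
  by apply/eqP; rewrite gt_eqF // /curl_eq /= !expr2; have := sqr_ge0 z; rewrite expr2; lra.
have [x0|x0] := lerP 0 x.
  rewrite -down; last by left.
  apply: horizontal => // z /andP[z1 z2]; split; first by apply/KE; split; lra.
  apply/eqP; rewrite gt_eqF //; apply: lt_le_trans h _; rewrite /curl_eq /= lerD2r.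
  by rewrite ler_sqr ?nnegrE //; exact: le_trans z1.
rewrite -bottom -down; last by right.
apply/esym; apply: horizontal => // z /andP[z1 z2]; split; first by apply/KE; split; lra.
apply/eqP; rewrite gt_eqF //; apply: lt_le_trans h _; rewrite /curl_eq /= lerD2r.
by rewrite -(sqrrN x) -(sqrrN z) ler_sqr ?nnegrE ?oppr_ge0 ?lerN2 //; lra.
Qed.

(** Each of the three regions of the rectangle is swept by horizontal and vertical
segments that end at a base point. *)
Lemma curl_class_fun : exists G : curl_region -> X,
  forall p, K p -> ~ universe D (param c p) -> phi (param c p) = G (curl_type p).
Proof.
exists (fun r => match r with CurlTop => phi (param c (0, 5))
  | CurlLoop => phi (param c (0, 1 / 2)) | CurlOuter => phi (param c (6, -1)) end).
move=> [x y] Kp nU; case E : (curl_type (x, y)).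
- exact: top_constant.
- exact: loop_constant.
- apply: outer_constant => //; move: E; rewrite /curl_type.
  case: ltgtP => //; first by case: ifP.
  by move=> E; case: nU; apply/(U_curl Kp).
Qed.

End CurlConstant.

Lemma curl_crossing_exists : exists c0 v w,
  crossing D c0 (param c (0, 1)) v w /\ det2 v w != 0.
Proof.
have [t tI st] : exists2 t, a <= t <= b & s t = 1 by apply: (runs_surj ab rs); apply/andP; split; lra.
have [u uI su] : exists2 u, a <= u <= b & s u = -1 by apply: (runs_surj ab rs); apply/andP; split; lra.
have [_ _ cE] := rs.
have tE : curve D i t = param c (0, 1).
  by rewrite cE // st /curl; congr param; congr pair; ring.
have uE : curve D i u = param c (0, 1).
  by rewrite cE // su /curl; congr param; congr pair; ring.
(* t and u are less than a period apart *)
have nsame : ~ same_point i t i u.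
  move=> [_ [z uE']]; have z0 : z = 0.
    have [z1 z2] : (z%:~R : R) < 1 /\ -1 < (z%:~R : R).
      move: tI uI; rewrite uE'; move: (z%:~R : R) => r /andP[? ?] /andP[? ?].
      by have lt := ba1; split; lra.
    have N1 : (-1 : R) = (-1)%:~R by rewrite mulrNz.
    by move: z1 z2; rewrite ltrz1 N1 ltr_int; lia.
  by move: su; rewrite uE' z0 addr0 st; lra.
have dp : double_point (curve D) i t i u by split; rewrite ?tE ?uE.
by have := double_point_crossing dp; rewrite tE.
Qed.

Lemma curl_model : local_model T c K (curl_rules d T) D (@curl_type R).
Proof.
split.
- move=> p Kp nU; have h : curl_eq p <> 0 by move/(U_curl Kp).
  by apply: filterS (curl_type_near h) => q [].
- move=> phi [lc rule]; have [G GE] := curl_class_fun lc.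
  exists G => //.
  have [c0 [v [w [cr vw]]]] := curl_crossing_exists.
  have Kp0 : K (0, 1) by split=> /=; apply/andP; split; lra.
  have [_ ca] := curl_crossing pc Kc ab meets rs cr (ex_intro2 _ _ _ Kp0 erefl).
  exact: (crossing_rule_curl ca GE vw (rule _ _ _ _ cr)).
- move=> G phi rG phiG c0 x v w cr xK.
  have [_ ca] := curl_crossing pc Kc ab meets rs cr xK.
  exact: (curl_crossing_rule ca phiG).
Qed.

End CurlModel.

Lemma curl_type_side (R : realType) (x y : R) : x = -6 \/ x = 6 -> -1 <= y <= 5 ->
  curl_type (x, y) = if 4 < y then CurlTop else CurlOuter.
Proof.
move=> x6 /andP[y1 y2]; rewrite /curl_type /curl_eq /=.
have -> : x ^+ 2 = 36 by case: x6 => ->; rewrite expr2; ring.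
have [y4|y4] := ltrP 4 y.
  have -> : 1 < y by lra.
  have -> // : 36 - y * (y - 1) ^+ 2 < 0.
  have : 9 < (y - 1) ^+ 2 by rewrite expr2; nra.
  by move=> h; nra.
have -> // : (36 - y * (y - 1) ^+ 2 < 0) = false.
apply/negbTE; rewrite -leNgt; have [y0|y0] := lerP y 0.
  by rewrite subr_ge0 (@le_trans _ _ 0) // mulr_le0_ge0 // sqr_ge0.
have h : (y - 1) ^+ 2 <= 9 by rewrite expr2; nra.
by have := sqr_ge0 (y - 1); nra.
Qed.

Lemma curl_type_bottom (R : realType) (x : R) : curl_type (x, -1) = CurlOuter.
Proof.
rewrite /curl_type /curl_eq /=.
have -> // : (x ^+ 2 - -1 * (-1 - 1) ^+ 2 < 0) = false.
by apply: lt_gtF; have := sqr_ge0 x; rewrite [(-1 - 1) ^+ 2]expr2; lra.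
Qed.

Lemma curl_type_top (R : realType) (x : R) : -6 <= x <= 6 -> curl_type (x, 5) = CurlTop.
Proof.
move=> /andP[x1 x2]; rewrite /curl_type /curl_eq /=.
have -> : (1 : R) < 5 by lra.
have -> // : x ^+ 2 - 5 * (5 - 1) ^+ 2 < 0.
by rewrite !expr2; nra.
Qed.

Section MoveOne.
Variables (R : realType) (S : oriented_surface R) (n : nat).
Variables (X : Type) (T : X -> X -> X -> X).
Hypothesis qT : ternary_quasigroup T.

Lemma loop_solve (d : bool) (t o : X) : exists l, curl_rules d T
  (fun r => match r with CurlTop => t | CurlLoop => l | CurlOuter => o end).
Proof.
have [q1 _ q3] := qT; rewrite /curl_rules; case: d.
- by have [l [lE _]] := q1 o t o; exists l; rewrite lE.
- by have [l [lE _]] := q3 t o o; exists l; rewrite lE.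
Qed.

Lemma loop_unique (d : bool) G1 G2 : curl_rules d T G1 -> curl_rules d T G2 ->
  G1 CurlTop = G2 CurlTop -> G1 CurlOuter = G2 CurlOuter -> forall r, G1 r = G2 r.
Proof.
have qf := quasigroup_face qT; rewrite /curl_rules => r1 r2 tE oE [] //.
case: d r1 r2 => r1 r2.
- have [_ u _ _] := qf (G1 CurlLoop) (G1 CurlOuter) (G1 CurlTop)
    (G2 CurlLoop) (G2 CurlOuter) (G2 CurlTop).
  by apply: u => //; rewrite -r1 -r2.
- have [_ _ _ u] := qf (G1 CurlTop) (G1 CurlOuter) (G1 CurlLoop)
    (G2 CurlTop) (G2 CurlOuter) (G2 CurlLoop).
  by apply: u => //; rewrite -r1 -r2.
Qed.

(** The loop does not occur on this side of the move. *)
Definition straight_type (f : R -> R) (p : plane R) : curl_region :=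
  if f p.1 < p.2 then CurlTop else CurlOuter.

Lemma straight_model (D : diagram S n) c (i : 'I_n) (a b : R) (f : R -> R) s dir d :
  graph_tangle D c (fun _ : 'I_1 => i) (fun _ => a) (fun _ => b) (fun _ => f)
    (-6) 6 (-1) 5 s dir (fun _ _ => False) ->
  local_model T c (rect (-6) 6 (-1) 5) (curl_rules d T) D (straight_type f).
Proof.
move=> gt; split.
- move=> p Kp nU; apply: filterS (graph_type_near gt Kp nU) => q H Kq.
  have := congr1 (fun t => t ord0) (H Kq).
  by rewrite /above_type /straight_type => ->.
- move=> phi [lc _].
  have [G0 G0E] : exists G, forall p, rect (-6) 6 (-1) 5 p -> ~ universe D (param c p) -> True ->
      phi (param c p) = G (above_type (fun _ : 'I_1 => f) p).
    apply: (slab_fun gt lc _ (B := fun=> True)); first by lra.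
    by move=> k l ? ? ?; rewrite (ord1 k) (ord1 l) eqxx.
  have [l lE] := loop_solve d (G0 (fun=> true)) (G0 (fun=> false)).
  eexists; first exact: lE.
  move=> p Kp nU; rewrite G0E // /straight_type.
  have -> : above_type (fun _ : 'I_1 => f) p = (fun=> f p.1 < p.2) by [].
  by case: (f p.1 < p.2).
- move=> G phi _ _ c0 x v w cr xK.
  have [k [l [_ [_ [_ [kl _ _ _ _]]]]]] := graph_crossing (gt_chart gt) (gt_dom gt) (gt_ab gt)
    (gt_meets gt) (gt_graph gt) (gt_runs gt) (gt_ends gt) cr xK.
  by rewrite (ord1 k) (ord1 l) eqxx in kl.
Qed.

(** The color of the loop is the only unknown of the equation at the new crossing.
*)
Lemma R1_colorings (D D' : diagram S n) : R1_move D D' ->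
  (colorings D T #= colorings D' T)%card.
Proof.
have n66 : (-6 : R) <= 6 by lra.
have n15 : (-1 : R) <= 5 by lra.
have n45 : (4 : R) < 5 by lra.
have n41 : (-1 : R) < 4 by lra.
move=> [c [i [a [b [f [sup gr /traces_runs[[s dir] /= rs] /traces_runs[[s' d] /= rs']]]]]]].
have sup' := supported_in_sym sup.
have [[pc Kc] ab m1 m2 off] := sup; have [cc _] := pc.
have /andP[ab1 ba1] := ab ord0.
have gt : graph_tangle D c (fun _ : 'I_1 => i) (fun _ => a) (fun _ => b) (fun _ => f)
    (-6) 6 (-1) 5 (fun _ => s) (fun _ => dir) (fun _ _ => False).
  by split=> // k l; rewrite (ord1 k) (ord1 l) eqxx.
have [f6 f6'] : f (-6) = 4 /\ f 6 = 4.
  have endE t : t = a \/ t = b -> graph_of f (s t) = curl (s' t).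
    move=> te.
    have tI : a <= t <= b by case: te => ->; rewrite lexx ltW.
    have := strand_end_outside sup (gt_graph gt) (gt_runs gt) (gt_ends gt) (k := ord0) te.
    have [_ _ -> //] := rs; have [_ _ -> //] := rs'.
    apply: (param_inj cc); first exact/Kc/(graph_in_rect (gt_graph gt) ord0)/(runs_in_cc ab1 rs).
    exact/Kc/curl_in/(runs_in_cc ab1 rs').
  have [a1 a2] := endE a (or_introl erefl); have [b1 b2] := endE b (or_intror erefl).
  have sq (u : R) : u = -2 \/ u = 2 -> u ^+ 2 = 4 by case=> ->; rewrite expr2; ring.
  have ea : s' a ^+ 2 = 4 by apply: sq; case: (runs_ends rs') => -[-> _]; [left|right].
  have eb : s' b ^+ 2 = 4 by apply: sq; case: (runs_ends rs') => -[_ ->]; [right|left].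
  by case: (runs_ends rs) a2 b2 => -[-> ->]; rewrite ea eb.
have ag : agree_off c (rect (-6) 6 (-1) 5) (orect (-6) 6 (-1) 5) D D'.
  apply: (supported_agree (@rect_compact _ _ _ _ _) sup).
  exact: (graph_strand_inside sup (gt_graph gt) (gt_runs gt)).
have ag' : agree_off c (rect (-6) 6 (-1) 5) (orect (-6) 6 (-1) 5) D' D.
  apply: (supported_agree (@rect_compact _ _ _ _ _) sup') => k t tI.
  exists (curl (s' t)); first exact/curl_inside/(runs_in_oo ab1 rs').
  by have [_ _ -> //] := rs'; case/andP: tI => ? ?; rewrite !ltW.
have topR : rect (-6) 6 (-1) 5 ((-6, 5) : plane R) by split; rewrite /= lexx ?n66 ?n15.
have botR : rect (-6) 6 (-1) 5 ((-6, -1) : plane R) by split; rewrite /= lexx ?n66 ?n15.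
have topO : ~ orect (-6) 6 (-1) 5 ((-6, 5) : plane R) by move=> []; rewrite /= ltxx.
have botO : ~ orect (-6) 6 (-1) 5 ((-6, -1) : plane R) by move=> []; rewrite /= ltxx.
have offU p : rect (-6) 6 (-1) 5 p -> f p.1 <> p.2 -> ~ universe D (param c p).
  move=> Kp ne /(graph_universe (gt_chart gt) (gt_dom gt) (gt_ab gt) (gt_meets gt)
    (gt_graph gt) (gt_runs gt) Kp) [_]; exact: ne.
have topU : ~ universe D (param c (-6, 5)) by apply: offU => //=; rewrite f6; apply/eqP; rewrite lt_eqF.
have botU : ~ universe D (param c (-6, -1)) by apply: offU => //=; rewrite f6; apply/eqP; rewrite gt_eqF.
apply: (@local_move_card _ _ _ _ T c _ _ _ (curl_rules d T) D D' (straight_type f) (@curl_type R) cc Kc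
  (@rect_compact _ _ _ _ _) (@orect_open _ _ _ _ _) (@orect_sub _ _ _ _ _)) => //.
- exact: straight_model gt.
- have key := curl_model T pc Kc ab1 ba1 m2 rs'; exact: key.
- move=> [x y] Kp /(rect_boundary Kp) bd; have [/= /andP[x1 x2] /andP[y1 y2]] := Kp.
  have side_ : x = -6 \/ x = 6 -> straight_type f (x, y) = curl_type (x, y).
    move=> x6; rewrite (curl_type_side x6) ?y1 // /straight_type /=.
    by case: x6 => ->; rewrite ?f6 ?f6'.
  case: bd => /= E.
  + by apply: side_; left.
  + by apply: side_; right.
  + have [/(_ x) + _] := gr; rewrite x1 x2 => /(_ isT)/andP[fx1 fx2].
    by rewrite /straight_type /= E curl_type_bottom (lt_gtF fx1).
  + have [/(_ x) + _] := gr; rewrite x1 x2 => /(_ isT)/andP[fx1 fx2].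
    by rewrite /straight_type /= E curl_type_top ?x1 // fx2.
- by exists (-6, 5).
- move=> G1 G2 r1 r2 H; apply: (loop_unique r1 r2).
  + have := H _ topR topO topU; rewrite /straight_type /= f6.
    by rewrite n45.
  + have := H _ botR botO botU; rewrite /straight_type /= f6.
    by rewrite (lt_gtF n41).
Qed.

End MoveOne.

Theorem lemma3p10 (R : realType) (S : oriented_surface R) (n : nat)
    (D D' : diagram S n) (X : finType) (T : X -> X -> X -> X) :
  compact [set: S] \/ S = plane_surface R ->
  ktq T ->
  reidemeister_move D D' ->
  (colorings D T #= colorings D' T)%card.
Proof.
move=> _ kT; have [qT _ _] := kT.
case=> [|[]|[]|[]].
- exact: isotopy_colorings.
- exact: R1_colorings.
- by rewrite card_eq_sym; exact: R1_colorings.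
- exact: R2_colorings.
- by rewrite card_eq_sym; exact: R2_colorings.
- exact: R3_colorings.
- by rewrite card_eq_sym; exact: R3_colorings.
Qed.
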